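(* Let $A$ be a pseudo-homogeneous support set of cardinality $N=m+2$, and let $B$ be a rational lift of $A$, $A=TB$, which is an algebraic barycentric circuit with simplex vertices $\beta(0),\dots,\beta(m)$ and barycenter $\gamma$. Let $f\in\mathbb{C}^A$ and let $g=\Phi(f)\in\mathbb{C}^B$, written as $$g(\mathbf{w})=\sum_{j=0}^m c_j\mathbf{w}^{\beta(j)}-c_\gamma\mathbf{w}^{\gamma},\qquad c_0,\dots,c_m\in\mathbb{C}^*,\ c_\gamma\in\mathbb{C}.$$ If $\operatorname{eq}(g)\in H_T$ and $c_\gamma$ is not contained in the region $$\Bigg\{\prod_{j=0}^m|c_j|^{\frac1{1+m}}\cdot\sum_{j=0}^m e^{i\left(\arg(c_j)+\langle\beta(j)-\gamma,\phi\rangle\right)}\ :\ \phi\in[0,2\pi)^m\Bigg\}\subset\mathbb{C},$$ then $E_{T\gamma}(f)\neq\emptyset$.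
   Context: Setting: $A\subset\mathbb{R}^{1+n}$ is a finite set of cardinality $N$, whose elements are the columns of a $(1+n)\times N$ matrix also denoted $A$; pseudo-homogeneous means that there is a linear form $\xi$ with $\langle\xi,\alpha\rangle=1$ for all $\alpha\in A$. $\mathbb{C}^A$ is the space of exponential sums $f(\mathbf{z})=\sum_{\alpha\in A}c_\alpha e^{\langle\mathbf{z},\alpha\rangle}$, $c_\alpha\in\mathbb{C}$. The amoeba of $f$ is $\mathcal{A}(f)=\overline{\operatorname{Re}(V(f))}\subset\mathbb{R}^{1+n}$, with $V(f)\subset\mathbb{C}^{1+n}$ the zero set of $f$. Barycentric circuits: a set $\{\beta(0),\dots,\beta(m),\gamma\}$ of $m+2$ points is a barycentric circuit if $\beta(0),\dots,\beta(m)$ are the vertices of an $m$-dimensional simplex and $\gamma=\frac1{m+1}\sum_j\beta(j)$ is its barycenter; it is algebraic if all points are integer points. The convention is that $B$ is dehomogenized: $\beta(j),\gamma\in\mathbb{Z}^m$, and the matrix $B$ is the $(1+m)\times N$ matrix with columns $(1,\beta(0)),\dots,(1,\beta(m)),(1,\gamma)$. In the expression for $g$, $\mathbf{w}=(e^{y_1},\dots,e^{y_m})$ and the factor $e^{y_0}$ coming from the top row of ones is dropped. That $B$ is a lift of $A$ means $\operatorname{Row}(A)\subseteq\operatorname{Row}(B)$ (real row spans), i.e. $A=TB$ for a real $(1+n)\times(1+m)$ matrix $T$; the lift is rational if the rank of the matrix $B$ equals the rank of the abelian group generated by its columns. $\Phi\colon\mathbb{C}^A\to\mathbb{C}^B$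 is the isomorphism keeping the coefficients and replacing each column of $A$ in the exponent by the corresponding column of $B$. $H_T=\{\mathbf{x}T:\mathbf{x}\in\mathbb{R}^{1+n}\}\subset\mathbb{R}^{1+m}$ (row vectors). $\operatorname{eq}(g)\in\mathbb{R}^m$ is the unique point $\mathbf{y}$ at which all the terms $|c_j|e^{\langle\mathbf{y},\beta(j)\rangle}$, $j=0,\dots,m$, have the same value. The condition $\operatorname{eq}(g)\in H_T$ means $(y_0,\operatorname{eq}(g))\in H_T$ for $y_0\in\mathbb{R}$ (this does not depend on $y_0$, since pseudo-homogeneity of $A$ implies that $H_T$ contains $(1,0,\dots,0)$). $T\gamma$ denotes $T$ applied to the column $(1,\gamma)$, i.e. the element of $A$ corresponding to $\gamma$. Orders: let $\mathbb{Z}[A]$ be the abelian group generated by $A$ and $S=\operatorname{Hom}_{\mathbb{Z}}(\mathbb{Z}[A],\mathbb{S}^1)$ with (normalized) Haar measure $\eta$. For $\chi\in S$ put $f_\chi(\mathbf{x})=\sum_{\alpha\in A}c_\alpha\chi(\alpha)e^{\langle\mathbf{x},\alpha\rangle}$. The Ronkin function $N_f(\mathbf{x})=\int_S\log|f_\chi(\mathbf{x})|\,d\eta(\chi)$ has constant gradient on each connected component of $\mathbb{R}^{1+n}\setminus\mathcal{A}(f)$; this gradient is called the order of the component, and distinct components have distinct orders. $E_\alpha(f)$ denotes the component of order $\alpha$ (empty if there is none). *)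

(* Defs.v *)
From HB Require Import structures.
From mathcomp Require Import all_boot all_order all_algebra.
From mathcomp Require Import complex.
From mathcomp Require Import all_classical all_reals all_analysis.

Set Implicit Arguments.
Unset Strict Implicit.
Unset Printing Implicit Defensive.
Import Order.TTheory GRing.Theory Num.Theory.
Import numFieldNormedType.Exports.

Local Open Scope classical_set_scope.
Local Open Scope ring_scope.
Local Open Scope complex_scope.

(* Conventions: a point configuration in R^p is a p x N matrix whose columns
   are the points; exponents are column vectors and the variables x, z, y are
   row vectors, so that <z, alpha> is the product z *m alpha.  An element of
   C^A is given by its family of coefficients 'I_N -> R[i], indexed by the
   columns of A; the isomorphism Phi : C^A -> C^B is then the identity on
   coefficient families. *)

Section Complex.
Variable R : realType.

Definition modulus (z : R[i]) : R := Normc.normc z.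

Definition cexp (z : R[i]) : R[i] :=
  (expR (complex.Re z))%:C * (cos (complex.Im z) +i* sin (complex.Im z)).

(* Principal argument, in ]-pi, pi]. *)
Definition arg (z : R[i]) : R :=
  let t := acos (complex.Re z / modulus z) in if 0 <= complex.Im z then t else - t.

End Complex.

Section IntegerSpan.
Variables (R : realType) (p N : nat).

Definition zspan_set (A : 'M[R]_(p, N)) : set 'cV[R]_p :=
  [set v | exists k : 'I_N -> int, v = \sum_j col j A *~ k j].

Definition zspan_pred (A : 'M[R]_(p, N)) : {pred 'cV[R]_p} :=
  fun v => `[< zspan_set A v >].

Lemma zspan_zmod_closed (A : 'M[R]_(p, N)) : zmod_closed (zspan_pred A).
Proof.
split=> [|u v /asboolP[k ->] /asboolP[l ->]]; apply/asboolP.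
  by exists (fun=> 0); rewrite big1// => j _; rewrite mulr0z.
exists (fun j => k j - l j); rewrite -sumrB.
by apply: eq_bigr => j _; rewrite mulrzBr.
Qed.

HB.instance Definition _ (A : 'M[R]_(p, N)) :=
  GRing.isZmodClosed.Build _ (zspan_pred A) (zspan_zmod_closed A).

(* The abelian group Z[A]. *)
Record zspan (A : 'M[R]_(p, N)) :=
  ZSpan { zspan_val : 'cV[R]_p; _ : zspan_val \in zspan_pred A }.

HB.instance Definition _ (A : 'M[R]_(p, N)) :=
  [isSub for @zspan_val A].
HB.instance Definition _ (A : 'M[R]_(p, N)) := [Choice of zspan A by <:].
HB.instance Definition _ (A : 'M[R]_(p, N)) :=
  [SubChoice_isSubZmodule of zspan A by <:].

Lemma zspan_col (A : 'M[R]_(p, N)) j : col j A \in zspan_pred A.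
Proof.
apply/asboolP; exists (fun i => (i == j)%:Z).
rewrite (bigD1 j)//= eqxx mulr1z big1 ?addr0// => i /negPf ->.
by rewrite mulr0z.
Qed.

Definition zspan_gen (A : 'M[R]_(p, N)) (j : 'I_N) : zspan A :=
  ZSpan (zspan_col A j).

Definition zfree r (v : 'I_r -> 'cV[R]_p) : Prop :=
  forall k : 'I_r -> int, \sum_i v i *~ k i = 0 -> forall i, k i = 0.

Definition zspan_rank (A : 'M[R]_(p, N)) (r : nat) : Prop :=
  (exists v : 'I_r -> 'cV[R]_p, (forall i, zspan_set A (v i)) /\ zfree v) /\
  (forall v : 'I_r.+1 -> 'cV[R]_p, (forall i, zspan_set A (v i)) -> ~ zfree v).

Definition rational_mx (A : 'M[R]_(p, N)) : Prop := zspan_rank A (\rank A).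

Definition pseudo_homogeneous (A : 'M[R]_(p, N)) : Prop :=
  exists xi : 'rV[R]_p, forall j, (xi *m col j A) 0 0 = 1.

End IntegerSpan.

Section Characters.
Variables (R : realType) (p N : nat).

(* The group S = Hom(Z[A], S^1). *)
Record character (A : 'M[R]_(p, N)) := Character {
  char_fun :> zspan A -> R[i];
  char_morph : forall u v, char_fun (u + v) = char_fun u * char_fun v;
  char_unit : forall u, modulus (char_fun u) = 1 }.

Variable A : 'M[R]_(p, N).

Lemma char_mul_morph (chi psi : character A) u v :
  chi (u + v) * psi (u + v) = (chi u * psi u) * (chi v * psi v).
Proof. by rewrite !char_morph mulrACA. Qed.

Lemma char_mul_unit (chi psi : character A) u : modulus (chi u * psi u) = 1.
Proof.
rewrite /modulus Normc.normcM [X in X * _](char_unit chi).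
by rewrite [X in _ * X](char_unit psi) mulr1.
Qed.

Definition char_mul (chi psi : character A) : character A :=
  Character (char_mul_morph chi psi) (char_mul_unit chi psi).

Lemma char_one_morph (u v : zspan A) : 1 = 1 * 1 :> R[i].
Proof. by rewrite mulr1. Qed.

Lemma char_one_unit (u : zspan A) : modulus (1 : R[i]) = 1.
Proof. exact: Normc.normc1. Qed.

Definition char_one : character A := Character char_one_morph char_one_unit.

HB.instance Definition _ := gen_eqMixin (character A).
HB.instance Definition _ := gen_choiceMixin (character A).
HB.instance Definition _ := isPointed.Build (character A) char_one.

(* Z[A] is discrete, so the compact-open topology of its dual is the topology
   of pointwise convergence. *)
Definition char_topology : Type :=
  initial_topology (fun chi : character A =>
    (char_fun chi : prod_topology (fun _ : zspan A => R[i]^o))).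

(* S with its Borel sigma-algebra. *)
Definition dual := g_sigma_algebraType (open : set (set char_topology)).

End Characters.

Section HaarMeasure.
Variables (R : realType) (p N : nat) (A : 'M[R]_(p, N)).

(* A Haar measure is a translation-invariant Borel measure; being a
   probability normalizes it. *)
Definition is_haar (eta : probability (dual A) R) : Prop :=
  forall (psi : character A) (E : set (dual A)), measurable E ->
    eta [set chi | E (char_mul psi chi)] = eta E.

End HaarMeasure.

Section ExponentialSums.
Variables (R : realType) (p N : nat).
Implicit Types (A : 'M[R]_(p, N)) (c : 'I_N -> R[i]).

Definition exp_sum A c (z : 'rV[R[i]]_p) : R[i] :=
  \sum_j c j * cexp ((z *m map_mx (real_complex R) (col j A)) 0 0).

Definition amoeba (f : 'rV[R[i]]_p -> R[i]) : set 'rV[R]_p :=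
  closure [set map_mx (@complex.Re R) z | z in [set z | f z = 0]].

Definition twisted_sum A c (chi : character A) (x : 'rV[R]_p) : R[i] :=
  \sum_j c j * chi (zspan_gen A j) * (expR ((x *m col j A) 0 0))%:C.

Definition ronkin A c (eta : probability (dual A) R) (x : 'rV[R]_p) : R :=
  fine (\int[eta]_(chi in [set: dual A])
          lne (modulus (twisted_sum c (chi : character A) x))%:E)%E.

Definition has_gradient (F : 'rV[R]_p -> R) (x : 'rV[R]_p) (alpha : 'cV[R]_p) :
  Prop := is_diff x F (fun v => (v *m alpha) 0 0).

Definition is_component (S C : set 'rV[R]_p) : Prop :=
  exists2 x, S x & C = connected_component S x.

(* E_alpha(f): distinct components have distinct orders, so the union below
   has at most one member. *)
Definition order_component A c (eta : probability (dual A) R)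
    (alpha : 'cV[R]_p) : set 'rV[R]_p :=
  \bigcup_(C in [set C | is_component (~` amoeba (exp_sum A c)) C /\
                         forall x, C x -> has_gradient (ronkin c eta) x alpha])
    C.

End ExponentialSums.

Section Circuits.
Variable R : realType.

Definition affinely_independent d k (b : 'I_k -> 'cV[R]_d) : Prop :=
  forall l : 'I_k -> R, \sum_j l j = 0 -> \sum_j l j *: b j = 0 ->
    forall j, l j = 0.

Definition barycentric_circuit d m (b : 'I_m.+1 -> 'cV[R]_d) (g : 'cV[R]_d) :
  Prop :=
  [/\ affinely_independent b, forall j, g != b j
    & g = m.+1%:R^-1 *: \sum_j b j].

Definition to_real d (v : 'cV[int]_d) : 'cV[R]_d := map_mx intr v.

(* A family indexed by the circuit: the vertices come first, the barycenter
   has the last index. *)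
Definition circuit_family m (X : Type) (b : 'I_m.+1 -> X) (g : X)
    (k : 'I_m.+2) : X := oapp b g (unlift ord_max k).

Definition lift_col m (v : 'cV[int]_m) : 'cV[R]_(1 + m) :=
  col_mx (const_mx 1) (to_real v).

Definition circuit_mx m (beta : 'I_m.+1 -> 'cV[int]_m) (gamma : 'cV[int]_m) :
    'M[R]_(1 + m, m.+2) :=
  \matrix_(i, k) lift_col (circuit_family beta gamma k) i 0.

(* y = eq(g), where c are the coefficients of the vertex terms of g. *)
Definition is_eq_point m (c : 'I_m.+1 -> R[i]) (beta : 'I_m.+1 -> 'cV[int]_m)
    (y : 'rV[R]_m) : Prop :=
  forall j k, modulus (c j) * expR ((y *m to_real (beta j)) 0 0) =
              modulus (c k) * expR ((y *m to_real (beta k)) 0 0).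

Definition H_ p q (T : 'M[R]_(p, q)) : set 'rV[R]_q :=
  [set x *m T | x in [set: 'rV[R]_p]].

Definition region m (c : 'I_m.+1 -> R[i]) (beta : 'I_m.+1 -> 'cV[int]_m)
    (gamma : 'cV[int]_m) : set R[i] :=
  [set (\prod_j modulus (c j) `^ (1 + m)%:R^-1)%:C *
       \sum_j cexp (0 +i* (arg (c j) +
                           (phi *m to_real (beta j - gamma)) 0 0))
  | phi in [set phi : 'rV[R]_m | forall i, 0 <= phi 0 i < 2 * pi]].

End Circuits.

(* Main.v *)
(* Let x0 satisfy x0 T = (y0, eq(g)). At x0 every f_chi is, up to a factor of
   constant modulus, w - (u_0 + ... + u_m) for a point u of the torus of
   unimodular tuples with a prescribed product, where w is c_gamma divided by the
   geometric mean of the |c_j|; as c_gamma lies outside the region, the values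
   f_chi(x0) are uniformly bounded away from 0. By Hurwitz's theorem, Kronecker's
   density theorem and compactness, the complement of the amoeba consists of the
   points where such a uniform bound holds.

   Near such a point q, the product of the values of f_chi at the four points
   q + i^k v is f_chi(q)^4 up to O(|v|^3). Taking logarithms and averaging over chi,
   which absorbs imaginary translations, shows that the second difference of the
   Ronkin function is O(|v|^3), hence 0 by repeated halving of v: the Ronkin
   function is affine near q.

   To first order, N_f(x0 + v) - N_f(x0) - <v, T gamma> is the mean over chi of the
   turning of the argument of f_chi(x0 + i t v) e^(- i t <v, T gamma>) for t in
   [0, 1]. The torus sum above avoids 0 and is even along each coordinate axis of
   the torus, so it has no winding and its argument lifts to a bounded function;
   the accumulated turning along v, 2v, 3v, ... stays bounded and by invariance of
   the Haar measure the mean turning is 0. So the gradient at x0 is T gamma, and it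
   is constant on the component of x0 by connectedness. *)

Require Import Defs.
From HB Require Import structures.
From mathcomp Require Import all_boot all_order all_algebra.
From mathcomp Require Import complex.
From mathcomp Require Import all_classical all_reals all_analysis.
From mathcomp Require Import measurable_realfun.
From mathcomp Require Import ring lra.

Set Implicit Arguments.
Unset Strict Implicit.
Unset Printing Implicit Defensive.
Import Order.TTheory GRing.Theory Num.Theory.
Import numFieldNormedType.Exports.

Local Open Scope classical_set_scope.
Local Open Scope ring_scope.

(** Harmonicity of log |f_chi| along complex lines enters only in discrete form. A step in the
    imaginary direction replaces chi by its product with a fixed character, which the Haar mean does
    not see; of the four neighbours q + i^k v only the two real ones then survive in the mean. The
    cubic order of the error is essential: halving v turns one second difference into a combination
    of weight 4, so a quadratic bound would merely reproduce itself.

    The obstacle on the amoeba side is that f only sees the characters e^(i <theta, .>), a subgroup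
    that need not be closed, while the Ronkin function averages over all of S. This is why bounds
    uniform in theta, and not mere absence of zeros, are carried along.

    No continuous branch of the argument is constructed. Arguments are sampled at finitely many
    nodes, consecutive values forming an acute angle, and the angles are added up. Evenness makes a
    loop along a coordinate axis of the torus return by the values on which it came, since the
    angles - pi and pi are the same point: its total turning is 0. *)

Section Modulus.
Variable R : realType.
Implicit Types z w : R[i].

Lemma modulus_ge0 z : 0 <= modulus z.
Proof. by case: z => a b; exact: sqrtr_ge0. Qed.

Lemma modulusM z w : modulus (z * w) = modulus z * modulus w.
Proof. exact: Normc.normcM. Qed.

Lemma modulusD z w : modulus (z + w) <= modulus z + modulus w.
Proof. exact: le_normcD. Qed.

Lemma modulusN z : modulus (- z) = modulus z.
Proof. exact: normcN. Qed.

Lemma modulus0 : modulus (0 : R[i]) = 0.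
Proof. exact: Normc.normc0. Qed.

Lemma modulus1 : modulus (1 : R[i]) = 1.
Proof. exact: Normc.normc1. Qed.

Lemma modulus_eq0 z : (modulus z == 0) = (z == 0).
Proof.
by apply/eqP/eqP => [/Normc.eq0_normc //|->]; rewrite modulus0.
Qed.

Lemma modulus_gt0 z : (0 < modulus z) = (z != 0).
Proof. by rewrite lt_neqAle eq_sym modulus_eq0 modulus_ge0 andbT. Qed.

Lemma modulusV z : modulus z^-1 = (modulus z)^-1.
Proof. exact: Normc.normcV. Qed.

Lemma modulusX z k : modulus (z ^+ k) = modulus z ^+ k.
Proof.
elim: k => [|k IH]; first by rewrite !expr0 modulus1.
by rewrite !exprS modulusM IH.
Qed.

Lemma modulus_distC z w : modulus (z - w) = modulus (w - z).
Proof. by rewrite -opprB modulusN. Qed.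

Lemma modulus_triangle z w : modulus z - modulus w <= modulus (z - w).
Proof. by rewrite lerBlDr -{1}(subrK w z) modulusD. Qed.

Lemma modulus_sum I (r : seq I) (P : pred I) (F : I -> R[i]) :
  modulus (\sum_(i <- r | P i) F i) <= \sum_(i <- r | P i) modulus (F i).
Proof.
elim/big_ind2: _ => [|x a y b xa yb|//]; first by rewrite modulus0.
exact: le_trans (modulusD _ _) (lerD _ _).
Qed.

Lemma modulus_real (a : R) : modulus a%:C%C = `|a|.
Proof. by rewrite /modulus /= expr0n addr0 sqrtr_sqr. Qed.

Lemma sqr_modulus z : modulus z ^+ 2 = complex.Re z ^+ 2 + complex.Im z ^+ 2.
Proof. by case: z => a b /=; rewrite /modulus /= sqr_sqrtr// addr_ge0// sqr_ge0. Qed.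

Lemma normRe_le_modulus z : `|complex.Re z| <= modulus z.
Proof.
rewrite -(@ler_pXn2r _ 2) ?nnegrE ?modulus_ge0//.
by rewrite sqr_modulus real_normK ?num_real// lerDl sqr_ge0.
Qed.

Lemma normIm_le_modulus z : `|complex.Im z| <= modulus z.
Proof.
rewrite -(@ler_pXn2r _ 2) ?nnegrE ?modulus_ge0//.
by rewrite sqr_modulus real_normK ?num_real// lerDr sqr_ge0.
Qed.

Lemma modulus_le_ReIm z : modulus z <= `|complex.Re z| + `|complex.Im z|.
Proof.
rewrite -(@ler_pXn2r _ 2) ?nnegrE ?modulus_ge0 ?addr_ge0//.
rewrite sqr_modulus sqrrD !real_normK ?num_real//.
by rewrite lerD2r lerDl mulrn_wge0// mulr_ge0.
Qed.

Lemma complexReD z w : complex.Re (z + w) = complex.Re z + complex.Re w.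
Proof. by case: z; case: w. Qed.
Lemma complexImD z w : complex.Im (z + w) = complex.Im z + complex.Im w.
Proof. by case: z; case: w. Qed.
Lemma complexReN z : complex.Re (- z) = - complex.Re z.
Proof. by case: z. Qed.
Lemma complexImN z : complex.Im (- z) = - complex.Im z.
Proof. by case: z. Qed.
Lemma complexReM z w : complex.Re (z * w) =
  complex.Re z * complex.Re w - complex.Im z * complex.Im w.
Proof. by case: z; case: w. Qed.
Lemma complexImM z w : complex.Im (z * w) =
  complex.Re z * complex.Im w + complex.Im z * complex.Re w.
Proof. by case: z; case: w. Qed.

Lemma complexReZ (a : R) z : complex.Re (a%:C%C * z) = a * complex.Re z.
Proof. by case: z => ? ? /=; rewrite mul0r subr0. Qed.
Lemma complexImZ (a : R) z : complex.Im (a%:C%C * z) = a * complex.Im z.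
Proof. by case: z => ? ? /=; rewrite mul0r addr0. Qed.

Lemma complexRe_sum I (r : seq I) (P : pred I) (F : I -> R[i]) :
  complex.Re (\sum_(i <- r | P i) F i) = \sum_(i <- r | P i) complex.Re (F i).
Proof. exact: (big_morph _ complexReD). Qed.
Lemma complexIm_sum I (r : seq I) (P : pred I) (F : I -> R[i]) :
  complex.Im (\sum_(i <- r | P i) F i) = \sum_(i <- r | P i) complex.Im (F i).
Proof. exact: (big_morph _ complexImD). Qed.

Lemma complex_ext z w : complex.Re z = complex.Re w -> complex.Im z = complex.Im w -> z = w.
Proof. by case: z => a b; case: w => c d /= -> ->. Qed.

End Modulus.

(** * The complex exponential and unimodular phases *)

Section Exponential.
Variable R : realType.
Implicit Types z w : R[i].

Lemma cexpD z w : cexp (z + w) = cexp z * cexp w.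
Proof.
case: z w => [a b] [c d]; apply: complex_ext;
  rewrite /cexp /= expRD ?cosD ?sinD; ring.
Qed.

Lemma cexp0 : cexp (0 : R[i]) = 1.
Proof. by apply: complex_ext; rewrite /cexp /= expR0 cos0 sin0; ring. Qed.

Lemma modulus_cexp z : modulus (cexp z) = expR (complex.Re z).
Proof.
rewrite /cexp modulusM modulus_real ger0_norm ?expR_ge0//.
by rewrite /modulus /= cos2Dsin2 sqrtr1 mulr1.
Qed.

Lemma cexp_neq0 z : cexp z != 0.
Proof. by rewrite -modulus_gt0 modulus_cexp expR_gt0. Qed.

Lemma cexpN z : cexp (- z) = (cexp z)^-1.
Proof.
by apply: (mulfI (cexp_neq0 z)); rewrite -cexpD subrr cexp0 divff ?cexp_neq0.
Qed.

Lemma cexp_real (a : R) : cexp a%:C%C = (expR a)%:C%C.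
Proof. by apply: complex_ext; rewrite /cexp /= cos0 sin0; ring. Qed.

Definition cis (t : R) : R[i] := cexp (0 +i* t)%C.

Lemma cisE t : cis t = (cos t +i* sin t)%C.
Proof. by apply: complex_ext; rewrite /cis /cexp /= expR0; ring. Qed.

Lemma cis0 : cis 0 = 1.
Proof. exact: cexp0. Qed.

Lemma cisD s t : cis (s + t) = cis s * cis t.
Proof. by rewrite /cis -cexpD; congr cexp; apply: complex_ext => /=; rewrite ?addr0. Qed.

Lemma cisN t : cis (- t) = (cis t)^-1.
Proof. by rewrite /cis -cexpN; congr cexp; apply: complex_ext => /=; rewrite ?oppr0. Qed.

Lemma modulus_cis t : modulus (cis t) = 1.
Proof. by rewrite modulus_cexp /= expR0. Qed.

Lemma cis_neq0 t : cis t != 0.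
Proof. exact: cexp_neq0. Qed.

Lemma cis_sum I (r : seq I) (P : pred I) (F : I -> R) :
  cis (\sum_(i <- r | P i) F i) = \prod_(i <- r | P i) cis (F i).
Proof. exact: (big_morph _ cisD cis0). Qed.

Lemma cis_pi : cis pi = -1.
Proof. by rewrite cisE cospi sinpi; apply: complex_ext => /=; rewrite ?oppr0. Qed.

Lemma cis2pi : cis (2 * pi) = 1.
Proof. by rewrite mulr_natl mulr2n cisD cis_pi mulrNN mulr1. Qed.

Lemma cis2pi_nat k : cis (2 * pi *+ k) = 1.
Proof.
by elim: k => [|k IH]; rewrite ?mulr0n ?cis0// mulrS cisD IH mulr1 cis2pi.
Qed.

Lemma cis2pi_int (k : int) : cis (2 * pi *~ k) = 1.
Proof.
case: k => k; first exact: cis2pi_nat.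
by rewrite NegzE mulrNz cisN cis2pi_nat invr1.
Qed.

Lemma cis_split t s : cexp (t +i* s)%C = (expR t)%:C%C * cis s.
Proof. by rewrite /cis -cexp_real -cexpD; congr cexp; apply: complex_ext => /=; rewrite ?addr0 ?add0r. Qed.

End Exponential.

(** * Taylor remainders of the complex exponential *)

Section Taylor.
Variable R : realType.
Implicit Types z w : R[i].

Definition cexp_rem k z : R[i] := cexp z - \sum_(i < k) z ^+ i / i`!%:R.

(** Along the ray through z, differentiation lowers the order of the remainder by one and produces a
    factor z. This drives the induction on the order; real and imaginary parts are separated so that
    the real mean value theorem applies to each. *)
Lemma is_derive_cexp_rem k z (t : R) :
  is_derive t 1 (fun t => complex.Re (cexp_rem k.+1 (t%:C%C * z)))
    (complex.Re (z * cexp_rem k (t%:C%C * z))) /\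
  is_derive t 1 (fun t => complex.Im (cexp_rem k.+1 (t%:C%C * z)))
    (complex.Im (z * cexp_rem k (t%:C%C * z))).
Proof.
case: z => a b.
have HE : forall s : R, cexp (s%:C%C * (a +i* b)%C) =
    (expR (s * a) * cos (s * b) +i* (expR (s * a) * sin (s * b)))%C.
  move=> s; apply: complex_ext; rewrite /cexp /= !mul0r ?subr0 ?addr0 //.
have HC : is_derive t 1 (fun s : R => expR (s * a) * cos (s * b))
   (a * (expR (t * a) * cos (t * b)) - b * (expR (t * a) * sin (t * b))).
  apply: is_derive_eq; rewrite /GRing.scale /=; ring.
have HS : is_derive t 1 (fun s : R => expR (s * a) * sin (s * b))
   (a * (expR (t * a) * sin (t * b)) + b * (expR (t * a) * cos (t * b))).
  apply: is_derive_eq; rewrite /GRing.scale /=; ring.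
have remS : forall j (s : R), cexp_rem j.+1 (s%:C%C * (a +i* b)%C) =
    cexp_rem j (s%:C%C * (a +i* b)%C)
      - (s ^+ j)%:C%C * ((a +i* b)%C ^+ j / j`!%:R).
  by move=> j s; rewrite /cexp_rem big_ord_recr /= opprD addrA exprMn mulrA rmorphXn.
elim: k => [|k [IHr IHi]].
  have rem1 : forall s : R, cexp_rem 1 (s%:C%C * (a +i* b)%C) =
     cexp (s%:C%C * (a +i* b)%C) - 1.
    by move=> s; rewrite /cexp_rem big_ord1 expr0 fact0 invr1 mulr1.
  have -> : cexp_rem 0 (t%:C%C * (a +i* b)%C) = cexp (t%:C%C * (a +i* b)%C).
    by rewrite /cexp_rem big_ord0 subr0.
  rewrite HE /=; split.
    rewrite (_ : (fun _ => _) = (fun s : R => expR (s * a) * cos (s * b)) - cst 1).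
      apply: is_derive_eq; first by rewrite subr0.
    by apply/funext => s; rewrite rem1 HE.
  rewrite (_ : (fun _ => _) = (fun s : R => expR (s * a) * sin (s * b)) - cst 0).
    by apply: is_derive_eq; rewrite subr0.
  by apply/funext => s; rewrite rem1 HE.
set d := ((a +i* b)%C ^+ k.+1 / (k.+1)`!%:R).
have Hd : k.+1%:R%:C%C * d = (a +i* b)%C * ((a +i* b)%C ^+ k / k`!%:R).
  rewrite /d factS natrM exprS rmorph_nat.
  have h1 : (k.+1%:R : R[i]) != 0 by rewrite pnatr_eq0.
  have h2 : (k`!%:R : R[i]) != 0 by rewrite pnatr_eq0 -lt0n fact_gt0.
  by field; rewrite h2 nat1r h1.
have HX : forall c : R, is_derive t 1 (fun s : R => s ^+ k.+1 * c) (t ^+ k * (k.+1%:R * c)).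
  move=> c; have := is_deriveM (is_deriveX k.+1 (is_derive_id t (1 : R)))
    (is_derive_cst c t (1 : R)).
  rewrite (_ : _ * _ = (fun s : R => s ^+ k.+1 * c)); last first.
    by apply/funext => s; rewrite /= fctE exprfctE.
  by move=> h; apply: is_derive_eq; rewrite /GRing.scale /=; ring.
split.
  rewrite (_ : (fun _ => _) = (fun s : R => complex.Re (cexp_rem k.+1 (s%:C%C * (a +i* b)%C)))
     - (fun s => s ^+ k.+1 * complex.Re d)); last first.
    by apply/funext => s; rewrite remS complexReD complexReN complexReZ.
  apply: is_derive_eq.
  rewrite [in RHS]remS [in RHS]mulrBr [RHS]complexReD complexReN; congr (_ - _).
  by rewrite [in RHS]mulrCA -Hd !complexReZ.
rewrite (_ : (fun _ => _) = (fun s : R => complex.Im (cexp_rem k.+1 (s%:C%C * (a +i* b)%C)))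
   - (fun s => s ^+ k.+1 * complex.Im d)); last first.
  by apply/funext => s; rewrite remS complexImD complexImN complexImZ.
apply: is_derive_eq.
rewrite [in RHS]remS [in RHS]mulrBr [RHS]complexImD complexImN; congr (_ - _).
by rewrite [in RHS]mulrCA -Hd !complexImZ.
Qed.

Lemma norm_le_of_derive_le (g g' : R -> R) (C : R) (k : nat) :
  (forall t : R, is_derive t (1 : R) g (g' t)) -> g 0 = 0 ->
  (forall t, 0 <= t <= 1 -> `|g' t| <= C * t ^+ k) ->
  forall t, 0 <= t <= 1 -> `|g t| <= C * t ^+ k.+1.
Proof.
move=> dg g0 bg t /andP[t0 t1].
have [->|tn0] := eqVneq t 0; first by rewrite g0 normr0 expr0n mulr0.
have {}t0 : 0 < t by rewrite lt_neqAle eq_sym tn0.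
have cg : {within `[0, t], continuous g}.
  apply: continuous_subspaceT => s; apply: differentiable_continuous.
  by apply/derivable1_diffP; exact: (@ex_derive _ _ _ _ _ _ _ (dg s)).
have [s /[!in_itv]/= /andP[s0 st] ] := MVT t0 (fun s _ => dg s) cg.
rewrite g0 !subr0 => ->.
rewrite normrM (gtr0_norm t0) exprSr mulrA ler_wpM2r ?(ltW t0)//.
have s1 : 0 <= s <= 1 by rewrite (ltW s0) (le_trans (ltW st) t1).
apply: (le_trans (bg s s1)); have := bg 1; rewrite lexx ler01 expr1n mulr1 => /(_ isT) C0.
rewrite ler_wpM2l ?(le_trans _ C0)//.
by rewrite lerXn2r ?nnegrE ?(ltW s0) ?(ltW st)// (le_trans (ltW s0) (ltW st)).
Qed.

Lemma cexp_rem_bound k : exists C : R, 0 <= C /\ forall z, modulus z <= 1 ->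
  modulus (cexp_rem k z) <= C * modulus z ^+ k.
Proof.
suff [C [C0 HC]] : exists C : R, 0 <= C /\ forall z, modulus z <= 1 ->
    forall t : R, 0 <= t <= 1 ->
    modulus (cexp_rem k (t%:C%C * z)) <= C * modulus z ^+ k * t ^+ k.
  exists C; split=> // z z1; have := HC z z1 1.
  by rewrite ler01 lexx mul1r expr1n mulr1; apply.
elim: k => [|k [C [C0 IH]]].
  (* Order 0 is the exponential itself, of modulus at most e on the unit disc. *)
  exists (expR 1); split; first exact: expR_ge0.
  move=> z z1 t /andP[t0 t1].
  rewrite /cexp_rem big_ord0 subr0 !expr0 !mulr1 modulus_cexp ler_expR.
  rewrite complexReM /= mul0r subr0; apply: le_trans (ler_norm _) _.
  rewrite normrM ger0_norm// mulr_ile1//.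
  exact: le_trans (normRe_le_modulus z) z1.
(* The doubling comes from adding the separate bounds for the real and imaginary parts. *)
exists (2 * C); split; first by rewrite mulr_ge0.
move=> z z1 t t01.
have Hz0 : forall j, cexp_rem j.+1 (0%:C%C * z) = 0.
  move=> j; rewrite mul0r /cexp_rem cexp0 big_ord_recl big1 /= ?expr0.
    by rewrite fact0 invr1 mulr1 addr0 subrr.
  by move=> i _; rewrite exprS mul0r mul0r.
have b s : 0 <= s <= 1 -> modulus (z * cexp_rem k (s%:C%C * z)) <=
    (C * modulus z ^+ k.+1) * s ^+ k.
  move=> s01; rewrite modulusM exprS mulrCA -!mulrA ler_wpM2l ?modulus_ge0//.
  by rewrite !mulrA IH.
have hR := @norm_le_of_derive_le _ _ (C * modulus z ^+ k.+1) k
  (fun t => (is_derive_cexp_rem k z t).1).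
have hI := @norm_le_of_derive_le _ _ (C * modulus z ^+ k.+1) k
  (fun t => (is_derive_cexp_rem k z t).2).
apply: le_trans (modulus_le_ReIm _) _.
rewrite -mulrA -mulrA mulr_natl mulr2n mulrA lerD//.
  apply: hR => //; first by rewrite Hz0.
  by move=> s s01; exact: le_trans (normRe_le_modulus _) (b s s01).
apply: hI => //; first by rewrite Hz0.
by move=> s s01; exact: le_trans (normIm_le_modulus _) (b s s01).
Qed.

End Taylor.

(** * Exponential sums in one complex variable: expansion, minimum modulus, Hurwitz *)

Section ExponentialPolynomials.
Variables (R : realType) (J : finType).
Implicit Types (a : J -> R[i]) (l : J -> R).

Definition line_sum a l (s : R[i]) : R[i] := \sum_j a j * cexp ((l j)%:C%C * s).

(** This is the k-th derivative of [line_sum a l] at 0. *)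
Definition moment a l k : R[i] := \sum_j a j * (l j ^+ k)%:C%C.

(** A Vandermonde argument: if all moments of positive order vanish, the weights a_j l_j annihilate
    every polynomial, so each is 0. Then l vanishes at both [i0] and [i1], against injectivity. *)
Lemma exists_moment_neq0 a l (i0 i1 : J) : injective l -> i0 != i1 ->
  a i0 != 0 -> a i1 != 0 -> exists k, moment a l k.+1 != 0.
Proof.
move=> linj i01 a0 a1; apply: contrapT => /forallNP nz.
have mom0 k : \sum_j a j * (l j)%:C%C * (l j)%:C%C ^+ k = 0.
  have /negP/negPn/eqP := nz k; rewrite /moment => E; rewrite -[RHS]E.
  by apply: eq_bigr => j _; rewrite -mulrA -exprS rmorphXn.
have pol0 (q : {poly R[i]}) : \sum_j a j * (l j)%:C%C * q.[(l j)%:C%C] = 0.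
  under eq_bigr do rewrite horner_coef mulr_sumr.
  rewrite exchange_big big1// => k _.
  under eq_bigr do rewrite mulrCA.
  by rewrite -mulr_sumr mom0 mulr0.
have al0 i : a i * (l i)%:C%C = 0.
  (* This polynomial isolates the index i: it vanishes at every other frequency. *)
  pose q : {poly R[i]} := \prod_(j | j != i) ('X - ((l j)%:C%C)%:P).
  have := pol0 q; rewrite (bigD1 i)//= big1 ?addr0 => [/eqP|j ji].
    rewrite mulf_eq0 => /orP[/eqP//|].
    rewrite horner_prod => /prodf_eq0[j ji]; rewrite !hornerE subr_eq0.
    by move=> /eqP/complexI/linj/esym/eqP; rewrite (negPf ji).
  have -> : q.[(l j)%:C%C] = 0; last by rewrite mulr0.
  by apply/eqP; rewrite horner_prod; apply/prodf_eq0; exists j; rewrite ?hornerE ?subrr.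
have {}al0 i : a i != 0 -> l i = 0.
  move=> ai; have /eqP := al0 i; rewrite mulf_eq0 (negPf ai)/= => /eqP.
  by move=> [].
by have := linj i0 i1; rewrite !al0// => /(_ erefl)/eqP; rewrite (negPf i01).
Qed.

(** The constant is chosen before the coefficients and frequencies; this uniformity is what later
    allows integration over the characters. *)
Lemma line_sum_rem k : exists2 C : R, 0 <= C & forall a l s (L : R),
   (forall j, modulus ((l j)%:C%C * s) <= L) -> L <= 1 ->
   modulus (line_sum a l s - \sum_(i < k) moment a l i * (s ^+ i / i`!%:R))
     <= C * (\sum_j modulus (a j)) * L ^+ k.
Proof.
have [C [C0 HC]] := cexp_rem_bound R k; exists C => // a l s L lL L1.
have -> : line_sum a l s - \sum_(i < k) moment a l i * (s ^+ i / i`!%:R) =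
   \sum_j a j * cexp_rem k ((l j)%:C%C * s).
  rewrite /line_sum /cexp_rem.
  under [in RHS]eq_bigr do rewrite mulrBr.
  rewrite sumrB; congr (_ - _).
  under [in RHS]eq_bigr do rewrite mulr_sumr.
  rewrite exchange_big; apply: eq_bigr => i _ /=.
  rewrite /moment mulr_suml; apply: eq_bigr => j _.
  by rewrite exprMn rmorphXn /= -!mulrA.
apply: le_trans (modulus_sum _ _ _) _.
rewrite (mulrC C) -mulrA mulr_suml; apply: ler_sum => j _.
rewrite modulusM ler_wpM2l ?modulus_ge0//.
apply: le_trans (HC _ (le_trans (lL j) L1)) _.
rewrite ler_wpM2l// lerXn2r ?nnegrE ?modulus_ge0//.
exact: le_trans (modulus_ge0 _) (lL j).
Qed.

Lemma line_sum_taylor a l k : exists C r : R, [/\ 0 <= C, 0 < r &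
  forall s, modulus s <= r ->
   modulus (line_sum a l s - \sum_(i < k) moment a l i * (s ^+ i / i`!%:R))
     <= C * modulus s ^+ k].
Proof.
have [C C0 HC] := line_sum_rem k.
pose L := 1 + \sum_j `|l j|.
have lL j : `|l j| <= L.
  by rewrite /L (bigD1 j)//= addrCA lerDl addr_ge0// sumr_ge0.
have L0 : 0 < L by rewrite ltr_pwDl// sumr_ge0.
exists (C * (\sum_j modulus (a j)) * L ^+ k), L^-1; split.
- by rewrite !mulr_ge0 ?exprn_ge0 ?(ltW L0)// sumr_ge0// => j _; exact: modulus_ge0.
- by rewrite invr_gt0.
move=> s sL; rewrite -mulrA -exprMn; apply: HC.
  by move=> j; rewrite modulusM modulus_real ler_wpM2r ?modulus_ge0.
by rewrite -ler_pdivlMl// mulr1.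
Qed.

Lemma line_sum_leading a l (i0 i1 : J) : injective l -> i0 != i1 ->
  a i0 != 0 -> a i1 != 0 ->
  exists (k : nat) (b : R[i]) (C r : R), [/\ b != 0, 0 <= C, 0 < r & forall s, modulus s <= r ->
    modulus (line_sum a l s - line_sum a l 0 - b * s ^+ k.+1)
      <= C * modulus s ^+ k.+2].
Proof.
move=> linj i01 a0 a1.
have ex := exists_moment_neq0 linj i01 a0 a1.
case: (ex_minnP ex) => k mk kmin.
have [C [r [C0 r0 HC]]] := line_sum_taylor a l k.+2.
exists k, (moment a l k.+1 / (k.+1)`!%:R), C, r; split=> //.
  by rewrite mulf_neq0// invr_eq0 pnatr_eq0 -lt0n fact_gt0.
move=> s /HC; rewrite big_ord_recr big_ord_recl big1 /=; last first.
  move=> i _; apply/eqP; rewrite mulf_eq0; apply/orP; left.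
  by apply: contraT => /kmin; rewrite leqNgt ltn_ord.
rewrite expr0 fact0 invr1 !mulr1 addr0 opprD addrA.
have -> : line_sum a l 0 = moment a l 0.
  by apply: eq_bigr => j _; rewrite mulr0 cexp0 expr0.
by rewrite mulrA (mulrAC (moment a l _)).
Qed.

Lemma line_sum_shift a l s p :
  line_sum a l (p + s) = line_sum (fun j => a j * cexp ((l j)%:C%C * p)) l s.
Proof. by apply: eq_bigr => j _; rewrite mulrDr cexpD mulrA. Qed.

(** Past the constant P the expansion at p starts with a monomial b s^(k+1). In a direction w with b
    w^(k+1) = - P, a short step t multiplies P by 1 - t^(k+1), up to an error of higher order in
    t. *)
Lemma min_modulus_principle a l (i0 i1 : J) p (rho : R) : injective l -> i0 != i1 ->
  a i0 != 0 -> a i1 != 0 -> line_sum a l p != 0 -> 0 < rho ->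
  exists2 s, modulus s < rho & modulus (line_sum a l (p + s)) < modulus (line_sum a l p).
Proof.
move=> linj i01 a0 a1 Fp rho0.
have cp j : cexp ((l j)%:C%C * p) != 0 by exact: cexp_neq0.
have [k [b [C [r [b0 C0 r0 H]]]]] :=
  @line_sum_leading (fun j => a j * cexp ((l j)%:C%C * p)) l i0 i1 linj i01
    (mulf_neq0 a0 (cp i0)) (mulf_neq0 a1 (cp i1)).
move: H; set F := line_sum _ l; set P := line_sum a l p => H.
have FP : F 0 = P by rewrite /F -line_sum_shift addr0.
have P0 : 0 < modulus P by rewrite modulus_gt0.
pose w : R[i] := k.+1.-root (- P / b).
have wk : b * w ^+ k.+1 = - P by rewrite /w rootCK// mulrC divfK.
have w0 : 0 <= modulus w := modulus_ge0 _.
pose D := C * modulus w ^+ k.+2.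
have D0 : 0 <= D by rewrite mulr_ge0// exprn_ge0.
(* In order: 1 - t^(k+1) stays nonnegative, t w stays within the Taylor radius, t w is shorter than
   [rho], and the error t^(k+2) D is smaller than the gain t^(k+1) |P|. *)
pose t := Num.min 1 (Num.min (r / (1 + modulus w))
   (Num.min (rho / (2 * (1 + modulus w))) (modulus P / (2 * (1 + D))))).
have w1 : 0 < 1 + modulus w by rewrite ltr_pwDl.
have t0 : 0 < t.
  rewrite !lt_min ltr01 !divr_gt0// ?mulr_gt0// ltr_pwDl//.
have t1 : t <= 1 by rewrite ge_min lexx.
have tr : t * (1 + modulus w) <= r.
  by rewrite -ler_pdivlMr// !ge_min lexx !orbT.
have trho : t * (2 * (1 + modulus w)) <= rho.
  by rewrite -ler_pdivlMr ?mulr_gt0// !ge_min lexx !orbT.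
have tP : t * (2 * (1 + D)) <= modulus P.
  by rewrite -ler_pdivlMr ?mulr_gt0 ?ltr_pwDl// !ge_min lexx !orbT.
have mt : modulus (t%:C%C * w) = t * modulus w.
  by rewrite modulusM modulus_real gtr0_norm.
exists (t%:C%C * w).
  rewrite mt; nra.
rewrite line_sum_shift -/F -FP.
have mr : modulus (t%:C%C * w) <= r by rewrite mt; nra.
have := H _ mr; rewrite mt => H'.
have E : F (t%:C%C * w) = (1 - t ^+ k.+1)%:C%C * P +
    (F (t%:C%C * w) - F 0 - b * (t%:C%C * w) ^+ k.+1).
  rewrite FP exprMn mulrCA wk rmorphB rmorph1 rmorphXn /=; ring.
rewrite {}E; apply: le_lt_trans (modulusD _ _) _.
rewrite modulusM modulus_real ger0_norm ?subr_ge0 ?exprn_ile1 ?(ltW t0)//.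
apply: le_lt_trans (lerD (lexx _) H') _.
rewrite FP exprMn mulrCA -/D.
have tk : 0 < t ^+ k.+1 by rewrite exprn_gt0.
rewrite (exprSr t k.+1); move: (t ^+ k.+1) tk => T T0.
have : T * (t * (2 * (1 + D))) <= T * modulus P by rewrite ler_pM2l.
have : 0 < T * t by rewrite mulr_gt0.
have : 0 <= T * t * D by rewrite mulr_ge0// ltW// mulr_gt0.
have : 0 < T * modulus P by rewrite mulr_gt0.
nra.
Qed.

Lemma line_sum_lipschitz_at a l p : exists C r : R, [/\ 0 <= C, 0 < r &
  forall s, modulus s <= r ->
   modulus (line_sum a l (p + s) - line_sum a l p) <= C * modulus s].
Proof.
have [C [r [C0 r0 H]]] :=
  line_sum_taylor (fun j => a j * cexp ((l j)%:C%C * p)) l 1.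
exists C, r; split=> // s /H; rewrite big_ord1 expr0 fact0 invr1 !mulr1 expr1.
rewrite line_sum_shift; congr (modulus (_ - _) <= _).
by apply: eq_bigr => j _; rewrite expr0 mulr1.
Qed.

Lemma continuous_at_of_lipschitz (V : normedModType R) (f : V -> R) (p : V) (C r : R) :
  0 < r -> (forall q, `|q - p| < r -> `|f q - f p| <= C * `|q - p|) ->
  {for p, continuous f}.
Proof.
move=> r0 H; apply/cvgrPdist_lt => e e0.
near=> q.
have qr : `|q - p| < r.
  by rewrite distrC; near: q; apply/nbhs_ballP; exists r => //= q; rewrite -ball_normE.
have qe : `|q - p| < e / (1 + `|C|).
  rewrite distrC; near: q; apply/nbhs_ballP; exists (e / (1 + `|C|)) => /=.
    by rewrite divr_gt0// ltr_pwDl.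
  by move=> q; rewrite -ball_normE.
rewrite distrC; apply: le_lt_trans (H q qr) _.
move: qe; rewrite ltr_pdivlMr ?ltr_pwDl// => qe.
have := ler_norm C; have := normr_ge0 (q - p); nra.
Unshelve. all: by end_near. Qed.

Lemma continuous_modulus_line_sum a l :
  continuous (fun q : R * R => modulus (line_sum a l (q.1 +i* q.2)%C)).
Proof.
move=> p; have [C [r [C0 r0 H]]] := line_sum_lipschitz_at a l (p.1 +i* p.2)%C.
apply: (@continuous_at_of_lipschitz _ _ p (2 * C) (r / 2)); first lra.
move=> q qp.
have q12 : modulus ((q.1 - p.1) +i* (q.2 - p.2))%C <= 2 * `|q - p|.
  apply: le_trans (modulus_le_ReIm _) _ => /=.
  rewrite mulr_natl mulr2n lerD//.
    by rewrite /Num.norm/= le_max lexx.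
  by rewrite /Num.norm/= le_max lexx orbT.
have := H ((q.1 - p.1) +i* (q.2 - p.2))%C.
have -> : ((p.1 +i* p.2) + ((q.1 - p.1) +i* (q.2 - p.2)))%C = (q.1 +i* q.2)%C.
  by apply: complex_ext => /=; rewrite addrC subrK.
move=> /(_ _)/wrap[|H']; first by apply: le_trans q12 _; lra.
apply: (@le_trans _ _ (C * modulus ((q.1 - p.1) +i* (q.2 - p.2))%C)).
  apply: le_trans H'; rewrite ler_norml modulus_triangle andbT.
  by rewrite lerNl opprB modulus_distC modulus_triangle.
by rewrite (mulrC 2) -mulrA ler_wpM2l.
Qed.

(* Hurwitz: a minimum of the modulus over a small square is a zero, and the
   minimum cannot sit on the boundary, where the limit is bounded below. *)
Lemma hurwitz a l (i0 i1 : J) (rho : R) : injective l -> i0 != i1 ->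
  a i0 != 0 -> a i1 != 0 -> line_sum a l 0 = 0 -> 0 < rho ->
  exists2 e : R, 0 < e & forall a', (forall j, modulus (a' j - a j) < e) ->
    exists2 s, modulus s <= rho & line_sum a' l s = 0.
Proof.
move=> linj i01 a0 a1 F0 rho0.
have [k [b [C [r [b0 C0 r0 H]]]]] := line_sum_leading linj i01 a0 a1.
have B0 : 0 < modulus b by rewrite modulus_gt0.
(* For |s| <= 2t one has C |s| <= |b| / 2, so the leading monomial is at least twice the remainder;
   2t also stays within [rho] and within the Taylor radius. *)
pose t := Num.min (rho / 2) (Num.min (r / 2) (modulus b / (4 * (1 + C)))).
have t0 : 0 < t.
  by rewrite !lt_min !divr_gt0//  mulr_gt0// ltr_pwDl.
have trho : 2 * t <= rho by rewrite mulrC -ler_pdivlMr// !ge_min lexx.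
have tr : 2 * t <= r by rewrite mulrC -ler_pdivlMr// !ge_min lexx !orbT.
have tb : t * (4 * (1 + C)) <= modulus b.
  by rewrite -ler_pdivlMr ?mulr_gt0 ?ltr_pwDl// !ge_min lexx !orbT.
pose d := t ^+ k.+1 * modulus b / 4.
have d0 : 0 < d by rewrite divr_gt0// mulr_gt0// exprn_gt0.
(* An annulus is needed because the minimum is taken over a square of half-side t: its points
   outside the disc of radius t have modulus up to 2t. *)
have Fd s : t <= modulus s -> modulus s <= 2 * t ->
    2 * d <= modulus (line_sum a l s).
  move=> s1 s2.
  have := H s (le_trans s2 tr); rewrite F0 subr0 => Hs.
  have := modulus_triangle (b * s ^+ k.+1) (line_sum a l s).
  rewrite (modulus_distC (b * _)) modulusM modulusX.
  have sk : t ^+ k.+1 <= modulus s ^+ k.+1.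
    by rewrite lerXn2r ?nnegrE ?modulus_ge0// ltW.
  move: Hs; rewrite (exprSr _ k.+1) /d.
  move: (modulus s ^+ k.+1) sk => X sk.
  have T0 : 0 < t ^+ k.+1 by rewrite exprn_gt0.
  have h1 : C * modulus s <= modulus b / 2 by nra.
  have X0 : 0 < X by exact: lt_le_trans sk.
  have h2 : X * (C * modulus s) <= X * (modulus b / 2) by rewrite ler_pM2l.
  have h3 : t ^+ k.+1 * modulus b <= X * modulus b by rewrite ler_pM2r.
  nra.
pose E := 1 + \sum_j expR (`|l j| * (2 * t)).
have E0 : 0 < E by rewrite ltr_pwDl// sumr_ge0// => j _; exact: expR_ge0.
(* The last two bounds keep the perturbed coefficients at [i0] and [i1] nonzero, as the minimum
   modulus principle requires. *)
pose e := Num.min (d / E) (Num.min (modulus (a i0)) (modulus (a i1))).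
exists e.
  by rewrite !lt_min divr_gt0//= !modulus_gt0 a0 a1.
move=> a' Ha'.
have eE : e * E <= d by rewrite -ler_pdivlMr// ge_min lexx.
have ai i : e <= modulus (a i) -> a' i != 0.
  move=> ei; have := Ha' i; apply: contraTneq => ->.
  by rewrite sub0r modulusN -leNgt.
have a'0 : a' i0 != 0 by apply: ai; rewrite !ge_min lexx orbT.
have a'1 : a' i1 != 0 by apply: ai; rewrite !ge_min lexx !orbT.
have e0 : 0 < e by exact: le_lt_trans (modulus_ge0 _) (Ha' i0).
have FF s : modulus s <= 2 * t ->
    modulus (line_sum a' l s - line_sum a l s) < d.
  move=> st; rewrite /line_sum -sumrB; apply: le_lt_trans (modulus_sum _ _ _) _.
  apply: (@le_lt_trans _ _ (e * \sum_j expR (`|l j| * (2 * t)))).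
    rewrite mulr_sumr; apply: ler_sum => j _.
    rewrite -mulrBl modulusM; apply: ler_pM; rewrite ?modulus_ge0//; first exact: ltW.
    rewrite modulus_cexp ler_expR complexReZ; apply: le_trans (ler_norm _) _.
    by rewrite normrM ler_wpM2l// (le_trans _ st)// normRe_le_modulus.
  apply: lt_le_trans eE; rewrite ltr_pM2l// /E; lra.
pose K := (`[- t, t] `*` `[- t, t])%classic : set (R * R).
have Kc : compact K by apply: compact_setX; exact: segment_compact.
have K0 : K (0, 0) by split; rewrite /= in_itv /= oppr_le0 ltW.
have [[p1 p2] /set_mem[/= p1t p2t] pmin] :=
    compact_EVT_min (ex_intro _ _ K0) Kc (continuous_subspaceT
      (@continuous_modulus_line_sum a' l)).
move: p1t p2t; rewrite !in_itv/= -!ler_norml => p1t p2t.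
have p2t' : modulus (p1 +i* p2)%C <= 2 * t.
  by apply: le_trans (modulus_le_ReIm _) _; rewrite mulr_natl mulr2n lerD.
exists (p1 +i* p2)%C; first exact: le_trans trho.
apply/eqP; apply: contraT => Fp.
have Fpd : modulus (line_sum a' l (p1 +i* p2)%C) < d.
  have := pmin (0, 0) (mem_set K0) => /= /le_lt_trans; apply.
  have := FF 0; rewrite F0 subr0 modulus0; apply.
  by rewrite mulr_ge0// ltW.
have pt : modulus (p1 +i* p2)%C < t.
  rewrite ltNge; apply/negP => /Fd/(_ p2t').
  have := modulus_triangle (line_sum a l (p1 +i* p2)%C) (line_sum a' l (p1 +i* p2)%C).
  rewrite modulus_distC; have := FF _ p2t'; lra.
have [|s sr] := @min_modulus_principle a' l i0 i1 (p1 +i* p2)%C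
  (t - modulus (p1 +i* p2)%C) linj i01 a'0 a'1 Fp; first by rewrite subr_gt0.
case: s sr => s1 s2 sr; rewrite ltNge => /negP[].
apply: (pmin (p1 + s1, p2 + s2)); apply: mem_set.
have st : modulus ((p1 + s1) +i* (p2 + s2))%C <= t.
  apply: le_trans (modulusD (p1 +i* p2)%C (s1 +i* s2)%C) _; lra.
split; rewrite /= in_itv/= -ler_norml.
  exact: le_trans (normRe_le_modulus ((p1 + s1) +i* (p2 + s2))%C) st.
exact: le_trans (normIm_le_modulus ((p1 + s1) +i* (p2 + s2))%C) st.
Qed.

End ExponentialPolynomials.

(** * The pairing of row and column vectors *)

Section Pairing.
Variables (R : realType) (p : nat).
Implicit Types (x y : 'rV[R]_p) (u v : 'cV[R]_p).

Definition dot x v : R := (x *m v) 0 0.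

Lemma dotDl x y v : dot (x + y) v = dot x v + dot y v.
Proof. by rewrite /dot mulmxDl mxE. Qed.
Lemma dotDr x u v : dot x (u + v) = dot x u + dot x v.
Proof. by rewrite /dot mulmxDr mxE. Qed.
Lemma dotNl x v : dot (- x) v = - dot x v.
Proof. by rewrite /dot mulNmx mxE. Qed.
Lemma dotNr x v : dot x (- v) = - dot x v.
Proof. by rewrite /dot mulmxN mxE. Qed.
Lemma dotZl (k : R) x v : dot (k *: x) v = k * dot x v.
Proof. by rewrite /dot -scalemxAl mxE. Qed.
Lemma dotZr (k : R) x v : dot x (k *: v) = k * dot x v.
Proof. by rewrite /dot -scalemxAr mxE. Qed.
Lemma dot0l v : dot 0 v = 0.
Proof. by rewrite /dot mul0mx mxE. Qed.
Lemma dot0r x : dot x 0 = 0.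
Proof. by rewrite /dot mulmx0 mxE. Qed.
Lemma dot_sumr x I (r : seq I) (P : pred I) (F : I -> 'cV[R]_p) :
  dot x (\sum_(i <- r | P i) F i) = \sum_(i <- r | P i) dot x (F i).
Proof. exact: (big_morph _ (dotDr x) (dot0r x)). Qed.

Lemma dot_tr_gt0 v : v != 0 -> 0 < dot v^T v.
Proof.
move=> v0; have sq i : 0 <= v^T 0 i * v i 0 by rewrite mxE -expr2 sqr_ge0.
rewrite /dot mxE lt_neqAle sumr_ge0// andbT eq_sym psumr_eq0//; apply: contra v0 => /allP h.
apply/eqP/matrixP => i j; rewrite ord1 mxE.
have := h i (mem_index_enum i); rewrite /= mxE -expr2 sqrf_eq0 => /eqP //.
Qed.

Lemma exists_dot_eq (r : R) v : v != 0 -> exists x, dot x v = r.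
Proof.
move=> v0; exists ((r / dot v^T v) *: v^T).
by rewrite dotZl divfK// gt_eqF// dot_tr_gt0.
Qed.

Lemma norm_dot_le x v : `|dot x v| <= `|x| * \sum_i `|v i 0|.
Proof.
rewrite /dot mxE mulr_sumr; apply: le_trans (ler_norm_sum _ _ _) _.
apply: ler_sum => i _; rewrite normrM ler_wpM2r//.
rewrite {2}/Num.norm /= mx_normrE.
exact: (le_bigmax_cond _ (fun i => `|x i.1 i.2|) (j := (0, i))).
Qed.

End Pairing.

(** * Kronecker's density theorem for characters of Z[A] *)

Section Kronecker.
Variables (R : realType) (p : nat).
Implicit Types (theta : 'rV[R]_p).

(* Averaging over the translates by 0 and tau, with tau chosen so that the
   frequencies beta and alpha are in opposite phase, removes beta. *)
Lemma fourier_coef_le (I : finType) (a : I -> 'cV[R]_p) (B : I -> R[i]) (K : R)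
    (alpha : 'cV[R]_p) :
  (forall theta, modulus (\sum_i B i * cis (dot theta (a i))) <= K) ->
  modulus (\sum_(i | a i == alpha) B i) <= K.
Proof.
(* [L] lists the frequencies other than [alpha] that may still carry a nonzero coefficient; each
   averaging removes its head. *)
suff main (L : seq 'cV[R]_p) : forall B : I -> R[i],
    (forall theta, modulus (\sum_i B i * cis (dot theta (a i))) <= K) ->
    (forall i, B i != 0 -> (a i == alpha) || (a i \in L)) ->
    modulus (\sum_(i | a i == alpha) B i) <= K.
  move=> bK; apply: (main (codom a)) => // i _.
  by rewrite codom_f orbT.
elim: L => [|b L IH] {}B bK BL.
  have := bK 0; rewrite (bigID (fun i => a i == alpha))/= [X in _ + X]big1.
    rewrite addr0; under eq_bigr do rewrite dot0l cis0 mulr1; by [].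
  move=> i ai; have [->|Bi] := eqVneq (B i) 0; first by rewrite mul0r.
  by have := BL i Bi; rewrite (negPf ai) in_nil.
have [ba|ba] := eqVneq b alpha.
  apply: IH => // i /BL; rewrite inE ba => /orP[->//|/orP[->//|->]].
  by rewrite orbT.
have [|tau Htau] := @exists_dot_eq _ _ pi (b - alpha); first by rewrite subr_eq0.
pose B' i := B i * ((1 + cis (dot tau (a i - alpha))) / 2).
have E : \sum_(i | a i == alpha) B i = \sum_(i | a i == alpha) B' i.
  apply: eq_bigr => i /eqP ai; rewrite /B' ai subrr dot0r cis0.
  by rewrite divff ?mulr1// -mulr2n pnatr_eq0.
rewrite E; apply: IH => [theta|i].
  have -> : \sum_i B' i * cis (dot theta (a i)) = 2^-1 *
     (\sum_i B i * cis (dot theta (a i)) +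
      cis (- dot tau alpha) * \sum_i B i * cis (dot (theta + tau) (a i))).
    rewrite [X in _ + X]mulr_sumr -big_split mulr_sumr; apply: eq_bigr => i _ /=.
    rewrite /B' dotDr dotNr dotDl !cisD; ring.
  rewrite modulusM modulusV -[2]/(1+1) -[1 + 1]/(2%:R) -(rmorph_nat (real_complex R)).
  rewrite modulus_real normr_nat ler_pdivrMl// mulr_natl mulr2n.
  apply: le_trans (modulusD _ _) _; rewrite lerD// modulusM modulus_cis mul1r.
  exact: bK.
rewrite mulf_eq0 negb_or => /andP[Bi ci].
have := BL i Bi; rewrite inE => /orP[->//|/orP[/eqP aib|->]]; last by rewrite orbT.
by move: ci; rewrite aib Htau cis_pi subrr mul0r eqxx.
Qed.

Lemma polynomial_lt_exponential d (q : R) : 0 <= q < 1 ->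
  exists M : nat, M.+1%:R ^+ d * q ^+ M < 1.
Proof.
move=> /andP[q0 q1]; have [->|qn0] := eqVneq q 0.
  by exists 1%N; rewrite expr1 mulr0.
have {}q0 : 0 < q by rewrite lt_neqAle eq_sym qn0.
(* Thus q^M cancels the (d+1)-st power of e^(c M), and e^(c M) >= 1 + c M >= c' (M + 1). One factor
   M + 1 is left over, and M is chosen to make it exceed c'^-(d+1). *)
pose c := - ln q / d.+1%:R.
have c0 : 0 < c by rewrite divr_gt0 // oppr_gt0 ln_lt0// q0.
have qE : q = expR (- (c *+ d.+1)).
  by rewrite /c -[_ / _ *+ _]mulr_natr divfK ?pnatr_eq0// opprK lnK.
pose c' := Num.min 1 c.
have c'0 : 0 < c' by rewrite lt_min ltr01.
pose M := Num.truncn (c' ^- d.+1); exists M.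
have M1 : c' ^- d.+1 < M.+1%:R.
  by rewrite truncnS_gt.
have E : c' * M.+1%:R <= expR (c * M%:R).
  apply: le_trans (expR_ge1Dx _); rewrite -natr1 mulrDr mulr1 addrC lerD//.
    by rewrite ge_min lexx.
  by rewrite ler_wpM2r// ge_min lexx orbT.
have E1 : expR (c * M%:R) ^+ d.+1 * q ^+ M = 1.
  rewrite qE -!expRM_natl -expRD -[RHS]expR0; congr expR.
  by rewrite -(mulr_natl c); ring.
have E2 : (c' * M.+1%:R) ^+ d.+1 * q ^+ M <= 1.
  rewrite -[leRHS]E1 ler_wpM2r ?exprn_ge0 ?(ltW q0)//.
  by apply: lerXn2r; rewrite ?nnegrE ?mulr_ge0 ?expR_ge0// ltW.
have M2 : 1 < c' ^+ d.+1 * M.+1%:R.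
  by rewrite -ltr_pdivrMl ?exprn_gt0// mulr1.
have X0 : 0 < M.+1%:R ^+ d * q ^+ M by rewrite mulr_gt0 ?exprn_gt0.
rewrite -(ltr_pM2l (lt_trans ltr01 M2)) mulr1; apply: le_lt_trans M2.
apply: le_trans E2; rewrite exprMn (exprSr M.+1%:R).
have rearr (a b x z : R) : a * x * (b * z) = a * (b * x) * z by ring.
by rewrite rearr.
Qed.

Lemma char_zero N (A : 'M[R]_(p, N)) (chi : character A) : chi 0 = 1.
Proof.
have := char_morph chi 0 0; rewrite addr0 => /esym/eqP.
rewrite -subr_eq0 -{3}[chi 0]mulr1 -mulrBr mulf_eq0 subr_eq0 => /orP[/eqP c0|/eqP//].
by have := char_unit chi 0; rewrite c0 modulus0 => /esym/eqP; rewrite oner_eq0.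
Qed.

Lemma char_sum N (A : 'M[R]_(p, N)) (chi : character A) I (r : seq I) (F : I -> zspan A) :
  chi (\sum_(i <- r) F i) = \prod_(i <- r) chi (F i).
Proof. exact: (big_morph _ (char_morph chi) (char_zero chi)). Qed.

(* Bohr's argument: with G theta the sum of 1 and of the e^{i<theta,A_j>} / chi(A_j),
   the coefficients of G^M at a fixed frequency are all equal to 1 up to a
   common phase, so some coefficient is at least (N+1)^M / (M+1)^(N+1); this is
   incompatible with a bound |G| <= q < N+1. *)
Theorem kronecker (N : nat) (A : 'M[R]_(p, N)) (chi : character A) (e : R) : 0 < e ->
  exists theta, forall j,
    modulus (chi (zspan_gen A j) - cis (dot theta (col j A))) < e.
Proof.
move=> e0; apply: contrapT => /forallNP H.
have chi1 := char_zero chi; have chi_sum := char_sum chi.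
have chi0 u : chi u != 0 by rewrite -modulus_gt0 char_unit.
(* [None] stands for the constant term 1 of G. *)
pose z (l : option 'I_N) : zspan A := if l is Some j then zspan_gen A j else 0.
pose a l : 'cV[R]_p := val (z l).
pose b l := (chi (z l))^-1.
have b1 l : modulus (b l) = 1 by rewrite /b modulusV char_unit invr1.
pose G theta := \sum_l b l * cis (dot theta (a l)).
(* If a unimodular term has distance at least e from 1, the parallelogram law gives |1 + c|^2 <= 4 -
   e^2 <= (2 - e^2 / 4)^2; the other N - 1 terms are bounded by 1 each. *)
pose q := N.+1%:R - e ^+ 2 / 4.
have Gq theta : modulus (G theta) <= q.
  have /existsNP[j /negP] := H theta; rewrite -leNgt => ej.
  have [cj cjE zj] : exists2 cj, cj = b (Some j) * cis (dot theta (a (Some j))) &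
     modulus cj = 1.
    by eexists => //; rewrite modulusM b1 modulus_cis mulr1.
  have zj1 : e <= modulus (1 - cj).
    apply: (le_trans ej); rewrite cjE /b /a /=.
    rewrite -[X in _ <= X]mul1r -(char_unit chi (zspan_gen A j)) -modulusM.
    by rewrite mulrBr mulr1 mulrA divff ?mul1r.
  have Ncard : N.+1%:R = 2 + \sum_(i | (i != None) && (i != Some j)) (1 : R).
    transitivity (\sum_(i : option 'I_N) (1 : R)).
      by rewrite sumr_const card_option card_ord.
    by rewrite (bigD1 None)//= (bigD1 (Some j))//= addrA.
  rewrite /G (bigD1 None)//= (bigD1 (Some j))//= addrA -cjE.
  rewrite {1}/b {1}/a /= chi1 invr1 mul1r dot0r cis0 /q Ncard [leRHS]addrAC.
  apply: le_trans (modulusD _ _) _; apply: lerD; last first.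
    apply: le_trans (modulus_sum _ _ _) _; apply: ler_sum => i _.
    by rewrite modulusM b1 modulus_cis mulr1.
  have h1 := sqr_modulus (1 + cj); have h2 := sqr_modulus (1 - cj).
  have h3 := sqr_modulus cj; rewrite zj in h3.
  have h4 : modulus (1 - cj) <= 2.
    by apply: le_trans (modulusD _ _) _; rewrite modulusN modulus1 zj.
  have h5 : modulus (1 + cj) ^+ 2 <= 4 - e ^+ 2.
    have : e ^+ 2 <= modulus (1 - cj) ^+ 2 by rewrite lerXn2r ?nnegrE ?modulus_ge0// ltW.
    move: h1 h2 h3; rewrite !complexReD !complexImD complexReN complexImN /=; nra.
  rewrite -(@ler_pXn2r _ 2) ?nnegrE ?modulus_ge0//; last by nra.
  apply: le_trans h5 _; nra.
have [M HM] : exists M : nat, M.+1%:R ^+ N.+1 * (q / N.+1%:R) ^+ M < 1.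
  apply: polynomial_lt_exponential; rewrite divr_ge0//; last first.
    exact: le_trans (modulus_ge0 _) (Gq 0).
  by rewrite ltr_pdivrMr// mul1r /q ltrBlDr ltrDl divr_gt0// exprn_gt0.
pose W := {ffun 'I_M -> option 'I_N}.
pose aw (w : W) := \sum_i a (w i).
pose Bw (w : W) := \prod_i b (w i).
have zw (w : W) : aw w = val (\sum_i z (w i)).
  by rewrite /aw (raddf_sum (val : zspan A -> _)).
have Bwz (w : W) : Bw w = (chi (\sum_i z (w i)))^-1.
  by rewrite chi_sum /Bw prodfV.
have GM theta : G theta ^+ M = \sum_(w : W) Bw w * cis (dot theta (aw w)).
  rewrite -[M in LHS]card_ord -prodr_const bigA_distr_bigA /=.
  apply: eq_bigr => w _; rewrite big_split /= -cis_sum /aw dot_sumr //.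
(* Words of equal frequency give the same element of Z[A], hence the same value of chi: their
   coefficients add without cancellation. *)
have coef w0 : #|[pred w | aw w == aw w0]|%:R <= q ^+ M.
  have := @fourier_coef_le W aw Bw (q ^+ M) (aw w0) _.
  have -> : \sum_(i | aw i == aw w0) Bw i = #|[pred w | aw w == aw w0]|%:R * Bw w0.
    rewrite -sum1_card natr_sum mulr_suml; apply: eq_bigr => w /eqP ww.
    by rewrite mul1r !Bwz; congr (chi _)^-1; apply: val_inj; rewrite -!zw.
  rewrite modulusM -(rmorph_nat (real_complex R)) modulus_real normr_nat.
  rewrite Bwz modulusV char_unit invr1 mulr1; apply=> theta.
  rewrite -GM modulusX; apply: lerXn2r; rewrite ?nnegrE ?modulus_ge0//.
  exact: le_trans (modulus_ge0 _) (Gq theta).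
(* The frequency of a word depends only on its letter counts, and there are at most (M+1)^(N+1)
   count vectors for the (N+1)^M words. *)
pose count (w : W) : {ffun option 'I_N -> 'I_M.+1} :=
  [ffun l => inord #|[pred i | w i == l]|].
have awc (w : W) : aw w = \sum_l a l *+ count w l.
  rewrite /aw (partition_big w xpredT)//=; apply: eq_bigr => l _.
  rewrite (eq_bigr (fun=> a l)) => [|i /eqP->//].
  rewrite sumr_const ffunE inordK//.
  by rewrite ltnS; apply: leq_trans (max_card _) _; rewrite card_ord.
have : (N.+1%:R ^+ M <= M.+1%:R ^+ N.+1 * q ^+ M).
  have -> : N.+1%:R ^+ M = \sum_(w : W) (1 : R).
    by rewrite sumr_const card_ffun card_option !card_ord natrX.
  rewrite (partition_big count xpredT)//=.
  have -> : M.+1%:R ^+ N.+1 * q ^+ M =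
      \sum_(k : {ffun option 'I_N -> 'I_M.+1}) q ^+ M.
    by rewrite sumr_const card_ffun card_option !card_ord -natrX mulr_natl.
  apply: ler_sum => k _.
  have [/existsP[w0 /eqP w0k]|no] := boolP [exists w0, count w0 == k].
    rewrite sumr_const; apply: le_trans (coef w0); rewrite ler_nat.
    apply/subset_leq_card/fintype.subsetP => w wk.
    have /eqP {}wk : count w == k := wk.
    by rewrite inE !awc wk w0k.
  rewrite big1 => [|w wk]; last by case/negP: no; apply/existsP; exists w.
  by rewrite exprn_ge0// (le_trans (modulus_ge0 _) (Gq 0)).
rewrite leNgt => /negP; apply.
move: HM; rewrite expr_div_n mulrA ltr_pdivrMr ?exprn_gt0// mul1r.
by [].
Qed.

End Kronecker.

(** * Directions that separate the columns *)

Section GenericDirection.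
Variables (R : realType) (p : nat).
Implicit Types (v w : 'rV[R]_p) (d : 'cV[R]_p).

Lemma dot_perturb_neq0 (L : seq 'cV[R]_p) v w :
  (forall d, d \in L -> dot v d != 0) ->
  exists2 e : R, 0 < e & forall t, 0 < t <= e -> forall d, d \in L ->
    dot (v + t *: w) d != 0.
Proof.
elim: L => [|b L IH] vL; first by exists 1.
have [|e e0 He] := IH; first by move=> d dL; rewrite vL// inE dL orbT.
have vb : dot v b != 0 by rewrite vL// inE eqxx.
pose f := `|dot v b| / (2 * (1 + `|dot w b|)).
have f0 : 0 < f by rewrite divr_gt0 ?normr_gt0// mulr_gt0// ltr_pwDl.
exists (Num.min e f); first by rewrite lt_min e0.
move=> t /andP[t0]; rewrite le_min => /andP[te tf] d; rewrite inE => /orP[/eqP ->|]; last first.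
  by apply: He; rewrite t0.
rewrite dotDl dotZl; apply/eqP => /eqP; rewrite addr_eq0 => /eqP vw.
move: tf; rewrite /f vw normrN normrM (gtr0_norm t0) ler_pdivlMr ?mulr_gt0 ?ltr_pwDl//.
have := normr_ge0 (dot w b); nra.
Qed.

(** When the direction found so far is orthogonal to a new vector b, a small push along the
    transpose of b repairs this without spoiling the finitely many conditions already met. *)
Lemma exists_generic_direction (L : seq 'cV[R]_p) : (forall d, d \in L -> d != 0) ->
  exists v, forall d, d \in L -> dot v d != 0.
Proof.
elim: L => [|b L IH] L0; first by exists 0.
have [|v vL] := IH; first by move=> d dL; rewrite L0// inE dL orbT.
have [vb|vb] := eqVneq (dot v b) 0; last first.
  by exists v => d; rewrite inE => /orP[/eqP ->//|]; exact: vL.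
have [e e0 He] := dot_perturb_neq0 b^T vL.
exists (v + e *: b^T) => d; rewrite inE => /orP[/eqP ->|]; last first.
  by apply: He; rewrite e0 lexx.
rewrite dotDl vb add0r dotZl mulf_neq0 ?gt_eqF//.
by rewrite dot_tr_gt0 ?L0// inE eqxx.
Qed.

Lemma exists_injective_direction N (A : 'M[R]_(p, N)) :
  injective (fun j => col j A) -> exists v, injective (fun j => dot v (col j A)).
Proof.
move=> Ainj.
have [|v Hv] := @exists_generic_direction
  [seq col ij.1 A - col ij.2 A | ij <- enum [pred ij : 'I_N * 'I_N | ij.1 != ij.2]].
  move=> d /mapP[[i j]]; rewrite mem_enum inE /= => ij ->.
  by rewrite subr_eq0; apply: contra ij => /eqP/Ainj ->.
exists v => i j vij; apply/eqP; apply: contraT => ij.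
have := Hv (col i A - col j A); rewrite dotDr dotNr vij subrr eqxx.
move=> H; exfalso; suff : false by []; apply: H.
by apply/mapP; exists (i, j) => //; rewrite mem_enum inE.
Qed.

End GenericDirection.

(** * Reduction of angles and Lipschitz bounds *)

Section Angles.
Variable R : realType.

Lemma exists_angle (t : R) : exists2 s, 0 <= s < 2 * pi & exists k : int, t = s + 2 * pi *~ k.
Proof.
have pi2 : 0 < 2 * pi :> R by rewrite mulr_gt0// pi_gt0.
pose k := Num.floor (t / (2 * pi)).
have E : 2 * pi *~ k = k%:~R * (2 * pi) :> R by rewrite -mulrzr mulrC.
exists (t - 2 * pi *~ k); last by exists k; rewrite subrK.
rewrite E subr_ge0 ltrBlDl -ler_pdivlMr// floor_le /=.
by rewrite -{2}[2 * pi]mul1r -mulrDl -ltr_pdivrMr// -intrD1 floorD1_gt.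
Qed.

Lemma cis_shift2pi (t : R) (k : int) : cis (t + 2 * pi *~ k) = cis t.
Proof. by rewrite cisD cis2pi_int mulr1. Qed.

Lemma cos_lipschitz (s t : R) : `|cos s - cos t| <= `|s - t|.
Proof.
wlog st : s t / s < t.
  move=> H; have [st|ts|->] := ltgtP s t; [exact: H| |by rewrite !subrr].
  by rewrite distrC (distrC s); exact: H.
rewrite distrC (distrC s).
have [|u _ ->] := MVT st (fun u _ => is_derive_cos u); last first.
  by rewrite normrM normrN ler_piMl// sin_max.
by apply: continuous_subspaceT => ?; exact: continuous_cos.
Qed.

Lemma sin_lipschitz (s t : R) : `|sin s - sin t| <= `|s - t|.
Proof.
rewrite -!cosBpihalf; apply: le_trans (cos_lipschitz _ _) _.
by rewrite opprB addrA subrK.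
Qed.

Lemma cis_lipschitz (s t : R) : modulus (cis s - cis t) <= 2 * `|s - t|.
Proof.
apply: le_trans (modulus_le_ReIm _) _.
by rewrite !cisE /= mulr_natl mulr2n lerD// ?cos_lipschitz ?sin_lipschitz.
Qed.

End Angles.

(** * The amoeba complement as a set of uniform lower bounds *)

Section AmoebaComplement.
Variables (R : realType) (p N : nat) (A : 'M[R]_(p, N)) (c : 'I_N -> R[i]).
Implicit Types (x theta : 'rV[R]_p) (u : 'I_N -> R[i]).

(* [f_chi] with the character replaced by its values [u] on the columns of [A]. *)
Definition tsum u x : R[i] := \sum_j c j * u j * (expR (dot x (col j A)))%:C%C.

Definition phases theta (j : 'I_N) : R[i] := cis (dot theta (col j A)).

(** The imaginary part of z acts as a character: this links zeros of f over x with zeros of the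
    twisted sums at x. *)
Lemma exp_sumE (z : 'rV[R[i]]_p) : exp_sum A c z =
  tsum (phases (map_mx (@complex.Im R) z)) (map_mx (@complex.Re R) z).
Proof.
apply: eq_bigr => j _; rewrite -mulrA; congr (_ * _).
rewrite /phases mulrC -cis_split; congr cexp.
apply: complex_ext => /=; rewrite /dot !mxE ?complexRe_sum ?complexIm_sum; apply: eq_bigr => k _;
  rewrite !mxE; first by rewrite complexReM /= mulr0 subr0.
by rewrite complexImM /= mulr0 add0r.
Qed.

Lemma tsum_dist_phase u u' x : modulus (tsum u x - tsum u' x) <=
  \sum_j modulus (c j) * expR (dot x (col j A)) * modulus (u j - u' j).
Proof.
rewrite /tsum -sumrB; apply: le_trans (modulus_sum _ _ _) _; apply: ler_sum => j _.
rewrite -mulrBl -mulrBr !modulusM modulus_real ger0_norm ?expR_ge0//.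
by rewrite mulrAC.
Qed.

(** The terms at the base point x; on a complex line through x they become the coefficients of a
    [line_sum] whose frequencies depend on the direction only. *)
Definition tcoef u x (j : 'I_N) : R[i] := c j * u j * (expR (dot x (col j A)))%:C%C.

Lemma tsum_complex_line u x v (s1 s2 : R) :
  tsum (fun j => u j * phases (s2 *: v) j) (x + s1 *: v) =
  line_sum (tcoef u x) (fun j => dot v (col j A)) (s1 +i* s2)%C.
Proof.
apply: eq_bigr => j _; rewrite /tcoef.
have -> : cexp ((dot v (col j A))%:C * (s1 +i* s2))%C =
    (expR (s1 * dot v (col j A)))%:C%C * cis (s2 * dot v (col j A)).
  rewrite -cis_split; congr cexp.
  by apply: complex_ext; rewrite ?complexReZ ?complexImZ mulrC.
have -> : phases (s2 *: v) j = cis (s2 * dot v (col j A)).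
  by rewrite /phases dotZl.
by rewrite dotDl dotZl expRD rmorphM /=; ring.
Qed.

Lemma tsum_real_line u x v :
  tsum u (x + v) = line_sum (tcoef u x) (fun j => dot v (col j A)) 1.
Proof.
have := tsum_complex_line u x v 1 0; rewrite scale1r => <-.
by apply: eq_bigr => j _; rewrite scale0r /phases dot0l cis0 mulr1.
Qed.

Lemma phasesD theta theta' j : phases (theta + theta') j = phases theta j * phases theta' j.
Proof. by rewrite /phases dotDl cisD. Qed.

Lemma modulus_phases theta j : modulus (phases theta j) = 1.
Proof. exact: modulus_cis. Qed.

Definition colbound : R := 1 + \sum_j \sum_i `|A i j|.

Lemma colbound_gt0 : 0 < colbound.
Proof. by rewrite ltr_pwDl// sumr_ge0// => j _; exact: sumr_ge0. Qed.

Lemma norm_dot_col v j : `|dot v (col j A)| <= `|v| * colbound.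
Proof.
apply: le_trans (norm_dot_le _ _) _; rewrite ler_wpM2l//.
under eq_bigr do rewrite mxE.
rewrite /colbound (bigD1 j)//= addrCA lerDl addr_ge0// sumr_ge0// => k _.
exact: sumr_ge0.
Qed.

Lemma sum_modulus_tcoef u x : (forall j, modulus (u j) = 1) ->
  \sum_j modulus (tcoef u x j) = \sum_j modulus (c j) * expR (dot x (col j A)).
Proof.
move=> u1; apply: eq_bigr => j _; rewrite /tcoef !modulusM u1 mulr1 modulus_real.
by rewrite ger0_norm ?expR_ge0.
Qed.

Lemma tsum_near x : exists2 C : R, 0 <= C & forall u v, (forall j, modulus (u j) = 1) ->
  `|v| * colbound <= 1 -> modulus (tsum u (x + v) - tsum u x) <= C * `|v|.
Proof.
have [C C0 HC] := @line_sum_rem R 'I_N 1.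
pose S := \sum_j modulus (c j) * expR (dot x (col j A)).
have S0 : 0 <= S by rewrite sumr_ge0// => j _; rewrite mulr_ge0 ?modulus_ge0 ?expR_ge0.
exists (C * S * colbound); first by rewrite !mulr_ge0// ltW ?colbound_gt0.
move=> u v u1 v1.
have vL j : modulus ((dot v (col j A))%:C%C * 1) <= `|v| * colbound.
  by rewrite mulr1 modulus_real norm_dot_col.
have := HC (tcoef u x) (fun j => dot v (col j A)) 1 _ vL v1.
rewrite sum_modulus_tcoef// -/S expr1 (mulrC `|v|) mulrA tsum_real_line.
have -> : tsum u x = \sum_(i < 1)
    moment (tcoef u x) (fun j => dot v (col j A)) i * (1 ^+ i / i`!%:R).
  rewrite big_ord1 expr0 fact0 divr1 mulr1; apply: eq_bigr => j _.
  by rewrite expr0 mulr1.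
by [].
Qed.

(** A whole ball around x is free of zeros for every [theta]. If the infimum over [theta] were 0, a
    limit phase vector would give a zero, and Hurwitz's theorem on a complex line would carry it to
    a genuine [theta] and a point of that ball. *)
Lemma amoeba_lower_bound (i0 i1 : 'I_N) x : injective (fun j => col j A) ->
  i0 != i1 -> c i0 != 0 -> c i1 != 0 -> ~ amoeba (exp_sum A c) x ->
  exists2 d : R, 0 < d & forall theta, d <= modulus (tsum (phases theta) x).
Proof.
move=> Ainj i01 c0 c1 xA.
have [r r0 Hr] : exists2 r : R, 0 < r & forall y theta, `|y - x| < r ->
    tsum (phases theta) y != 0.
  move/existsNP : xA => [B /not_implyP[xB /forallNP noB]].
  have /nbhs_ballP[r /= r0 rB] := xB; exists r => // y theta yx.
  apply/eqP => fy; apply: (noB y); split; last first.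
    by apply: rB; rewrite -ball_normE /= distrC.
  pose z : 'rV[R[i]]_p := \row_k (y 0 k +i* theta 0 k)%C.
  have zy : map_mx (@complex.Re R) z = y by apply/rowP => k; rewrite !mxE.
  have zt : map_mx (@complex.Im R) z = theta by apply/rowP => k; rewrite !mxE.
  by exists z => //=; rewrite exp_sumE zy zt.
have [v vinj] := exists_injective_direction Ainj.
pose rho := r / (2 * (1 + `|v|)).
have rho0 : 0 < rho by rewrite divr_gt0// mulr_gt0// ltr_pwDl.
have rhov : rho * `|v| < r.
  rewrite /rho mulrAC ltr_pdivrMr ?mulr_gt0 ?ltr_pwDl//.
  by have := normr_ge0 v; nra.
(* The parameter [theta] ranges over a non-compact space, so the minimum is sought on the closure of
   the realised angle vectors; the minimiser itself may come from no [theta]. *)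
pose Z0 := [set phi : 'rV[R]_N | exists theta, forall j, cis (phi 0 j) = phases theta j].
pose Box := [set phi : 'rV[R]_N | forall j, `[0, 2 * pi]%classic (phi 0 j)].
have Kc : compact (Box `&` closure Z0).
  apply: compact_closedI; last exact: closed_closure.
  by apply: (@rV_compact R N (fun=> `[0, 2 * pi]%classic)) => j; exact: segment_compact.
have pi2 : 0 < 2 * pi :> R by rewrite mulr_gt0// pi_gt0.
have K0 : (Box `&` closure Z0) 0.
  split=> [j|]; first by rewrite /= in_itv /= mxE lexx ltW.
  apply: subset_closure; exists 0 => j; rewrite mxE /phases dot0l //.
pose F (phi : 'rV[R]_N) := modulus (tsum (fun j => cis (phi 0 j)) x).
have cF : continuous F.
  move=> phi; apply: (@continuous_at_of_lipschitz _ _ _ _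
    (\sum_j modulus (c j) * expR (dot x (col j A)) * 2) 1) => // psi _.
  apply: (@le_trans _ _ (modulus (tsum (fun j => cis (psi 0 j)) x - tsum (fun j => cis (phi 0 j)) x))).
    rewrite ler_norml modulus_triangle andbT.
    by rewrite lerNl opprB modulus_distC modulus_triangle.
  apply: le_trans (tsum_dist_phase _ _ _) _; rewrite mulr_suml; apply: ler_sum => j _.
  rewrite -[leRHS]mulrA ler_wpM2l ?mulr_ge0 ?modulus_ge0 ?expR_ge0//.
  apply: le_trans (cis_lipschitz _ _) _; rewrite ler_wpM2l//.
  have -> : psi 0 j - phi 0 j = (psi - phi) 0 j by rewrite !mxE.
  rewrite {2}/Num.norm /= mx_normrE.
  exact: (le_bigmax_cond _ (fun i => `|(psi - phi) i.1 i.2|) (j := (0, j))).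
have [phi /set_mem[_ phiZ] phimin] :=
  EVT_min_rV (ex_intro _ _ K0) Kc (continuous_subspaceT cF).
exists (F phi).
  rewrite modulus_gt0; apply/negP => /eqP Fphi.
  pose a j := c j * cis (phi 0 j) * (expR (dot x (col j A)))%:C%C.
  have a0 i : c i != 0 -> a i != 0.
    move=> ci; apply: mulf_neq0; first exact: mulf_neq0 ci (cis_neq0 _).
    by rewrite -modulus_gt0 modulus_real gtr0_norm ?expR_gt0.
  have Fa : line_sum a (fun j => dot v (col j A)) 0 = 0.
    by rewrite -[RHS]Fphi; apply: eq_bigr => j _; rewrite mulr0 cexp0 mulr1.
  have [e e0 He] := hurwitz vinj i01 (a0 i0 c0) (a0 i1 c1) Fa rho0.
  pose E := 1 + \sum_j modulus (c j) * expR (dot x (col j A)) * 2.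
  have E0 : 0 < E.
    by rewrite ltr_pwDl// sumr_ge0// => j _; rewrite !mulr_ge0 ?modulus_ge0 ?expR_ge0.
  have [psi [[theta psiZ] psiphi]] : Z0 `&` ball phi (e / E) !=set0.
    by apply: phiZ; apply: nbhsx_ballx; rewrite divr_gt0.
  have [j|s srho s0] := He (tcoef (phases theta) x).
    rewrite /a /tcoef -psiZ -mulrBl -mulrBr !modulusM modulus_real ger0_norm ?expR_ge0//.
    rewrite mulrAC; set X := modulus (c j) * expR _; set Y := modulus _.
    move: psiphi; rewrite -ball_normE /= distrC => psiphi.
    have pj : `|psi 0 j - phi 0 j| <= `|psi - phi|.
      have -> : psi 0 j - phi 0 j = (psi - phi) 0 j by rewrite !mxE.
      rewrite {2}/Num.norm /= mx_normrE.
      exact: (le_bigmax_cond _ (fun i => `|(psi - phi) i.1 i.2|) (j := (0, j))).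
    have Y1 : Y <= 2 * `|psi 0 j - phi 0 j| := cis_lipschitz _ _.
    have XE : X * 2 <= E - 1.
      rewrite /E (bigD1 j)//= addrAC subrr add0r lerDl sumr_ge0// => i _.
      by rewrite !mulr_ge0 ?modulus_ge0 ?expR_ge0.
    have X0 : 0 <= X by rewrite mulr_ge0 ?modulus_ge0 ?expR_ge0.
    move: psiphi; rewrite ltr_pdivlMr// => psiphi.
    have h1 : X * Y <= X * (2 * `|psi - phi|).
      by rewrite ler_wpM2l// (le_trans Y1)// ler_wpM2l.
    have := normr_ge0 (psi - phi); nra.
  move: s srho s0 => [s1 s2] srho; rewrite -tsum_complex_line => /eqP; apply/negP.
  (* The zero s1 + i s2 is read back as a zero of f: s1 displaces the real point and s2 displaces
     [theta]. *)
  rewrite (_ : tsum _ _ = tsum (phases (theta + s2 *: v)) (x + s1 *: v)); last first.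
    by apply: eq_bigr => j _; rewrite phasesD.
  apply: Hr; rewrite addrAC subrr add0r normrZ; apply: le_lt_trans rhov.
  by rewrite ler_wpM2r//; apply: le_trans srho; exact: (normRe_le_modulus (s1 +i* s2)%C).
move=> theta.
have /choice[psi Hpsi] : forall j, exists s : R, 0 <= s < 2 * pi /\
    exists k : int, dot theta (col j A) = s + 2 * pi *~ k.
  by move=> j; have [s s1 s2] := exists_angle (dot theta (col j A)); exists s.
have Epsi j : cis ((\row_k psi k) 0 j) = phases theta j.
  by rewrite mxE /phases; have [_ [k ->]] := Hpsi j; rewrite cis_shift2pi.
have -> : modulus (tsum (phases theta) x) = F (\row_k psi k).
  by congr modulus; apply: eq_bigr => j _; rewrite Epsi.
apply: phimin; apply: mem_set; split.
  by move=> j; rewrite /= in_itv /= mxE; have [/andP[-> /ltW ->]] := Hpsi j.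
by apply: subset_closure; exists theta.
Qed.

Lemma lower_bound_notin_amoeba x (d : R) : 0 < d ->
  (forall theta, d <= modulus (tsum (phases theta) x)) -> ~ amoeba (exp_sum A c) x.
Proof.
move=> d0 H xA; have [C C0 HC] := tsum_near x.
pose r := Num.min colbound^-1 (d / (1 + C)).
have r0 : 0 < r by rewrite lt_min invr_gt0 colbound_gt0 divr_gt0// ltr_pwDl.
have [y [[z fz zy] xy]] := xA _ (nbhsx_ballx _ _ r0).
move: fz => /=; rewrite exp_sumE zy; set theta := map_mx _ z => fy.
have vr : `|y - x| < r by move: xy; rewrite -ball_normE /= distrC.
have v1 : `|y - x| * colbound <= 1.
  rewrite -ler_pdivlMr ?colbound_gt0// div1r; apply: ltW; apply: lt_le_trans vr _.
  by rewrite ge_min lexx.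
have := HC (phases theta) (y - x) (modulus_phases theta) v1.
rewrite (addrC x) subrK fy sub0r modulusN leNgt => /negP; apply.
apply: lt_le_trans (H theta).
have : `|y - x| < d / (1 + C) by apply: lt_le_trans vr _; rewrite ge_min lexx orbT.
rewrite ltr_pdivlMr ?ltr_pwDl//; have := normr_ge0 (y - x); nra.
Qed.

Lemma tsum_character_lower_bound x (d : R) :
  (forall theta, d <= modulus (tsum (phases theta) x)) ->
  forall chi : character A, d <= modulus (tsum (fun j => chi (zspan_gen A j)) x).
Proof.
move=> H chi; apply/ler_addgt0Pr => e e0.
pose E := 1 + \sum_j modulus (c j) * expR (dot x (col j A)).
have E0 : 0 < E.
  by rewrite ltr_pwDl// sumr_ge0// => j _; rewrite !mulr_ge0 ?modulus_ge0 ?expR_ge0.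
have [theta Htheta] := kronecker chi (divr_gt0 e0 E0).
apply: le_trans (H theta) _.
rewrite -lerBlDl; apply: le_trans (modulus_triangle _ _) _.
apply: le_trans (tsum_dist_phase _ _ _) _.
apply: (@le_trans _ _ (\sum_j modulus (c j) * expR (dot x (col j A)) * (e / E))).
  apply: ler_sum => j _; rewrite ler_wpM2l ?mulr_ge0 ?modulus_ge0 ?expR_ge0//.
  by rewrite modulus_distC ltW.
rewrite -mulr_suml mulrA ler_pdivrMr// mulrC ler_wpM2l// ?(ltW e0)//.
by rewrite /E lerDr.
Qed.

End AmoebaComplement.

Lemma continuous_pointwise_map (I : choiceType) (U : topologicalType) (m : I -> U -> U) :
  (forall i, continuous (m i)) ->
  continuous (fun (g : prod_topology (fun _ : I => U)) => (fun i => m i (g i)) : prod_topology (fun _ : I => U)).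
Proof.
move=> cm g; apply/cvg_sup; first exact/fmap_filter/nbhs_filter.
move=> i V.
have /= -> := @nbhsE (initial_topology (fun f : I -> U => f i)) (fun i => m i (g i)).
case=> B [[C oC <- Cx]] CV.
apply: (@filterS _ _ (fmap_filter _ (nbhs_filter g)) _ _ CV).
have cu : continuous (fun g : prod_topology (fun _ : I => U) => m i (g i)).
  move=> h; apply: (@continuous_comp _ _ _ (fun g : prod_topology (fun _ : I => U) => g i)).
   exact: proj_continuous.
  exact: cm.
exact: (cu g C (open_nbhs_nbhs (conj oC Cx))).
Qed.

(** * Measurability and Haar means on the dual group *)

Section DualGroup.
Variables (R : realType) (p N : nat) (A : 'M[R]_(p, N)).

Lemma continuous_Re : continuous (fun z : R[i]^o => complex.Re z : R^o).
Proof.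
move=> z B /nbhs_ballP[e /= e0 eB]; apply/nbhs_ballP.
exists e%:C%C => /= [|w]; first by rewrite ltcR.
rewrite -ball_normE /= -[`|z - w|]/((modulus (z - w))%:C%C) ltcR => zw.
apply: eB; rewrite -ball_normE /= -complexReN -complexReD.
exact: le_lt_trans (normRe_le_modulus _) zw.
Qed.

Lemma continuous_Im : continuous (fun z : R[i]^o => complex.Im z : R^o).
Proof.
move=> z B /nbhs_ballP[e /= e0 eB]; apply/nbhs_ballP.
exists e%:C%C => /= [|w]; first by rewrite ltcR.
rewrite -ball_normE /= -[`|z - w|]/((modulus (z - w))%:C%C) ltcR => zw.
apply: eB; rewrite -ball_normE /= -complexImN -complexImD.
exact: le_lt_trans (normIm_le_modulus _) zw.
Qed.

Lemma continuous_char_eval (u : zspan A) :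
  continuous (fun chi : char_topology A => char_fun chi u : R[i]^o).
Proof.
move=> chi; apply: (@continuous_comp _ _ _
  (fun chi : char_topology A => char_fun chi : prod_topology (fun _ : zspan A => R[i]^o))
  (fun f : prod_topology (fun _ : zspan A => R[i]^o) => f u)).
  exact: initial_continuous.
exact: proj_continuous.
Qed.

Lemma continuous_measurable_dual (f : char_topology A -> R) :
  continuous (f : _ -> R^o) -> measurable_fun setT (f : dual A -> R).
Proof.
move=> /continuousP cf; apply: (measurability _ (RGenOpens.measurableE R)).
move=> _ [_ [a [b ->] <-]]; rewrite setTI; apply: sub_gen_smallest.
exact/cf/interval_open.
Qed.

Lemma measurable_Re_char (u : zspan A) :
  measurable_fun setT (fun chi : dual A => complex.Re (char_fun chi u)).
Proof.
apply: continuous_measurable_dual => chi.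
apply: (@continuous_comp _ _ _ (fun chi : char_topology A => char_fun chi u : R[i]^o)).
  exact: continuous_char_eval.
exact: continuous_Re.
Qed.

Lemma measurable_Im_char (u : zspan A) :
  measurable_fun setT (fun chi : dual A => complex.Im (char_fun chi u)).
Proof.
apply: continuous_measurable_dual => chi.
apply: (@continuous_comp _ _ _ (fun chi : char_topology A => char_fun chi u : R[i]^o)).
  exact: continuous_char_eval.
exact: continuous_Im.
Qed.

Lemma continuous_char_mul (psi : character A) :
  continuous (char_mul psi : char_topology A -> char_topology A).
Proof.
apply/continuousP => _ [V oV <-].
pose mpsi (g : prod_topology (fun _ : zspan A => R[i]^o)) :
  prod_topology (fun _ : zspan A => R[i]^o) := fun u => char_fun psi u * g u.
have cmpsi : continuous mpsi.
  apply: (@continuous_pointwise_map _ (R[i]^o : topologicalType)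
    (fun u z => char_fun psi u * z)) => u z.
  exact: mulrl_continuous.
exists (mpsi @^-1` V); last by [].
by move/continuousP : cmpsi; apply.
Qed.

Lemma measurable_char_mul (psi : character A) :
  measurable_fun setT (char_mul psi : dual A -> dual A).
Proof.
apply: (@measurability _ _ (dual A) (dual A) setT (char_mul psi)
  (open : set (set (char_topology A))) erefl).
move=> _ [V oV <-]; rewrite setTI; apply: sub_gen_smallest.
by move/continuousP : (@continuous_char_mul psi); apply.
Qed.

Section HaarIntegral.
Variables (eta : probability (dual A) R).
Implicit Types g h : dual A -> R.

(** Over a probability measure this implies integrability, and it is stable under the operations
    used, so [haar_mean] is linear on this class. *)
Definition bounded_measurable g :=
  measurable_fun setT g /\ exists M : R, forall chi, `|g chi| <= M.

Lemma bounded_measurable_integrable g : bounded_measurable g ->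
  eta.-integrable setT (EFin \o g).
Proof.
move=> [mg [M gM]]; apply: measurable_bounded_integrable => //.
  by rewrite -ge0_fin_numE// fin_num_measure.
exists M; split; first exact: num_real.
by move=> y My chi _; apply: le_trans (gM chi) (ltW My).
Qed.

Definition haar_mean g : R := (\int[eta]_chi g chi)%R.

Lemma haar_meanD g h : bounded_measurable g -> bounded_measurable h ->
  haar_mean (fun chi => g chi + h chi) = haar_mean g + haar_mean h.
Proof.
by move=> /bounded_measurable_integrable ig /bounded_measurable_integrable ih;
  rewrite /haar_mean RintegralD.
Qed.

Lemma haar_meanZ (k : R) g : bounded_measurable g ->
  haar_mean (fun chi => k * g chi) = k * haar_mean g.
Proof. by move=> /bounded_measurable_integrable ig; rewrite /haar_mean RintegralZl. Qed.

Lemma haar_mean_cst (k : R) : haar_mean (fun=> k) = k.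
Proof.
rewrite /haar_mean Rintegral_cst// [X in fine X](_ : _ = 1%E) ?mulr1//.
exact: probability_setT.
Qed.

Lemma norm_haar_mean_le g (M : R) : bounded_measurable g ->
  (forall chi, `|g chi| <= M) -> `|haar_mean g| <= M.
Proof.
move=> bg gM; have ig := bounded_measurable_integrable bg.
apply: le_trans (le_normr_Rintegral _ ig) _ => //.
rewrite -[leRHS]haar_mean_cst.
apply: le_Rintegral => //.
  by apply: bounded_measurable_integrable; split; [exact: measurableT_comp bg.1|
    exists M => chi; rewrite normr_id].
apply: bounded_measurable_integrable; split; first exact: measurable_cst.
by exists `|M|.
Qed.

Lemma haar_mean_shift (psi : character A) g : is_haar eta -> bounded_measurable g ->
  haar_mean (fun chi => g (char_mul psi chi)) = haar_mean g.
Proof.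
move=> heta bg; rewrite /haar_mean /Rintegral; congr fine.
have mpsi := measurable_char_mul psi.
have bg' : bounded_measurable (g \o char_mul psi).
  split; first exact: measurableT_comp bg.1 mpsi.
  by have [M gM] := bg.2; exists M => chi; exact: gM.
have := @integral_pushforward _ _ _ _ R _ mpsi eta setT (EFin \o g).
rewrite preimage_setT => H; apply: etrans (esym (H _ _ _)) _ => //.
- by apply/measurable_EFinP; exact: bg.1.
- exact: bounded_measurable_integrable bg'.
- by apply: eq_measure_integral => E mE _; exact: heta.
Qed.

Lemma bounded_measurableD g h : bounded_measurable g -> bounded_measurable h ->
  bounded_measurable (fun chi => g chi + h chi).
Proof.
move=> [mg [M gM]] [mh [L hL]]; split; first exact: measurable_funD.
by exists (M + L) => chi; rewrite (le_trans (ler_normD _ _))// lerD.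
Qed.

Lemma bounded_measurableZ (k : R) g : bounded_measurable g ->
  bounded_measurable (fun chi => k * g chi).
Proof.
move=> [mg [M gM]]; split; first exact: measurable_funM.
by exists (`|k| * M) => chi; rewrite normrM ler_wpM2l.
Qed.

Lemma bounded_measurable_cst (k : R) : bounded_measurable (fun=> k).
Proof. by split; [exact: measurable_cst|exists `|k|]. Qed.

Lemma bounded_measurable_shift (psi : character A) g : bounded_measurable g ->
  bounded_measurable (fun chi => g (char_mul psi chi)).
Proof.
move=> bg; split; first exact: measurableT_comp bg.1 (measurable_char_mul psi).
by have [M gM] := bg.2; exists M => chi; exact: gM.
Qed.

End HaarIntegral.

Section MeasurableSums.
Variable (c : 'I_N -> R[i]).

Definition char_vals (chi : character A) (j : 'I_N) : R[i] := chi (zspan_gen A j).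

Lemma measurable_Re_csum (b : 'I_N -> R[i]) (u : 'I_N -> zspan A) (w : R[i]) :
  measurable_fun setT (fun chi : dual A =>
     complex.Re (\sum_j b j * char_fun chi (u j) + w)).
Proof.
rewrite (_ : (fun _ => _) = (fun chi : dual A => \sum_j
   (complex.Re (b j) * complex.Re (char_fun chi (u j))
     - complex.Im (b j) * complex.Im (char_fun chi (u j))) + complex.Re w)); last first.
  by apply/funext => chi; rewrite complexReD complexRe_sum; congr (_ + _);
    apply: eq_bigr => j _; rewrite complexReM.
apply: measurable_funD; last exact: measurable_cst.
apply: measurable_sum => j; apply: measurable_funB; apply: measurable_funM;
  by [exact: measurable_cst|exact: measurable_Re_char|exact: measurable_Im_char].
Qed.

Lemma measurable_Im_csum (b : 'I_N -> R[i]) (u : 'I_N -> zspan A) (w : R[i]) :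
  measurable_fun setT (fun chi : dual A =>
     complex.Im (\sum_j b j * char_fun chi (u j) + w)).
Proof.
rewrite (_ : (fun _ => _) = (fun chi : dual A => \sum_j
   (complex.Re (b j) * complex.Im (char_fun chi (u j))
     + complex.Im (b j) * complex.Re (char_fun chi (u j))) + complex.Im w)); last first.
  by apply/funext => chi; rewrite complexImD complexIm_sum; congr (_ + _);
    apply: eq_bigr => j _; rewrite complexImM.
apply: measurable_funD; last exact: measurable_cst.
apply: measurable_sum => j; apply: measurable_funD; apply: measurable_funM;
  by [exact: measurable_cst|exact: measurable_Re_char|exact: measurable_Im_char].
Qed.

End MeasurableSums.

End DualGroup.

(** * Estimates for the logarithm and the arctangent *)

Section LogEstimates.
Variable R : realType.
Implicit Types z : R[i].

Lemma ln_near1 (t : R) : `|t| <= 1 / 2 -> `|ln (1 + t) - t| <= 2 * t ^+ 2.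
Proof.
rewrite ler_norml => /andP[t1 t2].
have t0 : 0 < 1 + t by lra.
have lnle (s : R) : 0 < 1 + s -> ln (1 + s) <= s.
  move=> s0; rewrite -[leRHS]expRK ler_ln ?posrE ?expR_gt0//; exact: expR_ge1Dx.
have up := lnle t t0.
have lo : - ln (1 + t) <= (1 + t)^-1 - 1.
  rewrite -lnV ?posrE//; have := lnle ((1 + t)^-1 - 1).
  by rewrite [1 + (_ - 1)]addrC subrK invr_gt0; apply.
have h : (1 + t)^-1 - 1 <= - t + 2 * t ^+ 2.
  rewrite lerBlDr -(ler_pM2l t0) mulfV ?gt_eqF//.
  have : 0 <= t ^+ 2 * (1 + 2 * t) by rewrite mulr_ge0 ?sqr_ge0//; lra.
  rewrite !expr2; nra.
rewrite ler_norml; apply/andP; split; last by have := sqr_ge0 t; lra.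
lra.
Qed.

(** Twice the logarithm is ln (1 + t) with t = 2 Re z + |z|^2 and |t| <= 3 |z|; the error is then at
    most (18 + 1) / 2 times |z|^2. *)
Lemma ln_modulus_near1 z : modulus z <= 1 / 8 ->
  `|ln (modulus (1 + z)) - complex.Re z| <= 20 * modulus z ^+ 2.
Proof.
move=> z1; have z0 := modulus_ge0 z.
have Rz := normRe_le_modulus z.
set m := modulus z in z1 z0 Rz *.
pose t := 2 * complex.Re z + m ^+ 2.
have E : modulus (1 + z) ^+ 2 = 1 + t.
  by rewrite /t /m !sqr_modulus complexReD complexImD /=; ring.
have t3 : `|t| <= 3 * m.
  move: Rz; rewrite /t !ler_norml => /andP[R1 R2]; apply/andP; split; nra.
have t2 : `|t| <= 1 / 2 by lra.
have t0 : 0 < 1 + t by move: t2; rewrite ler_norml => /andP[]; lra.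
have mz : 0 < modulus (1 + z).
  rewrite lt_neqAle modulus_ge0 andbT eq_sym; apply: contraTneq t0 => z10.
  by rewrite -E z10 expr0n ltxx.
have := ln_near1 t2.
rewrite -E lnXn// mulr2n.
have : t ^+ 2 <= 9 * m ^+ 2.
  rewrite -[t ^+ 2]real_normK ?num_real//.
  have -> : 9 * m ^+ 2 = (3 * m) ^+ 2 by ring.
  by rewrite lerXn2r ?nnegrE// mulr_ge0.
have tE : t = 2 * complex.Re z + m ^+ 2 by [].
move: (ln _) => L; rewrite !ler_norml.
clearbody t; have := sqr_ge0 m => m2 h /andP[h1 h2]; apply/andP; split; lra.
Qed.

Lemma norm_ln_modulus_near1 z : modulus z <= 1 / 8 -> `|ln (modulus (1 + z))| <= 4 * modulus z.
Proof.
move=> z1; have z0 := modulus_ge0 z.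
have := ln_modulus_near1 z1; have := normRe_le_modulus z.
move: (ln _) => L; rewrite !ler_norml => /andP[h1 h2] /andP[h3 h4]; apply/andP; split; nra.
Qed.

Lemma atan_near0 (t : R) : `|t| <= 1 -> `|atan t - t| <= t ^+ 2.
Proof.
move=> t1.
wlog t0 : t t1 / 0 <= t.
  move=> H; have [|/ltW t0] := leP 0 t; first exact: H.
  have := H (- t); rewrite normrN oppr_ge0 sqrrN atanN -opprB opprK normrN => /(_ t1 t0).
  by rewrite addrC.
have [->|tn0] := eqVneq t 0; first by rewrite atan0 subrr normr0 sqr_ge0.
have {}t0 : 0 < t by rewrite lt_neqAle eq_sym tn0.
have {}t1 : t <= 1 by apply: le_trans (ler_norm t) t1.
have df s : s \in `]0, t[%R -> is_derive s (1 : R) (fun s : R => atan s - s) ((1 + s ^+ 2)^-1 - 1).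
  by move=> _; apply: is_derive_eq.
have [|s] := MVT t0 df.
  apply: continuous_subspaceT => s; apply: cvgB; [exact: continuous_atan|exact: cvg_id].
rewrite in_itv /= => /andP[s0 st]; rewrite atan0 !subr0 => ->.
rewrite normrM (gtr0_norm t0) expr2 ler_pM2r//.
have s2 : 0 < 1 + s ^+ 2 by rewrite ltr_pwDl// sqr_ge0.
have -> : (1 + s ^+ 2)^-1 - 1 = - (s ^+ 2 / (1 + s ^+ 2)).
  by field; rewrite gt_eqF.
rewrite normrN ger0_norm ?divr_ge0 ?sqr_ge0 ?(ltW s2)//.
rewrite ler_pdivrMr//; nra.
Qed.

End LogEstimates.

(** * From vanishing second differences to affinity *)

Section MidpointAffine.
Variables (R : realType) (p : nat) (h : 'rV[R]_p -> R) (x : 'rV[R]_p) (r C : R).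

Lemma midpoint_in_ball (q v : 'rV[R]_p) : `|q + v - x| < r -> `|q - v - x| < r -> `|q - x| < r.
Proof.
move=> h1 h2.
have -> : q - x = 2^-1 *: (q + v - x) + 2^-1 *: (q - v - x).
  rewrite -scalerDr; apply/rowP => i; rewrite !mxE.
  by field.
apply: le_lt_trans (ler_normD _ _) _; rewrite !normrZ ger0_norm ?invr_ge0//; lra.
Qed.

(* The second difference over [v] is a combination with total weight 4 of second
   differences over [v/2], so a cubic bound improves by a factor 1/2 at each halving. *)
Lemma cubic_second_difference_eq0 :
  (forall q v, `|q + v - x| < r -> `|q - v - x| < r ->
     `|h (q + v) + h (q - v) - 2 * h q| <= C * `|v| ^+ 3) ->
  forall q v, `|q + v - x| < r -> `|q - v - x| < r ->
     h (q + v) + h (q - v) = 2 * h q.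
Proof.
move=> H.
have key k : forall q v, `|q + v - x| < r -> `|q - v - x| < r ->
     `|h (q + v) + h (q - v) - 2 * h q| <= 2^-1 ^+ k * (C * `|v| ^+ 3).
  elim: k => [|k IH] q v hp hm; first by rewrite expr0 mul1r; exact: H.
  pose w : 'rV[R]_p := 2^-1 *: v.
  have ww : w + w = v by rewrite /w -scalerDl -[X in _ = X]scale1r; congr (_ *: _); field.
  have hq := midpoint_in_ball hp hm.
  have e1 : q + w + w = q + v by rewrite -addrA ww.
  have e2 : q - w - w = q - v by rewrite -addrA -opprD ww.
  have hqp : `|q + w - x| < r by apply: (@midpoint_in_ball _ w); rewrite ?e1 ?addrK.
  have hqm : `|q - w - x| < r by apply: (@midpoint_in_ball _ w); rewrite ?e2 ?subrK.
  have i1 := IH (q + w) w; rewrite e1 addrK in i1.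
  have i2 := IH (q - w) w; rewrite e2 subrK in i2.
  have {}i1 := i1 hp hq. have {}i2 := i2 hq hm.
  have i3 := IH q w hqp hqm.
  have nw : `|w| = 2^-1 * `|v| by rewrite /w normrZ ger0_norm// invr_ge0.
  have -> : h (q + v) + h (q - v) - 2 * h q =
     (h (q + v) + h q - 2 * h (q + w)) + 2 * (h (q + w) + h (q - w) - 2 * h q)
     + (h q + h (q - v) - 2 * h (q - w)) by ring.
  apply: le_trans (ler_normD _ _) _; apply: le_trans (lerD (ler_normD _ _) (lexx _)) _.
  rewrite normrM (ger0_norm (_ : 0 <= 2))//.
  set X := 2^-1 ^+ k * (C * `|v| ^+ 3).
  have E1 : 2^-1 ^+ k.+1 * (C * `|v| ^+ 3) = 2^-1 * X by rewrite exprS -mulrA.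
  have E2 : 2^-1 ^+ k * (C * `|w| ^+ 3) = 8^-1 * X.
    by rewrite nw /X; move: (2^-1 ^+ k) => Y; field.
  rewrite E1; rewrite E2 in i1 i2 i3; lra.
move=> q v hp hm; apply/eqP; rewrite -subr_eq0 -normr_le0.
apply/ler_addgt0Pr => e e0; rewrite add0r.
have [k Hk] : exists k : nat, 2^-1 ^+ k * (C * `|v| ^+ 3) <= e.
  pose X := C * `|v| ^+ 3.
  exists (Num.truncn (`|X| / e)).
  have h1 : `|X| / e < (Num.truncn (`|X| / e)).+1%:R by exact: truncnS_gt.
  apply: le_trans (ler_norm _) _; rewrite normrM ger0_norm ?exprn_ge0 ?invr_ge0//.
  rewrite -/X exprVn ler_pdivrMl ?exprn_gt0//.
  move: h1; rewrite ltr_pdivrMr// => /ltW h1; apply: le_trans h1 _.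
  rewrite ler_pM2r// -natrX ler_nat; exact: ltn_expl.
exact: le_trans (key k q v hp hm) Hk.
Qed.

(** The deviation from the affine function doubles exactly when w doubles, yet is O(|w|^2) near 0;
    scaling down and back up 2^k times leaves K |w|^2 / 2^k, so it is 0 on the whole ball. *)
Lemma midpoint_affine_propagation (alpha : 'cV[R]_p) (q0 : 'rV[R]_p) (e K : R) :
  (forall q v, `|q + v - x| < r -> `|q - v - x| < r -> h (q + v) + h (q - v) = 2 * h q) ->
  `|q0 - x| < r -> 0 < e ->
  (forall w, `|w| < e -> `|h (q0 + w) - h q0 - dot w alpha| <= K * `|w| ^+ 2) ->
  forall q, `|q - x| < r -> h q - h q0 = dot (q - q0) alpha.
Proof.
move=> H q0r e0 He.
pose psi w := h (q0 + w) - h q0 - dot w alpha.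
have half w : `|q0 + w - x| < r ->  `|q0 + 2^-1 *: w - x| < r /\ psi w = 2 * psi (2^-1 *: w).
  move=> wr; set u := 2^-1 *: w.
  have uu : u + u = w by rewrite /u -scalerDl -[X in _ = X]scale1r; congr (_ *: _); field.
  have h1 : `|q0 + u + u - x| < r by rewrite -(addrA q0) uu.
  have h2 : `|q0 + u - u - x| < r by rewrite addrK.
  split; first exact: midpoint_in_ball h1 h2.
  have := H _ _ h1 h2; rewrite addrK -(addrA q0) uu /psi -uu dotDl uu; lra.
have iter k : forall w, `|q0 + w - x| < r -> psi w = 2 ^+ k * psi (2^-1 ^+ k *: w).
  elim: k => [|k IH] w wr; first by rewrite !expr0 scale1r mul1r.
  have [ur ->] := half w wr.
  by rewrite (IH _ ur) exprS -mulrA scalerA -exprSr.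
move=> q qr; apply/eqP; rewrite -subr_eq0.
suff : psi (q - q0) = 0 by rewrite /psi (addrC q0) subrK => ->.
set w := q - q0; have wr : `|q0 + w - x| < r by rewrite /w (addrC q0) subrK.
apply/eqP; rewrite -normr_le0; apply/ler_addgt0Pr => f f0; rewrite add0r.
pose X := `|w| / e + `|K| * `|w| ^+ 2 / f.
pose k := Num.truncn X.
have kX : X <= 2 ^+ k.
  apply: le_trans (ltW (truncnS_gt _)) _; rewrite -natrX ler_nat; exact: ltn_expl.
have X1 : `|w| / e <= X by rewrite /X lerDl divr_ge0 ?(ltW f0)// mulr_ge0 ?exprn_ge0.
have X2 : `|K| * `|w| ^+ 2 / f <= X by rewrite /X lerDr divr_ge0 ?(ltW e0).
have p0 : 0 < 2 ^+ k :> R by rewrite exprn_gt0.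
have we : `|2^-1 ^+ k.+1 *: w| < e.
  rewrite normrZ ger0_norm ?exprn_ge0 ?invr_ge0// exprVn.
  rewrite ltr_pdivrMl ?exprn_gt0// exprS.
  have we : `|w| <= 2 ^+ k * e by rewrite -ler_pdivrMr// (le_trans X1).
  apply: le_lt_trans we _; rewrite -mulrA ltr_pMl ?ltr1n// mulr_gt0//.
rewrite (iter k.+1 w wr) normrM ger0_norm ?exprn_ge0//.
apply: le_trans (ler_wpM2l _ (He _ we)) _; first by rewrite exprn_ge0.
rewrite normrZ ger0_norm ?exprn_ge0 ?invr_ge0//.
set Y := 2 ^+ k.+1 ; have Y0 : 0 < Y by rewrite exprn_gt0.
have -> : Y * (K * (2^-1 ^+ k.+1 * `|w|) ^+ 2) = K * `|w| ^+ 2 / Y.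
  by rewrite exprVn -/Y; move: Y Y0 => Y Y0; field; rewrite gt_eqF.
rewrite ler_pdivrMr//.
apply: (@le_trans _ _ (`|K| * `|w| ^+ 2)).
  by rewrite ler_wpM2r ?exprn_ge0// ler_norm.
have fk : `|K| * `|w| ^+ 2 <= f * 2 ^+ k.
  by rewrite (mulrC f) -ler_pdivrMr// (le_trans X2).
apply: le_trans fk _; by rewrite /Y ler_pM2l// ler_weXn2l// ler1n.
Qed.

End MidpointAffine.

(** * The product over four points *)

Section FourPoints.
Variable R : realType.
Implicit Types z : R[i].

Lemma modulus_nat (k : nat) : modulus (k%:R : R[i]) = k%:R.
Proof. by rewrite -(rmorph_nat (real_complex R)) modulus_real normr_nat. Qed.

Lemma modulus_prod2_dist (a1 a2 b1 b2 : R[i]) (K e : R) :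
  modulus a1 <= K -> modulus b2 <= K -> modulus (a1 - b1) <= e -> modulus (a2 - b2) <= e ->
  modulus (a1 * a2 - b1 * b2) <= 2 * K * e.
Proof.
move=> a1K b2K h1 h2.
have -> : a1 * a2 - b1 * b2 = a1 * (a2 - b2) + (a1 - b1) * b2 by ring.
apply: le_trans (modulusD _ _) _; rewrite !modulusM.
have : modulus a1 * modulus (a2 - b2) <= K * e by rewrite ler_pM ?modulus_ge0.
have : modulus (a1 - b1) * modulus b2 <= e * K by rewrite ler_pM ?modulus_ge0.
lra.
Qed.

Lemma modulus_prod_le (a b : R[i]) (K L : R) : modulus a <= K -> modulus b <= L ->
  modulus (a * b) <= K * L.
Proof. by move=> aK bL; rewrite modulusM ler_pM ?modulus_ge0. Qed.

(* The product of [1 + s m1 + s^2 m2] over the fourth roots of unity [s] is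
   [1 - 2 m2^2 + m2^4 + 4 m2 m1^2 - m1^4]: the terms of order below 4 cancel. *)
Lemma four_point_product (M : R) : 1 <= M -> exists2 K : R, 0 <= K &
  forall (m1 m2 r1 r2 r3 r4 i : R[i]) (L : R), i * i = -1 -> 0 <= L <= 1 ->
    modulus m1 <= M * L -> modulus m2 <= M * L ^+ 2 ->
    modulus r1 <= M * L ^+ 3 -> modulus r2 <= M * L ^+ 3 ->
    modulus r3 <= M * L ^+ 3 -> modulus r4 <= M * L ^+ 3 ->
    modulus ((1 + m1 + m2 + r1) * (1 - m1 + m2 + r2) *
      ((1 + i * m1 - m2 + r3) * (1 - i * m1 - m2 + r4)) - 1) <= K * L ^+ 3.
Proof.
(* [K1] bounds the four monomials of the exact product minus 1; [K2] below bounds the effect of the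
   remainders, every factor having modulus at most 4 M. *)
move=> M1; pose K1 := 2 * M ^+ 2 + 2 * M ^+ 4 + 4 * M ^+ 3.
have M0 : 0 <= M by lra.
have K10 : 0 <= K1 by rewrite /K1 !addr_ge0// mulr_ge0// exprn_ge0.
pose K2 := 2 * ((4 * M) * (4 * M)) * (2 * (4 * M) * M).
have K20 : 0 <= K2 by rewrite /K2 !mulr_ge0.
exists (K1 + K2); first exact: addr_ge0.
move=> m1 m2 r1 r2 r3 r4 i L ii /andP[L0 L1] hm1 hm2 hr1 hr2 hr3 hr4.
have i1 : modulus i = 1.
  have : modulus i ^+ 2 = 1 by rewrite expr2 -modulusM ii modulusN modulus1.
  by move/eqP; rewrite sqrp_eq1 ?modulus_ge0// => /eqP.
have L2 : L ^+ 2 <= 1 by rewrite exprn_ile1.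
have L3 : L ^+ 3 <= 1 by rewrite exprn_ile1.
have L30 : 0 <= L ^+ 3 by rewrite exprn_ge0.
have m1M : modulus m1 <= M by nra.
have im1M : modulus (i * m1) <= M by rewrite modulusM i1 mul1r.
have m2M : modulus m2 <= M by nra.
have rM (r : R[i]) : modulus r <= M * L ^+ 3 -> modulus r <= M by move=> h; nra.
have b3 (x y : R[i]) : modulus x <= M -> modulus y <= M -> modulus (1 + x + y) <= 4 * M.
  move=> hx hy; apply: le_trans (modulusD _ _) _.
  apply: le_trans (lerD (modulusD _ _) (lexx _)) _; rewrite modulus1; lra.
have b4 (x y z : R[i]) : modulus x <= M -> modulus y <= M -> modulus z <= M ->
    modulus (1 + x + y + z) <= 4 * M.
  move=> hx hy hz; apply: le_trans (modulusD _ _) _.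
  apply: le_trans (lerD (modulusD _ _) (lexx _)) _.
  apply: le_trans (lerD (lerD (modulusD _ _) (lexx _)) (lexx _)) _; rewrite modulus1; lra.
set a1 := 1 + m1 + m2 + r1; set a2 := 1 - m1 + m2 + r2.
set a3 := 1 + i * m1 - m2 + r3; set a4 := 1 - i * m1 - m2 + r4.
pose b1 := 1 + m1 + m2; pose b2 := 1 - m1 + m2.
pose c3 := 1 + i * m1 - m2; pose c4 := 1 - i * m1 - m2.
have d12 : modulus (a1 * a2 - b1 * b2) <= 2 * (4 * M) * (M * L ^+ 3).
  apply: modulus_prod2_dist.
  - exact: b4 m1M m2M (rM _ hr1).
  - by apply: b3 => //; rewrite modulusN.
  - by rewrite /a1 addrAC subrr add0r.
  - by rewrite /a2 addrAC subrr add0r.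
have d34 : modulus (a3 * a4 - c3 * c4) <= 2 * (4 * M) * (M * L ^+ 3).
  apply: modulus_prod2_dist.
  - by apply: b4 => //; [rewrite modulusN|exact: rM].
  - by apply: b3 => //; rewrite modulusN.
  - by rewrite /a3 addrAC subrr add0r.
  - by rewrite /a4 addrAC subrr add0r.
have d1234 : modulus (a1 * a2 * (a3 * a4) - b1 * b2 * (c3 * c4)) <=
    2 * ((4 * M) * (4 * M)) * (2 * (4 * M) * (M * L ^+ 3)).
  apply: modulus_prod2_dist => //.
  - apply: modulus_prod_le; first exact: b4 m1M m2M (rM _ hr1).
    by apply: b4 => //; [rewrite modulusN|exact: rM].
  - by apply: modulus_prod_le; apply: b3 => //; rewrite modulusN.
have E : b1 * b2 * (c3 * c4) - 1 =
    (- (2%:R * (m2 * m2)) + (m2 * m2) * (m2 * m2)) + (4%:R * (m2 * (m1 * m1)) - (m1 * m1) * (m1 * m1)).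
  have -> : c3 * c4 = (1 - m2) * (1 - m2) + m1 * m1.
    rewrite /c3 /c4; transitivity ((1 - m2) * (1 - m2) - (i * i) * (m1 * m1)); first ring.
    by rewrite ii; ring.
  by rewrite /b1 /b2; ring.
have eqle (x y : R) : x = y -> x <= y by move=> ->.
have h22 : modulus (m2 * m2) <= (M * L ^+ 2) * (M * L ^+ 2) by exact: modulus_prod_le.
have h11 : modulus (m1 * m1) <= (M * L) * (M * L) by exact: modulus_prod_le.
have d1 : modulus (b1 * b2 * (c3 * c4) - 1) <= K1 * L ^+ 3.
  rewrite E; apply: le_trans (modulusD _ _) _.
  apply: le_trans (lerD (modulusD _ _) (modulusD _ _)) _.
  have t1 : modulus (- (2%:R * (m2 * m2))) = 2 * modulus (m2 * m2).
    by rewrite modulusN modulusM modulus_nat.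
  have t2 : modulus (4%:R * (m2 * (m1 * m1))) = 4 * modulus (m2 * (m1 * m1)).
    by rewrite modulusM modulus_nat.
  rewrite t1 t2 modulusN.
  have g1 : 2 * modulus (m2 * m2) <= 2 * M ^+ 2 * L ^+ 3.
    apply: (@le_trans _ _ (2 * M ^+ 2 * L ^+ 3 * L)).
      by rewrite -!mulrA ler_wpM2l//; apply: le_trans h22 _; apply: eqle; ring.
    by rewrite ler_piMr// !mulr_ge0// exprn_ge0.
  have g2 : modulus (m2 * m2 * (m2 * m2)) <= M ^+ 4 * L ^+ 3.
    apply: (@le_trans _ _ (M ^+ 4 * L ^+ 3 * L ^+ 5)).
      by apply: le_trans (modulus_prod_le h22 h22) _; apply: eqle; ring.
    by rewrite ler_piMr ?exprn_ile1// !mulr_ge0// exprn_ge0.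
  have g3 : 4 * modulus (m2 * (m1 * m1)) <= 4 * M ^+ 3 * L ^+ 3.
    apply: (@le_trans _ _ (4 * M ^+ 3 * L ^+ 3 * L)).
      by rewrite -!mulrA ler_wpM2l//; apply: le_trans (modulus_prod_le hm2 h11) _; apply: eqle; ring.
    by rewrite ler_piMr// !mulr_ge0// exprn_ge0.
  have g4 : modulus (m1 * m1 * (m1 * m1)) <= M ^+ 4 * L ^+ 3.
    apply: (@le_trans _ _ (M ^+ 4 * L ^+ 3 * L)).
      by apply: le_trans (modulus_prod_le h11 h11) _; apply: eqle; ring.
    by rewrite ler_piMr// !mulr_ge0// exprn_ge0.
  rewrite /K1; lra.
have -> : a1 * a2 * (a3 * a4) - 1 =
  (a1 * a2 * (a3 * a4) - b1 * b2 * (c3 * c4)) + (b1 * b2 * (c3 * c4) - 1) by ring.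
apply: le_trans (modulusD _ _) _; rewrite [leRHS]mulrDl [leRHS]addrC lerD//.
apply: le_trans d1234 _; rewrite /K2; lra.
Qed.

End FourPoints.

(** * The Ronkin function near a point with a uniform lower bound *)

Section Ronkin.
Variables (R : realType) (p N : nat) (A : 'M[R]_(p, N)) (c : 'I_N -> R[i]).
Variables (eta : probability (dual A) R) (eta_haar : is_haar eta).
Implicit Types (x q v : 'rV[R]_p) (chi : character A).

(** Both translates of [g0] have the mean of [g0], so they turn the coefficient -4 into -2: the
    four-point difference has the mean of a real second difference. *)
Lemma haar_mean_comb (g1 g2 g0 : dual A -> R) (psi1 psi2 : character A) :
  bounded_measurable g1 -> bounded_measurable g2 -> bounded_measurable g0 ->
  let g chi := (g1 chi + g2 chi) + (g0 (char_mul psi1 chi) + g0 (char_mul psi2 chi))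
    + (- 4%:R) * g0 chi in
  bounded_measurable g /\
  haar_mean eta g1 + haar_mean eta g2 - 2 * haar_mean eta g0 = haar_mean eta g.
Proof.
move=> b1 b2 b0 g; rewrite /g {g}.
pose g3 (chi : dual A) := g0 (char_mul psi1 chi).
pose g4 (chi : dual A) := g0 (char_mul psi2 chi).
have E3 : haar_mean eta g3 = haar_mean eta g0 := haar_mean_shift psi1 eta_haar b0.
have E4 : haar_mean eta g4 = haar_mean eta g0 := haar_mean_shift psi2 eta_haar b0.
have b3 : bounded_measurable g3 := bounded_measurable_shift psi1 b0.
have b4 : bounded_measurable g4 := bounded_measurable_shift psi2 b0.
have b12 := bounded_measurableD b1 b2; have b34 := bounded_measurableD b3 b4.
have bk := bounded_measurableZ (- 4%:R) b0; have b1234 := bounded_measurableD b12 b34.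
split; first exact: bounded_measurableD b1234 bk.
transitivity (haar_mean eta g1 + haar_mean eta g2 + (haar_mean eta g3 + haar_mean eta g4)
   + (- 4%:R) * haar_mean eta g0).
  by rewrite E3 E4; move: (haar_mean _ _) (haar_mean _ _) (haar_mean _ _) => X Y Z; ring.
apply: esym; apply: etrans (haar_meanD eta b1234 bk) _.
congr (_ + _); last exact: haar_meanZ.
apply: etrans (haar_meanD eta b12 b34) _.
by congr (_ + _); exact: haar_meanD.
Qed.

Definition logmod x (chi : dual A) : R := ln (modulus (tsum A c (char_vals (chi : character A)) x)).

Definition lower_bounded x (d : R) :=
  forall chi : character A, d <= modulus (tsum A c (char_vals chi) x).

Lemma modulus_char_vals chi j : modulus (char_vals chi j) = 1.
Proof. exact: char_unit. Qed.

Lemma modulus_tsum_le chi x : modulus (tsum A c (char_vals chi) x) <=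
  \sum_j modulus (c j) * expR (dot x (col j A)).
Proof.
apply: le_trans (modulus_sum _ _ _) _.
by rewrite (sum_modulus_tcoef A c x (modulus_char_vals chi)).
Qed.

Lemma bounded_measurable_logmod x d : 0 < d -> lower_bounded x d ->
  bounded_measurable (logmod x).
Proof.
have half (y : R) : y = 2^-1 * (y *+ 2) by lra.
move=> d0 dx; split.
  rewrite (_ : logmod x = fun chi => 2^-1 * ln
     (complex.Re (\sum_j (c j * (expR (dot x (col j A)))%:C%C) * char_fun chi (zspan_gen A j) + 0) ^+ 2
     + complex.Im (\sum_j (c j * (expR (dot x (col j A)))%:C%C) * char_fun chi (zspan_gen A j) + 0) ^+ 2));
    last first.
    apply/funext => chi; rewrite -sqr_modulus addr0.
    have E : \sum_j c j * (expR (dot x (col j A)))%:C%C * char_fun chi (zspan_gen A j) =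
        tsum A c (char_vals (chi : character A)) x.
      by apply: eq_bigr => j _; rewrite mulrAC.
    rewrite E lnXn; last exact: lt_le_trans d0 (dx chi).
    exact: half.
  apply: measurable_funM; first exact: measurable_cst.
  apply: measurableT_comp; first exact: measurable_ln.
  apply: measurable_funD; apply: measurable_funX;
    [exact: measurable_Re_csum|exact: measurable_Im_csum].
set T := \sum_j modulus (c j) * expR (dot x (col j A)).
exists (`|ln d| + `|ln T|) => chi.
have h1 := dx chi; have h2 := modulus_tsum_le chi x.
have z0 := lt_le_trans d0 h1; have T0 := lt_le_trans z0 h2.
have g1 : ln d <= logmod x chi by rewrite ler_ln ?posrE.
have g2 : logmod x chi <= ln T by rewrite ler_ln ?posrE.
have := ler_norm (ln T); have := ler_norm (- ln d); rewrite normrN.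
have := normr_ge0 (ln T); have := normr_ge0 (ln d).
rewrite ler_norml => *; apply/andP; split; lra.
Qed.

Lemma ronkinE x d : 0 < d -> lower_bounded x d ->
  ronkin c eta x = haar_mean eta (logmod x).
Proof.
move=> d0 dx; rewrite /ronkin /haar_mean /Rintegral; congr fine.
apply: eq_integral => chi _; rewrite /= leNgt.
by rewrite (lt_le_trans d0 (dx chi)).
Qed.

Lemma lower_bounded_near x d : 0 < d -> lower_bounded x d ->
  exists2 r : R, 0 < r & forall q, `|q - x| < r -> lower_bounded q (d / 2).
Proof.
move=> d0 dx; have [C C0 HC] := tsum_near A c x.
pose r := Num.min (colbound A)^-1 (d / (2 * (1 + C))).
exists r.
  by rewrite lt_min invr_gt0 colbound_gt0 divr_gt0// mulr_gt0// ltr_pwDl.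
move=> q; rewrite lt_min => /andP[q1 q2] chi.
have v1 : `|q - x| * colbound A <= 1.
  by rewrite -ler_pdivlMr ?colbound_gt0// div1r ltW.
have := HC (char_vals chi) (q - x) (modulus_char_vals chi) v1.
rewrite (addrC x) subrK => h1.
have := modulus_triangle (tsum A c (char_vals chi) x) (tsum A c (char_vals chi) q).
rewrite modulus_distC; have h2 := dx chi.
move: q2; rewrite ltr_pdivlMr ?mulr_gt0 ?ltr_pwDl// => q2.
have := normr_ge0 (q - x); nra.
Qed.

Lemma phase_char_morph theta (u v : zspan A) :
  cis (dot theta (val (u + v))) = cis (dot theta (val u)) * cis (dot theta (val v)).
Proof. by rewrite raddfD dotDr cisD. Qed.

Lemma phase_char_unit theta (u : zspan A) : modulus (cis (dot theta (val u))) = 1.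
Proof. exact: modulus_cis. Qed.

(** Multiplying chi by this character is the translation of f_chi by i theta. *)
Definition phase_char theta : character A :=
  Character (phase_char_morph theta) (phase_char_unit theta).

Lemma char_vals_mul chi psi : char_vals (char_mul chi psi) =
  (fun j => char_vals chi j * char_vals psi j).
Proof. by []. Qed.

Lemma char_vals_phase theta : char_vals (phase_char theta) = phases A theta.
Proof. by []. Qed.

Lemma lower_bounded_midpoint x d : 0 < d -> lower_bounded x d ->
  exists2 r : R, 0 < r & forall q v, `|q + v - x| < r -> `|q - v - x| < r ->
    ronkin c eta (q + v) + ronkin c eta (q - v) = 2 * ronkin c eta q.
Proof.
move=> d0 dx; have [r1 r10 Hr1] := lower_bounded_near d0 dx.
have [C3 C30 HC3] := @line_sum_rem R 'I_N 3.
pose kap := colbound A; have kap0 : 0 < kap := colbound_gt0 A.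
pose S := \sum_j modulus (c j) * expR (dot x (col j A)).
have S0 : 0 <= S by rewrite sumr_ge0// => j _; rewrite mulr_ge0 ?modulus_ge0 ?expR_ge0.
(* Passing from x to a point q of the small ball multiplies each exponential by at most e. *)
pose T := S * expR 1; have T0 : 0 <= T by rewrite mulr_ge0 ?expR_ge0.
pose D := d / 2; have D0 : 0 < D by rewrite divr_gt0.
(* One constant for the Taylor coefficients (T / D) and the remainder (C3 T / D) after division by F
   0, whose modulus is at least D. *)
pose M := 1 + (1 + C3) * T / D.
have M1 : 1 <= M by rewrite /M lerDl divr_ge0 ?(ltW D0)// mulr_ge0// addr_ge0.
have [K K0 HK] := four_point_product M1.
(* With L = |v| kap this gives 8 (1 + K) L < 1, hence K L^3 <= 1/8, the range in which the logarithm
   is controlled. *)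
pose r := Num.min r1 (8 * (1 + K) * kap)^-1.
exists r; first by rewrite lt_min r10 invr_gt0 !mulr_gt0// ltr_pwDl.
apply: (@cubic_second_difference_eq0 _ _ _ _ _ (4 * K * kap ^+ 3)) => q v hp hm.
have hq := midpoint_in_ball hp hm.
have vr : `|v| < r.
  have -> : v = 2^-1 *: (q + v - x) - 2^-1 *: (q - v - x).
    by rewrite -scalerBr; apply/rowP => i; rewrite !mxE; field.
  apply: le_lt_trans (ler_normB _ _) _; rewrite !normrZ ger0_norm ?invr_ge0//; lra.
have rr (w : 'rV[R]_p) : `|w| < r -> `|w| < r1 /\ `|w| * kap * (8 * (1 + K)) < 1.
  rewrite lt_min => /andP[-> h]; split=> //.
  by rewrite -ltr_pdivlMr ?mulr_gt0 ?ltr_pwDl// mul1r; move: h; rewrite -ltr_pdivlMr// invfM.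
have lbq := Hr1 q (rr _ hq).1; have lbp := Hr1 _ (rr _ hp).1; have lbm := Hr1 _ (rr _ hm).1.
pose L := `|v| * kap.
have L0 : 0 <= L by rewrite mulr_ge0// ltW.
have LK : L * (8 * (1 + K)) < 1 := (rr v vr).2.
have L1 : L <= 1 by nra.
have Tq : \sum_j modulus (c j) * expR (dot q (col j A)) <= T.
  rewrite /T /S mulr_suml; apply: ler_sum => j _; rewrite -mulrA ler_wpM2l ?modulus_ge0//.
  rewrite -expRD ler_expR -{1}(subrK x q) dotDl addrC lerD2l.
  apply: le_trans (ler_norm _) _; apply: le_trans (norm_dot_col _ _ _) _.
  have := (rr _ hq).2; have : 0 <= `|q - x| * kap by rewrite mulr_ge0// ltW.
  rewrite -/kap; nra.
have bq := bounded_measurable_logmod D0 lbq.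
have bp := bounded_measurable_logmod D0 lbp.
have bm := bounded_measurable_logmod D0 lbm.
pose g (chi : dual A) := (logmod (q + v) chi + logmod (q - v) chi)
  + (logmod q (char_mul (phase_char v) chi) + logmod q (char_mul (phase_char (- v)) chi))
  + (- 4%:R) * logmod q chi.
have [bg Eg] := haar_mean_comb (phase_char v) (phase_char (- v)) bp bm bq.
rewrite (ronkinE D0 lbq) (ronkinE D0 lbp) (ronkinE D0 lbm) Eg -/g.
apply: norm_haar_mean_le => // chi.
set u := char_vals (chi : character A).
pose l j := dot v (col j A).
pose F := line_sum (tcoef A c u q) l.
have F0E : F 0 = tsum A c u q by apply: eq_bigr => j _; rewrite mulr0 cexp0 mulr1.
have F0 : 0 < modulus (F 0) by rewrite F0E; apply: lt_le_trans D0 (lbq chi).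
have FE (s1 s2 : R) : tsum A c (fun j => u j * phases A (s2 *: v) j) (q + s1 *: v) = F (Complex s1 s2).
  exact: tsum_complex_line.
have E1 : tsum A c u (q + v) = F 1.
  by rewrite /F -tsum_real_line.
have E2 : tsum A c u (q - v) = F (Complex (-1) 0).
  rewrite -FE scaleN1r; apply: eq_bigr => j _.
  by rewrite scale0r /phases dot0l cis0 mulr1.
have E3 : tsum A c (char_vals (char_mul (phase_char v) (chi : character A))) q = F (Complex 0 1).
  rewrite -FE scale0r addr0 scale1r; apply: eq_bigr => j _.
  by rewrite char_vals_mul char_vals_phase (mulrC (phases _ _ _)).
have E4 : tsum A c (char_vals (char_mul (phase_char (- v)) (chi : character A))) q = F (Complex 0 (-1)).
  rewrite -FE scale0r addr0 scaleN1r; apply: eq_bigr => j _.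
  by rewrite char_vals_mul char_vals_phase (mulrC (phases _ _ _)).
have F1 : 0 < modulus (F 1) by rewrite -E1; apply: lt_le_trans D0 (lbp chi).
have F2 : 0 < modulus (F (Complex (-1) 0)) by rewrite -E2; apply: lt_le_trans D0 (lbm chi).
have F3 : 0 < modulus (F (Complex 0 1)) by rewrite -E3; apply: lt_le_trans D0 (lbq _).
have F4 : 0 < modulus (F (Complex 0 (-1))) by rewrite -E4; apply: lt_le_trans D0 (lbq _).
have F0n : F 0 != 0 by rewrite -modulus_gt0.
pose t := tcoef A c u q.
have sumt : \sum_j modulus (t j) <= T.
  by rewrite (sum_modulus_tcoef A c q (modulus_char_vals (chi : character A))).
pose m1 := moment t l 1 / F 0; pose m2 := moment t l 2 / 2%:R / F 0.
pose rho s := F s / F 0 - (1 + s * m1 + s * s * m2).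
have lL j : `|l j| <= L := norm_dot_col A v j.
have F0D : D <= modulus (F 0) by rewrite F0E; exact: lbq.
have quot (z : R[i]) (B : R) : 0 <= B -> modulus z <= B -> modulus (z / F 0) <= B / D.
  move=> B0 zB; rewrite modulusM modulusV ler_pM ?modulus_ge0 ?invr_ge0 ?modulus_ge0//.
  by rewrite lef_pV2 ?posrE.
have mom k : modulus (moment t l k) <= T * L ^+ k.
  apply: le_trans (modulus_sum _ _ _) _.
  apply: (@le_trans _ _ (\sum_j modulus (t j) * L ^+ k)).
    apply: ler_sum => j _; rewrite modulusM modulus_real normrX ler_wpM2l ?modulus_ge0//.
    by rewrite lerXn2r ?nnegrE.
  by rewrite -mulr_suml ler_wpM2r ?exprn_ge0.
have TM : T / D <= M.
  rewrite /M [(1 + C3) * T]mulrDl mul1r mulrDl.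
  by rewrite addrCA lerDl addr_ge0// divr_ge0 ?(ltW D0)// mulr_ge0.
have CTM : C3 * T / D <= M.
  rewrite /M [(1 + C3) * T]mulrDl mul1r mulrDl addrA lerDr addr_ge0//.
  by rewrite divr_ge0 ?(ltW D0).
have hm1 : modulus m1 <= M * L.
  apply: le_trans (quot _ _ _ (mom 1%N)) _; first by rewrite mulr_ge0.
  by rewrite expr1 mulrAC ler_wpM2r.
have hm2 : modulus m2 <= M * L ^+ 2.
  apply: (@le_trans _ _ (modulus (moment t l 2 / F 0))).
    rewrite /m2 mulrAC [leLHS]modulusM ler_piMr ?modulus_ge0//.
    by rewrite modulusV modulus_nat invf_le1// ler1n.
  apply: le_trans (quot _ _ _ (mom 2%N)) _; first by rewrite mulr_ge0 ?exprn_ge0.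
  by rewrite mulrAC ler_wpM2r ?exprn_ge0.
have mom0 : moment t l 0 = F 0.
  by apply: eq_bigr => j _; rewrite expr0 mulr0 cexp0.
have hrho s : modulus s = 1 -> modulus (rho s) <= M * L ^+ 3.
  move=> s1; have ls j : modulus ((l j)%:C%C * s) <= L.
    by rewrite modulusM s1 mulr1 modulus_real.
  have := HC3 t l s L ls L1; set W := (X in modulus X <= _) => hW.
  have -> : rho s = W / F 0.
    rewrite /rho /W !big_ord_recr big_ord0 /= mom0 /m1 /m2 -/F.
    rewrite expr0 fact0 divr1 expr1 (_ : 1`! = 1%N)// divr1 (_ : 2`! = 2%N)// expr2.
    by field; rewrite F0n.
  apply: le_trans (quot _ (C3 * T * L ^+ 3) _ _) _.
  - by apply: mulr_ge0; [exact: mulr_ge0|exact: exprn_ge0].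
  - by apply: le_trans hW _; rewrite ler_wpM2r ?exprn_ge0// ler_wpM2l.
  - by rewrite mulrAC ler_wpM2r ?exprn_ge0//.
pose i : R[i] := Complex 0 1.
have ii : i * i = -1 by apply: complex_ext; rewrite /=; ring.
have i1 : modulus i = 1 by rewrite /modulus /= expr0n expr1n add0r sqrtr1.
have iN : Complex 0 (-1) = - i by apply: complex_ext; rewrite /= ?oppr0.
have oN : Complex (-1) 0 = -1 :> R[i] by apply: complex_ext; rewrite /= ?oppr0.
have L01 : 0 <= L <= 1 by rewrite L0 L1.
have modN1 : modulus (- 1 : R[i]) = 1 by rewrite modulusN modulus1.
have modNi : modulus (- i) = 1 by rewrite modulusN.
have hZ := HK m1 m2 (rho 1) (rho (-1)) (rho i) (rho (- i)) i L ii L01 hm1 hm2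
  (hrho 1 (modulus1 R)) (hrho (-1) modN1) (hrho i i1) (hrho (- i) modNi).
have R1 : 1 + m1 + m2 + rho 1 = F 1 / F 0 by rewrite /rho; ring.
have R2 : 1 - m1 + m2 + rho (-1) = F (-1) / F 0 by rewrite /rho; ring.
have R3 : 1 + i * m1 - m2 + rho i = F i / F 0.
  by rewrite /rho ii; ring.
have R4 : 1 - i * m1 - m2 + rho (- i) = F (- i) / F 0.
  by rewrite /rho mulrNN ii; ring.
rewrite R1 R2 R3 R4 in hZ; rewrite oN in F2 E2; rewrite iN in F4 E4.
set Z := F 1 / F 0 * (F (-1) / F 0) * (F i / F 0 * (F (- i) / F 0)) in hZ.
have gZ : g chi = ln (modulus Z).
  rewrite /g /logmod E1 E2 E3 E4 -/u -F0E /Z !modulusM !modulusV.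
  rewrite !lnM ?posrE ?mulr_gt0 ?invr_gt0// !lnV ?posrE//.
  by move: (ln _) (ln _) (ln _) (ln _) (ln _) => X1 X2 X3 X4 X5; ring.
have L3 : K * L ^+ 3 <= 1 / 8.
  have h1 : K * L ^+ 3 <= K * L.
    by rewrite ler_wpM2l// exprS ler_piMr// exprn_ile1.
  apply: le_trans h1 _; move: L0 LK; clear; move: L => L; lra.
rewrite gZ -[Z](subrK 1) addrC.
apply: le_trans (norm_ln_modulus_near1 (le_trans hZ L3)) _.
have -> : 4 * K * kap ^+ 3 * `|v| ^+ 3 = 4 * (K * L ^+ 3) by rewrite /L exprMn; ring.
by rewrite ler_pM2l.
Qed.

End Ronkin.

(** * Angles between nearby complex values *)

Section Angle.
Variable R : realType.
Implicit Types z : R[i].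

(* The principal argument of [z' / z] when that quotient has positive real part. *)
Definition angle z' z : R :=
  atan ((complex.Im z' * complex.Re z - complex.Re z' * complex.Im z) /
        (complex.Re z' * complex.Re z + complex.Im z' * complex.Im z)).

Definition acute z' z : bool :=
  0 < complex.Re z' * complex.Re z + complex.Im z' * complex.Im z.

Lemma cis_atan (t : R) : cis (atan t) = ((Num.sqrt (1 + t ^+ 2))^-1)%:C%C * (Complex 1 t).
Proof.
have c := cos_atan t.
have s : sin (atan t) = t * (Num.sqrt (1 + t ^+ 2))^-1.
  rewrite -c -{2}(atanK t) /tan divfK// c invr_eq0 sqrtr_eq0 -ltNge.
  by rewrite ltr_pwDl// sqr_ge0.
by rewrite cisE c s; apply: complex_ext => /=; ring.
Qed.

Lemma angleP z' z : acute z' z ->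
  z' * (modulus z)%:C%C = z * (modulus z')%:C%C * cis (angle z' z).
Proof.
rewrite /acute /angle cis_atan; set P := _ + _; set Q := _ - _ => P0.
have E : 1 + (Q / P) ^+ 2 = (modulus z' * modulus z / P) ^+ 2.
  rewrite !exprMn !sqr_modulus exprVn.
  have -> : (complex.Re z' ^+ 2 + complex.Im z' ^+ 2) * (complex.Re z ^+ 2 + complex.Im z ^+ 2) =
     P ^+ 2 + Q ^+ 2 by rewrite /P /Q; ring.
  by field; rewrite gt_eqF.
have z0 : z != 0 by apply: contraTneq P0 => z0; rewrite /P z0 /= !mulr0 addr0 ltxx.
have z'0 : z' != 0 by apply: contraTneq P0 => z'0; rewrite /P z'0 /= !mul0r addr0 ltxx.
have m0 : 0 < modulus z by rewrite modulus_gt0.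
have m'0 : 0 < modulus z' by rewrite modulus_gt0.
rewrite E sqrtr_sqr ger0_norm; last by rewrite divr_ge0 ?mulr_ge0 ?modulus_ge0 ?ltW.
have mm := sqr_modulus z.
have e1 : z * (P +i* Q)%C = z' * ((modulus z) ^+ 2)%:C%C.
  rewrite mm /P /Q; case: (z) (z') => a b [a' b'].
  by apply: complex_ext => /=; ring.
have -> : (1 +i* (Q / P))%C = (P^-1)%:C%C * (P +i* Q)%C.
  by apply: complex_ext => /=; field; rewrite gt_eqF.
have -> : z * (modulus z')%:C%C * (((modulus z' * modulus z / P)^-1)%:C%C * ((P^-1)%:C%C * (P +i* Q)%C)) =
   (z * (P +i* Q)%C) * (modulus z' * (modulus z' * modulus z / P)^-1 * P^-1)%:C%C.
  by rewrite !rmorphM /=; ring.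
rewrite e1 -mulrA -rmorphM /=; congr (_ * _%:C%C).
by field; rewrite !gt_eqF.
Qed.

Lemma norm_angle_lt z' z : `|angle z' z| < pi / 2.
Proof. by rewrite ltr_norml /angle atan_gtNpi2 atan_ltpi2. Qed.

Lemma angle_id z : angle z z = 0.
Proof. by rewrite /angle (mulrC (complex.Im z)) subrr mul0r atan0. Qed.

Lemma acute_near z' z (d : R) : 0 < d -> d <= modulus z -> modulus (z' - z) <= d / 2 -> acute z' z.
Proof.
move=> d0 dz zz.
have : 0 < modulus z ^+ 2 - modulus (z' - z) * modulus z.
  have := modulus_ge0 (z' - z); nra.
move=> /lt_le_trans; apply.
have := normRe_le_modulus ((z' - z) * (Complex (complex.Re z) (- complex.Im z))).
rewrite modulusM (_ : modulus (Complex _ _) = modulus z); last first.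
  by case: (z) => a b; rewrite /modulus /= sqrrN.
rewrite sqr_modulus complexReM complexReD complexImD complexReN complexImN /=.
rewrite ler_norml => /andP[h _]; lra.
Qed.

Lemma cis_eq1_small (t : R) : `|t| < 2 * pi -> cis t = 1 -> t = 0.
Proof.
rewrite cisE => t2 [c s].
wlog t0 : t t2 c s / 0 <= t.
  move=> H; have [|/ltW t0] := leP 0 t; first exact: H.
  by apply: oppr_inj; rewrite oppr0; apply: H; rewrite ?normrN ?cosN ?sinN ?s ?oppr0 ?oppr_ge0.
have {}t2 : t < 2 * pi by rewrite ger0_norm in t2.
have [tpi|pit] := leP t pi.
  by apply: (@cos_inj R); rewrite ?in_itv /= ?t0 ?tpi ?lexx ?pi_ge0// c cos0.
have p0 := pi_gt0 R.
have h : cos (2 * pi - t) = cos 0.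
  by rewrite -cosN opprB mulr_natl cosD cosN sinN cos2pi sin2pi c s cos0; ring.
have /eqP : 2 * pi - t = 0.
  by apply: (@cos_inj R) => //; rewrite in_itv /=; apply/andP; split; lra.
rewrite subr_eq0 => /eqP e; rewrite e ltxx in t2; discriminate.
Qed.

(* Both sides have the same image under [cis], and four angles of absolute value
   less than [pi / 2] cannot add up to a non-zero multiple of [2 * pi]. *)
Lemma angle_square (z00 z01 z10 z11 : R[i]) :
  acute z01 z00 -> acute z11 z10 -> acute z10 z00 -> acute z11 z01 ->
  angle z11 z01 - angle z10 z00 = angle z11 z10 - angle z01 z00.
Proof.
move=> a1 a2 a3 a4; apply/eqP; rewrite -subr_eq0; apply/eqP.
have nz z' z : acute z' z -> z' != 0 /\ z != 0.
  by move=> a; split; apply: contraTneq a => ->; rewrite /acute /= ?mul0r ?mulr0 addr0 ltxx.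
have [n01 n00] := nz _ _ a1; have [n11 n10] := nz _ _ a2.
have mc (z : R[i]) : z != 0 -> (modulus z)%:C%C != 0 :> R[i].
  by move=> z0; rewrite -modulus_gt0 modulus_real normr_gt0 modulus_eq0.
have E z' z : acute z' z -> cis (angle z' z) = z' * (modulus z)%:C%C / (z * (modulus z')%:C%C).
  move=> a; have [n' n] := nz _ _ a; rewrite (angleP a) mulrC mulKf//.
  by rewrite mulf_neq0 ?mc.
apply: cis_eq1_small.
  have := norm_angle_lt z11 z01; have := norm_angle_lt z10 z00.
  have := norm_angle_lt z11 z10; have := norm_angle_lt z01 z00.
  rewrite !ltr_norml => /andP[? ?] /andP[? ?] /andP[? ?] /andP[? ?]; apply/andP; split; lra.
rewrite !(cisD, cisN) !E//.
by field; rewrite !mc ?n00 ?n01 ?n10 ?n11.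
Qed.

End Angle.

(** * A bounded lift of the argument on the torus *)

Section Winding.
Variables (R : realType) (m : nat) (F : 'rV[R]_m -> R[i]) (d Lam : R).
Implicit Types psi : 'rV[R]_m.
Hypotheses (d0 : 0 < d) (Lam0 : 0 < Lam) (Fd : forall psi, d <= modulus (F psi)).
Hypothesis Flip : forall psi psi', modulus (F psi - F psi') <= Lam * `|psi - psi'|.
Hypothesis Fper : forall psi psi' : 'rV[R]_m,
  (forall j, cis (psi 0 j) = cis (psi' 0 j)) -> F psi = F psi'.
Hypothesis Feven : forall j (s : R), F (s *: delta_mx 0 j) = F (- s *: delta_mx 0 j).

Let close psi psi' := Lam * `|psi - psi'| <= d / 2.

Let close_acute psi psi' : close psi psi' -> acute (F psi) (F psi').
Proof. by move=> h; apply: acute_near d0 (Fd _) _; exact: le_trans (Flip _ _) h. Qed.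

Variables (B : R) (K : nat).
Hypotheses (B0 : 4 * pi <= B) (K0 : (0 < K)%N) (KB : Lam * B / K%:R <= d / 2).

Let node psi (t : nat) := (t%:R / K%:R) *: psi.

(** A branch of arg F(psi) - arg F(0), accumulated along the segment from 0 to psi. [K] is fine
    enough for consecutive nodes to be acute when |psi| <= B, and B has room for angles reduced to
    [0, 2 pi) plus a short step. *)
Definition lift_arg psi : R := \sum_(t < K) angle (F (node psi t.+1)) (F (node psi t)).

Lemma norm_lift_arg psi : `|lift_arg psi| <= K%:R * (pi / 2).
Proof.
apply: le_trans (ler_norm_sum _ _ _) _.
apply: (@le_trans _ _ (\sum_(t < K) (pi / 2))); last by rewrite sumr_const card_ord mulr_natl.
by apply: ler_sum => t _; exact: ltW (norm_angle_lt _ _).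
Qed.

(** The strip between the two segments is cut into quadrilaterals. [angle_square] makes their
    contributions telescope, and the edge at the origin contributes 0. *)
Lemma lift_arg_close psi psi' : `|psi| <= B -> `|psi'| <= B -> close psi' psi ->
  lift_arg psi' - lift_arg psi = angle (F psi') (F psi).
Proof.
move=> hB hB' cl.
have Kp : 0 < K%:R :> R by rewrite ltr0n.
have step q t : `|q| <= B -> acute (F (node q t.+1)) (F (node q t)).
  move=> qB; apply: close_acute; apply: le_trans KB; rewrite -mulrA ler_wpM2l ?(ltW Lam0)//.
  rewrite /node -scalerBl -mulrBl -natr1 addrAC subrr add0r normrZ.
  by rewrite mul1r ger0_norm ?invr_ge0 ?ler0n// mulrC ler_wpM2r ?invr_ge0 ?ler0n.
have cross t : (t <= K)%N -> acute (F (node psi' t)) (F (node psi t)).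
  move=> tK; apply: close_acute; apply: le_trans cl; rewrite ler_wpM2l ?(ltW Lam0)//.
  rewrite /node -scalerBr normrZ ger0_norm ?divr_ge0 ?ler0n//.
  by rewrite ler_piMl// ler_pdivrMr// mul1r ler_nat.
have tele n : (n <= K)%N ->
   \sum_(t < n) angle (F (node psi' t.+1)) (F (node psi' t))
   - \sum_(t < n) angle (F (node psi t.+1)) (F (node psi t)) =
   angle (F (node psi' n)) (F (node psi n)).
  elim: n => [|n IH] nK.
    by rewrite !big_ord0 subrr /node !mul0r !scale0r angle_id.
  rewrite !big_ord_recr /= opprD addrACA (IH (ltnW nK)) addrC.
  have := angle_square (step psi n hB) (step psi' n hB') (cross n (ltnW nK)) (cross n.+1 nK).
  lra.
rewrite /lift_arg tele// /node divff ?gt_eqF// !scale1r //.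
Qed.

Let coord_le psi j : `|psi 0 j| <= `|psi|.
Proof.
rewrite {2}/Num.norm /= mx_normrE.
exact: (le_bigmax_cond _ (fun i => `|psi i.1 i.2|) (j := (0, j))).
Qed.

Let norm_le_of_coord psi (b : R) : 0 <= b -> (forall j, `|psi 0 j| <= b) -> `|psi| <= b.
Proof.
move=> b0 H; rewrite {1}/Num.norm /= mx_normrE; apply: bigmax_le => // -[i j] _ /=.
by rewrite ord1.
Qed.

Let e j : 'rV[R]_m := (2 * pi) *: delta_mx 0 j.

Let F_shift psi j : F (psi + e j) = F psi.
Proof.
apply: Fper => k; rewrite !mxE eqxx /=; case: eqP => _; last by rewrite mulr0 addr0.
by rewrite mulr1 cisD cis2pi mulr1.
Qed.

Let norm_delta j : `|delta_mx 0 j : 'rV[R]_m| <= 1.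
Proof.
apply: norm_le_of_coord => // k; rewrite mxE eqxx /=; case: eqP => _; rewrite ?normr0 ?normr1 ?ler01//.
Qed.

(* Moving [psi] within the ball does not change the left-hand side minus the
   right-hand side, and at [psi = - pi *: delta_mx 0 j] both sides agree by [Feven]. *)
Lemma lift_arg_shift psi j : `|psi| <= B -> `|psi + e j| <= B ->
  lift_arg (psi + e j) = lift_arg psi.
Proof.
move=> h1 h2; apply/eqP; rewrite -subr_eq0; apply/eqP.
have p0 := pi_gt0 R.
pose q : 'rV[R]_m := (- pi) *: delta_mx 0 j.
have qe : q + e j = pi *: delta_mx 0 j.
  by rewrite /q /e -scalerDl; congr (_ *: _); ring.
have nq (s : R) : `|s| <= pi -> `|s *: (delta_mx 0 j : 'rV[R]_m)| <= B.
  move=> sp; rewrite normrZ; apply: (@le_trans _ _ (`|s| * 1)); first by rewrite ler_wpM2l.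
  have := B0; rewrite mulr1; lra.
have qB : `|q| <= B by apply: nq; rewrite normrN ger0_norm ?(ltW p0).
have qeB : `|q + e j| <= B by rewrite qe; apply: nq; rewrite ger0_norm ?(ltW p0).
have base : lift_arg (q + e j) - lift_arg q = 0.
  apply/eqP; rewrite subr_eq0; apply/eqP; rewrite qe; apply: eq_bigr => t _.
  rewrite /node /q !scalerA !mulrN -!Feven //.
(* Enough subdivisions for consecutive points of the path to be [close]. *)
pose n := (Num.truncn (Lam * `|q - psi| / (d / 2))).+1.
have n0 : 0 < n%:R :> R by rewrite ltr0n.
pose path (t : nat) := psi + (t%:R / n%:R) *: (q - psi).
have pathB t : (t <= n)%N -> `|path t| <= B /\ `|path t + e j| <= B.
  move=> tn; pose s : R := t%:R / n%:R.
  have s0 : 0 <= s by rewrite divr_ge0 ?ler0n.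
  have s1 : s <= 1 by rewrite ler_pdivrMr// mul1r ler_nat.
  have conv (a b : 'rV[R]_m) : `|a| <= B -> `|b| <= B -> `|(1 - s) *: a + s *: b| <= B.
    clearbody s; move=> aB bB; apply: le_trans (ler_normD _ _) _; rewrite !normrZ !ger0_norm ?subr_ge0//.
    have : (1 - s) * `|a| <= (1 - s) * B by rewrite ler_wpM2l// subr_ge0.
    have : s * `|b| <= s * B by rewrite ler_wpM2l.
    lra.
  have E : path t = (1 - s) *: psi + s *: q.
    by rewrite /path -/s scalerBr scalerBl scale1r addrA addrAC.
  have E' : path t + e j = (1 - s) *: (psi + e j) + s *: (q + e j).
    by rewrite E !scalerDr [RHS]addrACA -scalerDl subrK scale1r.
  by split; [rewrite E|rewrite E']; exact: conv.
have clo (a b : 'rV[R]_m) : a - b = n%:R^-1 *: (q - psi) -> close a b.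
  move=> ab; rewrite /close ab normrZ ger0_norm ?invr_ge0 ?ler0n//.
  rewrite mulrCA mulrC ler_pdivrMr//.
  have := truncnS_gt (Lam * `|q - psi| / (d / 2)).
  rewrite -/n ltr_pdivrMr ?divr_gt0// => /ltW h.
  by rewrite [leRHS]mulrC.
have stp t : path t.+1 - path t = n%:R^-1 *: (q - psi).
  rewrite /path opprD addrACA subrr add0r -scalerBl -mulrBl -natr1.
  by rewrite addrAC subrr add0r mul1r.
have comb (a b a' b' z : R) : a - b = z -> a' - b' = z -> a' - a = b' - b.
  by move=> h h'; lra.
have inv t : (t <= n)%N -> lift_arg (path t + e j) - lift_arg (path t) =
    lift_arg (psi + e j) - lift_arg psi.
  elim: t => [|t IH] tn; first by rewrite /path mul0r scale0r addr0.
  rewrite -(IH (ltnW tn)).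
  have [b1 b2] := pathB t (ltnW tn); have [b3 b4] := pathB t.+1 tn.
  have g1 := lift_arg_close b1 b3 (clo _ _ (stp t)).
  have stp' : path t.+1 + e j - (path t + e j) = n%:R^-1 *: (q - psi).
    by rewrite opprD addrACA subrr addr0 stp.
  have g2 := lift_arg_close b2 b4 (clo _ _ stp').
  (* By periodicity of F both lifts gain the same angle at each step, so their difference is
     constant along the path. *)
  rewrite !F_shift in g2; exact: comb g1 g2.
have pn : path n = q by rewrite /path divff ?gt_eqF// scale1r addrC subrK.
by rewrite -(inv n (leqnn n)) pn.
Qed.

(** Coordinates are exchanged one at a time; every intermediate mixture of psi and psi' stays in the
    ball, so [lift_arg_shift] applies at each exchange. *)
Lemma lift_arg_periodic psi psi' : (forall j, `|psi 0 j| <= B) -> (forall j, `|psi' 0 j| <= B) ->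
  (forall j, [\/ psi' 0 j = psi 0 j, psi' 0 j = psi 0 j + 2 * pi
     | psi 0 j = psi' 0 j + 2 * pi]) ->
  lift_arg psi' = lift_arg psi.
Proof.
move=> h1 h2 h; have p0 := pi_gt0 R; have B00 : 0 <= B by have := B0; lra.
pose mix (s : seq 'I_m) : 'rV[R]_m := \row_j if j \in s then psi' 0 j else psi 0 j.
have mixB s : `|mix s| <= B.
  by apply: norm_le_of_coord => // j; rewrite mxE; case: ifP => _.
have mixE s : uniq s -> lift_arg (mix s) = lift_arg (mix [::]).
  elim: s => [//|j s IH] /= /andP[js us]; rewrite -IH//.
  have [E|E|E] := h j.
  - congr lift_arg; apply/rowP => k; rewrite !mxE inE; case: eqP => [->|//] /=.
    by rewrite (negPf js).
  - have -> : mix (j :: s) = mix s + e j.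
      apply/rowP => k; rewrite !mxE inE eqxx /=; case: eqP => [->|_] /=.
        by rewrite (negPf js) mulr1.
      by rewrite mulr0 addr0.
    have Es : mix s + e j = mix (j :: s).
      apply/rowP => k; rewrite !mxE inE eqxx /=; case: eqP => [->|_] /=.
        by rewrite (negPf js) mulr1.
      by rewrite mulr0 addr0.
    by apply: lift_arg_shift; rewrite ?Es.
  - have Es : mix s = mix (j :: s) + e j.
      apply/rowP => k; rewrite !mxE inE eqxx /=; case: eqP => [->|_] /=.
        by rewrite (negPf js) mulr1.
      by rewrite mulr0 addr0.
    by rewrite Es lift_arg_shift// -Es.
have := mixE (enum 'I_m) (enum_uniq _).
have -> : mix (enum 'I_m) = psi' by apply/rowP => j; rewrite mxE mem_enum.
have -> //: mix [::] = psi by apply/rowP => j; rewrite mxE.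
Qed.

(** Every point of the progression is reduced to [0, 2 pi)^m, where the lift is bounded by K pi / 2.
    Each angle is a difference of lifts at reduced points, so the sum telescopes to two such values
    whatever n is. *)
Lemma bounded_angle_sum psi lam (n : nat) : `|lam| < 1 -> Lam * `|lam| <= d / 2 ->
  `|\sum_(k < n) angle (F (psi + k.+1%:R *: lam)) (F (psi + k%:R *: lam))|
    <= K%:R * pi.
Proof.
move=> lam1 lamd; have p0 := pi_gt0 R; have hB := B0.
have /choice[rho Hrho] : forall k : nat, exists r : 'rV[R]_m,
    forall j, 0 <= r 0 j < 2 * pi /\ exists z : int, (psi + k%:R *: lam) 0 j = r 0 j + 2 * pi *~ z.
  move=> k.
  have /choice[r Hr] : forall j, exists s : R, 0 <= s < 2 * pi /\
      exists z : int, (psi + k%:R *: lam) 0 j = s + 2 * pi *~ z.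
    by move=> j; have [s s1 s2] := exists_angle ((psi + k%:R *: lam) 0 j); exists s.
  by exists (\row_j r j) => j; rewrite !mxE; have := Hr j; rewrite !mxE.
have rhoB k : `|rho k| <= B.
  apply: norm_le_of_coord => [|j]; first lra.
  by have [/andP[r1 r2] _] := Hrho k j; rewrite ger0_norm//; lra.
have Frho k : F (psi + k%:R *: lam) = F (rho k).
  apply: Fper => j; have [_ [z ->]] := Hrho k j; exact: cis_shift2pi.
have lamj j : `|lam 0 j| < 1 := le_lt_trans (coord_le _ _) lam1.
have rlB k j : `|(rho k + lam) 0 j| <= B.
  rewrite mxE; have [/andP[r1 r2] _] := Hrho k j.
  have := lamj j; have := pi_ge2 R; rewrite ltr_norml ler_norml => ? /andP[? ?]; apply/andP; split; lra.
have termE k : angle (F (psi + k.+1%:R *: lam)) (F (psi + k%:R *: lam)) =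
    lift_arg (rho k.+1) - lift_arg (rho k).
  have nrl : `|rho k + lam| <= B by apply: norm_le_of_coord => [|j]; [lra|exact: rlB].
  have Erl : F (psi + k.+1%:R *: lam) = F (rho k + lam).
    apply: Fper => j; have [_ [z Hz]] := Hrho k j.
    rewrite -natr1 scalerDl scale1r addrA mxE Hz [RHS](_ : _ = cis (rho k 0 j + lam 0 j)).
      by rewrite addrAC cis_shift2pi.
    by rewrite mxE.
  rewrite Erl Frho -lift_arg_close//; last first.
    by rewrite /close addrAC subrr add0r.
  congr (_ - _); symmetry; apply: lift_arg_periodic => [j|j|j].
  - exact: rlB.
  - exact: le_trans (coord_le _ _) (rhoB _).
  have [/andP[r1 r2] [z Hz]] := Hrho k j; have [/andP[r3 r4] [z' Hz']] := Hrho k.+1 j.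
  move: Hz'; rewrite -natr1 scalerDl scale1r addrA mxE Hz => Hz'.
  have E : rho k.+1 0 j = (rho k + lam) 0 j + 2 * pi *~ (z - z').
    by rewrite mxE mulrzBr; lra.
  (* Two reduced coordinates and a step shorter than 1 differ by less than 4 pi, so the integer is
     -1, 0 or 1. *)
  have zz : `|2 * pi *~ (z - z') : R| < 2 * pi * 2%:R.
    have [l1 l2] : -1 < lam 0 j /\ lam 0 j < 1.
      by have := lamj j; rewrite ltr_norml => /andP.
    have E' : 2 * pi *~ (z - z') = rho k.+1 0 j - rho k 0 j - lam 0 j.
      by rewrite E mxE; ring.
    by have pi2 := pi_ge2 R; rewrite E' ltr_norml; apply/andP; split; lra.
  have {zz} : `|z - z'| < 2.
    move: zz; rewrite -mulrzr normrM (ger0_norm (_ : 0 <= 2 * pi)) ?mulr_ge0 ?(ltW p0)//.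
    by rewrite ltr_pM2l ?mulr_gt0// -intr_norm (_ : 2%:R = (2%:Z)%:~R)// ltr_int.
  move: (z - z') E => [[|[|l]]|[|l]] E lt2; try by [].
  - by constructor 1; rewrite E mulr0z addr0.
  - by constructor 2; rewrite E mulr1z.
  - by constructor 3; rewrite E NegzE mulrN1z subrK.
rewrite -(big_mkord xpredT (fun k => angle (F (psi + k.+1%:R *: lam)) (F (psi + k%:R *: lam)))).
rewrite (telescope_sumr_eq (fun k => lift_arg (rho k)))//.
apply: le_trans (ler_normB _ _) _.
have := norm_lift_arg (rho n); have := norm_lift_arg (rho 0); lra.
Qed.

End Winding.

(** * First-order expansion of the angle *)

Section AngleExpansion.
Variable R : realType.
Implicit Types z : R[i].

Lemma angle_quotient z (s : R[i]) : z != 0 ->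
  angle ((1 + s) * z) z = atan (complex.Im s / (1 + complex.Re s)).
Proof.
move=> z0; rewrite /angle.
have m0 : 0 < modulus z ^+ 2 by rewrite exprn_gt0// modulus_gt0.
have -> : complex.Im ((1 + s) * z) * complex.Re z - complex.Re ((1 + s) * z) * complex.Im z =
   complex.Im s * modulus z ^+ 2.
  by rewrite sqr_modulus complexReM complexImM complexReD complexImD /=; ring.
have -> : complex.Re ((1 + s) * z) * complex.Re z + complex.Im ((1 + s) * z) * complex.Im z =
   (1 + complex.Re s) * modulus z ^+ 2.
  by rewrite sqr_modulus complexReM complexImM complexReD complexImD /=; ring.
by rewrite -mulf_div divff ?gt_eqF// mulr1.
Qed.

Lemma angle_near1 z (s : R[i]) : z != 0 -> modulus s <= 1 / 8 ->
  `|angle ((1 + s) * z) z - complex.Im s| <= 6 * modulus s ^+ 2.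
Proof.
move=> z0 s8; rewrite angle_quotient//.
have := normRe_le_modulus s; have := normIm_le_modulus s; have := modulus_ge0 s.
move: (complex.Re s) (complex.Im s) (modulus s) s8 => a b M M8 M0 bM aM.
have [a1 a2] : - M <= a /\ a <= M by move: aM; rewrite ler_norml => /andP.
have a0 : 0 < 1 + a by lra.
set t := b / (1 + a).
have tE : t * (1 + a) = b by rewrite /t divfK// gt_eqF.
have tM : `|t| <= 2 * M.
  rewrite normrM normfV (gtr0_norm a0) ler_pdivrMr//; nra.
have t1 : `|t| <= 1 by lra.
have h1 := atan_near0 t1.
have h2 : t ^+ 2 <= 4 * M ^+ 2.
  rewrite -[t ^+ 2]real_normK ?num_real//.
  have -> : 4 * M ^+ 2 = (2 * M) ^+ 2 by ring.
  by rewrite lerXn2r ?nnegrE// mulr_ge0.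
have h3 : `|t - b| <= 2 * M ^+ 2.
  have -> : t - b = - (t * a) by rewrite -tE; ring.
  rewrite normrN normrM.
  have -> : 2 * M ^+ 2 = 2 * M * M by ring.
  by apply: ler_pM.
rewrite -(subrK t (atan t)) -addrA; apply: le_trans (ler_normD _ _) _; lra.
Qed.

End AngleExpansion.

(** * The gradient of the Ronkin function as a mean turning *)

Section FirstOrder.
Variables (R : realType) (p N : nat) (A : 'M[R]_(p, N)) (c : 'I_N -> R[i]).
Variables (eta : probability (dual A) R) (eta_haar : is_haar eta).
Variable alpha : 'cV[R]_p.
Implicit Types (x v : 'rV[R]_p) (chi : character A).

(* The variation of the argument of [f_chi(x + i t v) e^(- i t <v, alpha>)]
   between t = 0 and t = 1. *)
Definition turn x v (chi : dual A) : R :=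
  angle (cis (- dot v alpha) * tsum A c (char_vals (char_mul (phase_char A v) (chi : character A))) x)
        (tsum A c (char_vals (chi : character A)) x).

Lemma tsum_shifted_line u x v (s1 s2 : R) :
  cexp (- (dot v alpha)%:C%C * Complex s1 s2) *
    tsum A c (fun j => u j * phases A (s2 *: v) j) (x + s1 *: v) =
  line_sum (tcoef A c u x) (fun j => dot v (col j A) - dot v alpha) (Complex s1 s2).
Proof.
rewrite tsum_complex_line /line_sum mulr_sumr; apply: eq_bigr => j _.
by rewrite rmorphB mulrBl cexpD -!mulNr; ring.
Qed.

Lemma measurable_turn x v : (forall chi, acute (cis (- dot v alpha) *
     tsum A c (char_vals (char_mul (phase_char A v) chi)) x) (tsum A c (char_vals chi) x)) ->
  bounded_measurable (turn x v).
Proof.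
move=> ac; split; last by exists (pi / 2) => chi; exact: ltW (norm_angle_lt _ _).
pose z1 (chi : dual A) : R[i] := \sum_j
  (cis (- dot v alpha) * (c j * phases A v j * (expR (dot x (col j A)))%:C%C)) *
    char_fun chi (zspan_gen A j) + 0.
pose z0 (chi : dual A) : R[i] := \sum_j
  (c j * (expR (dot x (col j A)))%:C%C) * char_fun chi (zspan_gen A j) + 0.
have z1E (chi : dual A) : cis (- dot v alpha) *
     tsum A c (char_vals (char_mul (phase_char A v) (chi : character A))) x = z1 chi.
  rewrite /z1 addr0 mulr_sumr; apply: eq_bigr => j _.
  by rewrite char_vals_mul char_vals_phase /char_vals; ring.
have z0E (chi : dual A) : tsum A c (char_vals (chi : character A)) x = z0 chi.
  by rewrite /z0 addr0; apply: eq_bigr => j _; rewrite /char_vals; ring.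
have mR1 : measurable_fun setT (fun chi : dual A => complex.Re (z1 chi)) by exact: measurable_Re_csum.
have mI1 : measurable_fun setT (fun chi : dual A => complex.Im (z1 chi)) by exact: measurable_Im_csum.
have mR0 : measurable_fun setT (fun chi : dual A => complex.Re (z0 chi)) by exact: measurable_Re_csum.
have mI0 : measurable_fun setT (fun chi : dual A => complex.Im (z0 chi)) by exact: measurable_Im_csum.
(* The division is rewritten as multiplication by exp (- ln .), legitimate since acuteness makes the
   denominator positive; every piece is then visibly measurable. *)
rewrite (_ : turn x v = @atan R \o (fun chi : dual A =>
   (complex.Im (z1 chi) * complex.Re (z0 chi) - complex.Re (z1 chi) * complex.Im (z0 chi)) *
   expR (- ln (complex.Re (z1 chi) * complex.Re (z0 chi) + complex.Im (z1 chi) * complex.Im (z0 chi))))); last first.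
  apply/funext => chi; rewrite /turn /angle z1E z0E /=; congr (atan (_ * _)).
  have := ac chi; rewrite /acute z1E z0E => P0.
  by rewrite -lnV ?posrE// lnK// posrE invr_gt0.
apply: measurableT_comp.
  by apply: continuous_measurable_fun => t; exact: continuous_atan.
apply: measurable_funM.
  by apply: measurable_funB; apply: measurable_funM.
apply: measurableT_comp; first exact: measurable_expR.
apply: measurable_funN; apply: measurableT_comp; first exact: measurable_ln.
by apply: measurable_funD; apply: measurable_funM.
Qed.

Lemma haar_mean_first_order (g1 g2 q : dual A -> R) (k : R) :
  bounded_measurable g1 -> bounded_measurable g2 -> bounded_measurable q ->
  let g chi := g1 chi + (-1) * g2 chi + (- k) + (-1) * q chi in
  bounded_measurable g /\
  haar_mean eta g1 - haar_mean eta g2 - k - haar_mean eta q = haar_mean eta g.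
Proof.
move=> b1 b2 bq g; rewrite /g {g}.
have b2' := bounded_measurableZ (-1) b2; have bq' := bounded_measurableZ (-1) bq.
have b12 := bounded_measurableD b1 b2'.
have bk := bounded_measurable_cst A (- k); have b12k := bounded_measurableD b12 bk.
split; first exact: bounded_measurableD b12k bq'.
transitivity (haar_mean eta g1 + (-1) * haar_mean eta g2 + (- k) + (-1) * haar_mean eta q).
  by move: (haar_mean _ _) (haar_mean _ _) (haar_mean _ _) => X Y Z; ring.
apply: esym; apply: etrans (haar_meanD eta b12k bq') _.
congr (_ + _); last exact: haar_meanZ.
apply: etrans (haar_meanD eta b12 bk) _; rewrite haar_mean_cst; congr (_ + _).
apply: etrans (haar_meanD eta b1 b2') _; congr (_ + _); exact: haar_meanZ.
Qed.

(** This is the Cauchy-Riemann equation: with normalised first Taylor coefficient m1, the step 1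
    changes log |G| by Re m1 and the step i changes arg G by Im (i m1), which is the same number.
    Twisting by [alpha] shifts all frequencies by - <v, alpha>. *)
Lemma ronkin_first_order x d : 0 < d -> lower_bounded A c x d ->
  exists r K : R, [/\ 0 < r & forall v, `|v| < r -> bounded_measurable (turn x v) /\
    `|ronkin c eta (x + v) - ronkin c eta x - dot v alpha - haar_mean eta (turn x v)|
       <= K * `|v| ^+ 2].
Proof.
move=> d0 dx; have [r1 r10 Hr1] := lower_bounded_near d0 dx.
have [C2 C20 HC2] := @line_sum_rem R 'I_N 2.
pose kap := colbound A + \sum_i `|alpha i 0|.
have kap0 : 0 < kap by rewrite ltr_pwDl ?colbound_gt0// sumr_ge0.
pose T := \sum_j modulus (c j) * expR (dot x (col j A)).
have T0 : 0 <= T by rewrite sumr_ge0// => j _; rewrite mulr_ge0 ?modulus_ge0 ?expR_ge0.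
pose M := 1 + (1 + C2) * T / d.
have M1 : 1 <= M by rewrite /M lerDl divr_ge0 ?(ltW d0)// mulr_ge0// addr_ge0.
pose r := Num.min r1 (16 * M * kap)^-1.
have r0 : 0 < r by rewrite lt_min r10 invr_gt0 !mulr_gt0//; lra.
(* 104 = 6 * 4 + 20 * 4: the constants of [angle_near1] and [ln_modulus_near1] times the 4 in the
   square of the bound 2 L M; the term 2 M pays for the two remainders. *)
exists r, ((104 * M ^+ 2 + 2 * M) * kap ^+ 2); split=> // v vr.
have [vr1 vk] : `|v| < r1 /\ `|v| * kap * (16 * M) < 1.
  move: vr; rewrite lt_min => /andP[-> h]; split=> //.
  by rewrite -ltr_pdivlMr ?mulr_gt0// ?(lt_le_trans ltr01)// mul1r;
    move: h; rewrite -ltr_pdivlMr// invfM.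
pose L := `|v| * kap.
have L0 : 0 <= L by rewrite mulr_ge0// ltW.
have LM : L * M <= 1 / 16 by rewrite -/L in vk; move: (L) vk => l; lra.
have LM2 : 2 * (L * M) <= 1 / 8 by lra.
have L1 : L <= 1.
  have : L <= L * M by rewrite ler_peMr.
  lra.
have lbv : lower_bounded A c (x + v) (d / 2) by apply: Hr1; rewrite addrAC subrr add0r.
have dd0 : 0 < d / 2 by rewrite divr_gt0.
pose l j := dot v (col j A) - dot v alpha.
have lL j : `|l j| <= L.
  apply: le_trans (ler_normB _ _) _; rewrite /L /kap mulrDr lerD//.
    exact: norm_dot_col.
  exact: norm_dot_le.
have key (chi : character A) (u := char_vals chi) (G := line_sum (tcoef A c u x) l) :
   [/\ G 0 = tsum A c u x, G 0 != 0, d <= modulus (G 0) &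
    exists m1 : R[i], modulus m1 <= M * L /\ forall s, modulus s = 1 ->
      exists rho : R[i], modulus rho <= M * L ^+ 2 /\ G s = (1 + (s * m1 + rho)) * G 0].
  have G0E : G 0 = tsum A c u x by apply: eq_bigr => j _; rewrite mulr0 cexp0 mulr1.
  have G0d : d <= modulus (G 0) by rewrite G0E; exact: dx.
  have G0n : G 0 != 0 by rewrite -modulus_gt0; exact: lt_le_trans G0d.
  split=> //.
  pose t := tcoef A c u x.
  have sumt : \sum_j modulus (t j) = T by exact: (sum_modulus_tcoef A c x (modulus_char_vals chi)).
  have quot (z : R[i]) (B : R) : 0 <= B -> modulus z <= B -> modulus (z / G 0) <= B / d.
    move=> B0 zB; rewrite modulusM modulusV ler_pM ?modulus_ge0 ?invr_ge0 ?modulus_ge0//.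
    by rewrite lef_pV2 ?posrE// (lt_le_trans d0 G0d).
  have TM : T / d <= M.
    rewrite /M [(1 + C2) * T]mulrDl mul1r mulrDl.
    by rewrite addrCA lerDl addr_ge0// divr_ge0 ?(ltW d0)// mulr_ge0.
  have CTM : C2 * T / d <= M.
    rewrite /M [(1 + C2) * T]mulrDl mul1r mulrDl addrA lerDr addr_ge0//.
    by rewrite divr_ge0 ?(ltW d0).
  exists (moment t l 1 / G 0); split.
    apply: le_trans (quot _ (T * L) _ _) _; first exact: mulr_ge0.
      apply: le_trans (modulus_sum _ _ _) _; rewrite -sumt mulr_suml.
      apply: ler_sum => j _; rewrite modulusM modulus_real expr1 ler_wpM2l ?modulus_ge0//.
    by rewrite mulrAC ler_wpM2r.
  move=> s s1; exists (G s / G 0 - (1 + s * (moment t l 1 / G 0))); split; last by field.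
  have ls j : modulus ((l j)%:C%C * s) <= L by rewrite modulusM s1 mulr1 modulus_real.
  have := HC2 t l s L ls L1; rewrite sumt; set W := (X in modulus X <= _) => hW.
  have -> : G s / G 0 - (1 + s * (moment t l 1 / G 0)) = W / G 0.
    have mom0 : moment t l 0 = G 0.
      by apply: eq_bigr => j _; rewrite expr0 mulr0 cexp0.
    rewrite /W !big_ord_recr big_ord0 /= mom0 -/G.
    by rewrite expr0 fact0 divr1 expr1 (_ : 1`! = 1%N)// divr1; field.
  apply: le_trans (quot _ (C2 * T * L ^+ 2) _ hW) _.
    by apply: mulr_ge0; [exact: mulr_ge0|exact: exprn_ge0].
  by rewrite mulrAC ler_wpM2r ?exprn_ge0//.
pose i : R[i] := Complex 0 1.
have i1 : modulus i = 1 by rewrite /modulus /= expr0n expr1n add0r sqrtr1.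
have Gi (chi : character A) (u := char_vals chi) :
   cis (- dot v alpha) * tsum A c (char_vals (char_mul (phase_char A v) chi)) x =
     line_sum (tcoef A c u x) l i.
  rewrite -tsum_shifted_line scale0r addr0 scale1r; congr (_ * _).
    by rewrite /cis; congr cexp; apply: complex_ext => /=; ring.
  by apply: eq_bigr => j _; rewrite char_vals_mul char_vals_phase (mulrC (phases _ _ _)).
have G1 (chi : character A) (u := char_vals chi) :
   (expR (- dot v alpha))%:C%C * tsum A c u (x + v) = line_sum (tcoef A c u x) l 1.
  have -> : 1 = Complex 1 0 :> R[i] by [].
  rewrite -tsum_shifted_line scale1r; congr (_ * _).
    by rewrite -cexp_real; congr cexp; apply: complex_ext => /=; ring.
  by apply: eq_bigr => j _; rewrite scale0r /phases dot0l cis0 mulr1.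
have L20 : 0 <= L ^+ 2 by rewrite exprn_ge0.
have LL : L ^+ 2 <= L by rewrite expr2 ler_piMr.
have small (m1 rho : R[i]) s : modulus m1 <= M * L -> modulus rho <= M * L ^+ 2 -> modulus s = 1 ->
    modulus (s * m1 + rho) <= 2 * (L * M).
  move=> h1 h2 hs; apply: le_trans (modulusD _ _) _; rewrite modulusM hs mul1r.
  have : M * L ^+ 2 <= M * L by rewrite ler_wpM2l//; lra.
  move: h1 h2; move: (modulus m1) (modulus rho) (L ^+ 2) => X Y Z; lra.
have ac chi : acute (cis (- dot v alpha) * tsum A c (char_vals (char_mul (phase_char A v) chi)) x)
    (tsum A c (char_vals chi) x).
  have [G0E G0n G0d [m1 [hm1 Hs]]] := key chi; have [rho [hrho GiE]] := Hs i i1.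
  rewrite Gi GiE -G0E; apply: acute_near (lt_le_trans d0 G0d) (lexx _) _.
  rewrite [X in modulus X](_ : _ = (i * m1 + rho) * line_sum (tcoef A c (char_vals chi) x) l 0);
    last ring.
  rewrite modulusM mulrC ler_wpM2l ?modulus_ge0//.
  by apply: le_trans (small _ _ _ hm1 hrho i1) _; lra.
have bq := measurable_turn ac; split=> //.
have [bg Eg] := haar_mean_first_order (dot v alpha)
  (bounded_measurable_logmod dd0 lbv) (bounded_measurable_logmod d0 dx) bq.
rewrite (ronkinE eta dd0 lbv) (ronkinE eta d0 dx) Eg; apply: norm_haar_mean_le => // chi.
have [G0E G0n G0d [m1 [hm1 Hs]]] := key (chi : character A).
have [rho [hrho GiE]] := Hs i i1; have [rho' [hrho' G1E]] := Hs 1 (modulus1 R).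
have tE : turn x v chi = angle ((1 + (i * m1 + rho)) * line_sum (tcoef A c (char_vals (chi : character A)) x) l 0)
   (line_sum (tcoef A c (char_vals (chi : character A)) x) l 0).
  by rewrite /turn Gi GiE G0E.
have s1 := small _ _ _ hm1 hrho i1; have s2 := small _ _ _ hm1 hrho' (modulus1 R).
have s18 : modulus (i * m1 + rho) <= 1 / 8 := le_trans s1 LM2.
have s28 : modulus (1 * m1 + rho') <= 1 / 8 := le_trans s2 LM2.
have h1 := angle_near1 G0n s18; rewrite -tE in h1.
have h2 := ln_modulus_near1 s28.
have lnE : logmod c (x + v) chi - logmod c x chi - dot v alpha = ln (modulus (1 + (1 * m1 + rho'))).
  have e0 : 1 + (1 * m1 + rho') = line_sum (tcoef A c (char_vals (chi : character A)) x) l 1 /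
      line_sum (tcoef A c (char_vals (chi : character A)) x) l 0 by rewrite G1E mulfK.
  rewrite e0 -G1 G0E !modulusM modulusV modulus_real gtr0_norm ?expR_gt0//.
  have p1 := lt_le_trans dd0 (lbv chi); have p2 := lt_le_trans d0 (dx chi).
  rewrite lnM ?posrE ?mulr_gt0 ?invr_gt0 ?expR_gt0// lnM ?posrE ?expR_gt0//.
  by rewrite lnV ?posrE// expRK /logmod; ring.
have g : logmod c (x + v) chi + -1 * logmod c x chi + - dot v alpha + -1 * turn x v chi =
   ln (modulus (1 + (1 * m1 + rho'))) - turn x v chi by rewrite -lnE; ring.
rewrite g.
have Re1 : complex.Re (1 * m1 + rho') = complex.Re m1 + complex.Re rho' by rewrite mul1r complexReD.
have Im1 : complex.Im (i * m1 + rho) = complex.Re m1 + complex.Im rho.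
  by rewrite complexImD complexImM /= mul0r mul1r add0r.
rewrite Re1 in h2; rewrite Im1 in h1.
have q1 : modulus (i * m1 + rho) ^+ 2 <= 4 * M ^+ 2 * L ^+ 2.
  have -> : 4 * M ^+ 2 * L ^+ 2 = (2 * (L * M)) ^+ 2 by ring.
  by rewrite lerXn2r ?nnegrE ?modulus_ge0// (le_trans _ s1) ?modulus_ge0.
have q2 : modulus (1 * m1 + rho') ^+ 2 <= 4 * M ^+ 2 * L ^+ 2.
  have -> : 4 * M ^+ 2 * L ^+ 2 = (2 * (L * M)) ^+ 2 by ring.
  by rewrite lerXn2r ?nnegrE ?modulus_ge0// (le_trans _ s2) ?modulus_ge0.
have q3 := le_trans (normIm_le_modulus rho) hrho.
have q4 := le_trans (normRe_le_modulus rho') hrho'.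
have -> : (104 * M ^+ 2 + 2 * M) * kap ^+ 2 * `|v| ^+ 2 = 104 * M ^+ 2 * L ^+ 2 + 2 * (M * L ^+ 2).
  by rewrite /L exprMn; ring.
have fin (a b b' w w' f f' W Z : R) : `|b - (a + f)| <= 6 * w -> `|b' - (a + f')| <= 20 * w' ->
  w <= 4 * M ^+ 2 * W -> w' <= 4 * M ^+ 2 * W -> `|f| <= Z -> `|f'| <= Z ->
  `|b' - b| <= 104 * M ^+ 2 * W + 2 * Z.
  clear; move: (M ^+ 2) => M2; rewrite !ler_norml => /andP[? ?] /andP[? ?] ? ? /andP[? ?] /andP[? ?].
  by apply/andP; split; lra.
exact: fin h1 h2 q1 q2 q3 q4.
Qed.

Lemma haar_mean_sum (g : nat -> dual A -> R) n : (forall k, bounded_measurable (g k)) ->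
  bounded_measurable (fun chi => \sum_(k < n) g k chi) /\
  haar_mean eta (fun chi => \sum_(k < n) g k chi) = \sum_(k < n) haar_mean eta (g k).
Proof.
move=> bg; elim: n => [|n [IH1 IH2]].
  rewrite (_ : (fun _ => _) = fun=> 0); last by apply/funext => chi; rewrite big_ord0.
  by rewrite big_ord0 haar_mean_cst; split=> //; exact: bounded_measurable_cst.
rewrite (_ : (fun _ => _) = fun chi => (\sum_(k < n) g k chi) + g n chi); last first.
  by apply/funext => chi; rewrite big_ord_recr.
split; first exact: bounded_measurableD IH1 (bg n).
by rewrite big_ord_recr /= -IH2; exact: haar_meanD.
Qed.

Lemma haar_mean_turn_eq0 x v (C : R) : bounded_measurable (turn x v) ->
  (forall (chi : character A) n,
    `|\sum_(k < n) turn x v (char_mul (phase_char A (k%:R *: v)) chi)| <= C) ->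
  haar_mean eta (turn x v) = 0.
Proof.
move=> bt H.
pose g (k : nat) (chi : dual A) := turn x v (char_mul (phase_char A (k%:R *: v)) chi).
have bg k : bounded_measurable (g k) := bounded_measurable_shift _ bt.
have gE k : haar_mean eta (g k) = haar_mean eta (turn x v) := haar_mean_shift _ eta_haar bt.
have bound n : n%:R * `|haar_mean eta (turn x v)| <= C.
  have [bs Es] := haar_mean_sum n bg.
  have := norm_haar_mean_le eta bs (fun chi => H chi n).
  have E : \sum_(k < n) haar_mean eta (g k) = n%:R * haar_mean eta (turn x v).
    rewrite (eq_bigr (fun=> haar_mean eta (turn x v))) => [|k _]; last exact: gE.
    by rewrite sumr_const card_ord mulr_natl.
  by rewrite [X in `|X| <= _ -> _]Es E normrM normr_nat.
apply/eqP; rewrite -normr_le0 leNgt; apply/negP => h0.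
have := bound (Num.truncn (C / `|haar_mean eta (turn x v)|)).+1.
rewrite leNgt => /negP; apply; rewrite -ltr_pdivrMr//; exact: truncnS_gt.
Qed.

End FirstOrder.

(** * Polar form *)

Section Argument.
Variable R : realType.
Implicit Types z : R[i].

Lemma modulus_cis_arg z : z = (modulus z)%:C%C * cis (arg z).
Proof.
have [->|z0] := eqVneq z 0; first by rewrite modulus0 rmorph0 mul0r.
have m0 : 0 < modulus z by rewrite modulus_gt0.
set t := complex.Re z / modulus z.
have t1 : -1 <= t <= 1.
  by rewrite -ler_norml normrM normfV (gtr0_norm m0) ler_pdivrMr// mul1r normRe_le_modulus.
have st : Num.sqrt (1 - t ^+ 2) = `|complex.Im z| / modulus z.
  have -> : 1 - t ^+ 2 = (`|complex.Im z| / modulus z) ^+ 2.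
    rewrite /t !exprMn !exprVn real_normK ?num_real//.
    have -> : complex.Im z ^+ 2 = modulus z ^+ 2 - complex.Re z ^+ 2 by rewrite sqr_modulus; ring.
    by field; rewrite gt_eqF.
  by rewrite sqrtr_sqr ger0_norm// divr_ge0// ltW.
have ct : cos (acos t) = t by rewrite acosK// in_itv.
have sat : sin (acos t) = `|complex.Im z| / modulus z by rewrite sin_acos.
rewrite cisE /arg -/t; case: ifPn => Iz.
  rewrite ct sat ger0_norm//; apply: complex_ext; rewrite /t /=; field; by rewrite gt_eqF.
rewrite cosN sinN ct sat ltr0_norm ?ltNge//.
by apply: complex_ext; rewrite /t /=; field; rewrite gt_eqF.
Qed.

Lemma exists_cis z : modulus z = 1 -> exists t, cis t = z.
Proof. by move=> z1; exists (arg z); rewrite [RHS]modulus_cis_arg z1 mul1r. Qed.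

Lemma angle_scale (s z' z : R[i]) : s != 0 -> angle (s * z') (s * z) = angle z' z.
Proof.
move=> s0; rewrite /angle.
have m0 : 0 < modulus s ^+ 2 by rewrite exprn_gt0// modulus_gt0.
have -> : complex.Im (s * z') * complex.Re (s * z) - complex.Re (s * z') * complex.Im (s * z) =
   (complex.Im z' * complex.Re z - complex.Re z' * complex.Im z) * modulus s ^+ 2.
  by rewrite sqr_modulus !complexReM !complexImM; ring.
have -> : complex.Re (s * z') * complex.Re (s * z) + complex.Im (s * z') * complex.Im (s * z) =
   (complex.Re z' * complex.Re z + complex.Im z' * complex.Im z) * modulus s ^+ 2.
  by rewrite sqr_modulus !complexReM !complexImM; ring.
by rewrite -mulf_div divff ?gt_eqF// mulr1.
Qed.

End Argument.

(** * The sum of unimodular numbers with prescribed product *)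

Section Torus.
Variables (R : realType) (m : nat) (zeta w : R[i]).
Hypothesis zeta1 : modulus zeta = 1.
Implicit Types psi : 'rV[R]_m.

(* The torus of unimodular [u_0, ..., u_m] with prescribed product [zeta ^ (m+1)] is
   parametrized by [u_j = zeta e^(i psi_j)], the last coordinate being determined. *)
Definition torus_sum psi : R[i] :=
  zeta * (\sum_j cis (psi 0 j) + cis (- \sum_j psi 0 j)) - w.

Lemma torus_sum_lipschitz psi psi' :
  modulus (torus_sum psi - torus_sum psi') <= (4 * m%:R + 1) * `|psi - psi'|.
Proof.
have pj j : `|psi 0 j - psi' 0 j| <= `|psi - psi'|.
  have -> : psi 0 j - psi' 0 j = (psi - psi') 0 j by rewrite !mxE.
  rewrite {2}/Num.norm /= mx_normrE.
  exact: (le_bigmax_cond _ (fun i => `|(psi - psi') i.1 i.2|) (j := (0, j))).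
have -> : torus_sum psi - torus_sum psi' =
   zeta * ((\sum_j (cis (psi 0 j) - cis (psi' 0 j))) +
      (cis (- \sum_j psi 0 j) - cis (- \sum_j psi' 0 j))).
  by rewrite /torus_sum sumrB; ring.
rewrite modulusM zeta1 mul1r; apply: le_trans (modulusD _ _) _.
have h1 : modulus (\sum_j (cis (psi 0 j) - cis (psi' 0 j))) <= 2 * m%:R * `|psi - psi'|.
  apply: le_trans (modulus_sum _ _ _) _.
  apply: (@le_trans _ _ (\sum_(j < m) (2 * `|psi - psi'|))).
    by apply: ler_sum => j _; apply: le_trans (cis_lipschitz _ _) _; rewrite ler_wpM2l.
  by rewrite sumr_const card_ord -[leLHS]mulr_natl mulrCA mulrA.
have h2 : modulus (cis (- \sum_j psi 0 j) - cis (- \sum_j psi' 0 j)) <= 2 * m%:R * `|psi - psi'|.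
  apply: le_trans (cis_lipschitz _ _) _; rewrite -mulrA ler_wpM2l//.
  rewrite -opprD normrN -sumrB; apply: le_trans (ler_norm_sum _ _ _) _.
  apply: (@le_trans _ _ (\sum_(j < m) `|psi - psi'|)); first exact: ler_sum.
  by rewrite sumr_const card_ord mulr_natl.
have := normr_ge0 (psi - psi'); lra.
Qed.

Lemma torus_sum_periodic psi psi' :
  (forall j, cis (psi 0 j) = cis (psi' 0 j)) -> torus_sum psi = torus_sum psi'.
Proof.
move=> h; rewrite /torus_sum !cisN !cis_sum.
by rewrite (eq_bigr _ (fun j _ => h j)) (eq_bigr (fun j => cis (psi' 0 j)) (fun j _ => h j)).
Qed.

(** Moving one free coordinate by s moves the determined one by - s, and cis s + cis (- s) does not
    see the sign. *)
Lemma torus_sum_even j (s : R) :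
  torus_sum (s *: delta_mx 0 j) = torus_sum (- s *: delta_mx 0 j).
Proof.
have E (t : R) : torus_sum (t *: delta_mx 0 j) =
    zeta * ((\sum_(k | k != j) 1) + (cis t + cis (- t))) - w.
  have dj k : (t *: delta_mx 0 j : 'rV[R]_m) 0 k = if k == j then t else 0.
    by rewrite !mxE eqxx /=; case: eqP => _; rewrite ?mulr1 ?mulr0.
  rewrite /torus_sum (bigD1 j)//= [X in cis (- X)](bigD1 j)//= !dj eqxx.
  rewrite [X in cis (- (_ + X))]big1 ?addr0 => [|k /negPf kj]; last by rewrite dj kj.
  rewrite (eq_bigr (fun=> 1)) => [|k /negPf kj]; last by rewrite dj kj cis0.
  by ring.
by rewrite !E opprK (addrC (cis s)).
Qed.

Lemma torus_sum_lower_bound : (forall psi, torus_sum psi != 0) ->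
  exists2 d : R, 0 < d & forall psi, d <= modulus (torus_sum psi).
Proof.
move=> nz; have pi2 : 0 < 2 * pi :> R by rewrite mulr_gt0// pi_gt0.
pose Box := [set psi : 'rV[R]_m | forall j, `[0, 2 * pi]%classic (psi 0 j)].
have Kc : compact Box.
  by apply: (@rV_compact R m (fun=> `[0, 2 * pi]%classic)) => j; exact: segment_compact.
have K0 : Box 0 by move=> j; rewrite /= in_itv /= mxE lexx ltW.
have cF : continuous (fun psi => modulus (torus_sum psi)).
  move=> psi; apply: (@continuous_at_of_lipschitz _ _ _ _ (4 * m%:R + 1) 1) => // psi' _.
  apply: le_trans (torus_sum_lipschitz _ _).
  rewrite ler_norml modulus_triangle andbT.
  by rewrite lerNl opprB modulus_distC modulus_triangle.
have [phi _ phimin] := EVT_min_rV (ex_intro _ _ K0) Kc (continuous_subspaceT cF).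
exists (modulus (torus_sum phi)); first by rewrite modulus_gt0.
move=> psi.
have /choice[r Hr] : forall j, exists s : R, 0 <= s < 2 * pi /\
    exists k : int, psi 0 j = s + 2 * pi *~ k.
  by move=> j; have [s s1 s2] := exists_angle (psi 0 j); exists s.
have -> : torus_sum psi = torus_sum (\row_j r j).
  by apply: torus_sum_periodic => j; rewrite mxE; have [_ [k ->]] := Hr j; exact: cis_shift2pi.
apply: phimin; apply: mem_set => j; rewrite /= in_itv /= mxE.
by have [/andP[-> /ltW ->]] := Hr j.
Qed.

Lemma bounded_torus_angle_sum (d : R) : 0 < d -> (forall psi, d <= modulus (torus_sum psi)) ->
  exists e C : R, 0 < e /\ forall psi lam (n : nat), `|lam| < e ->
    `|\sum_(k < n) angle (torus_sum (psi + k.+1%:R *: lam)) (torus_sum (psi + k%:R *: lam))| <= C.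
Proof.
move=> d0 dF; pose Lam : R := 4 * m%:R + 1.
have Lam0 : 0 < Lam by rewrite ltr_wpDl// mulr_ge0.
pose B : R := 4 * pi; pose K := (Num.truncn (Lam * B / (d / 2))).+1.
have dd0 : 0 < d / 2 by rewrite divr_gt0.
exists (Num.min 1 (d / 2 / Lam)), (K%:R * pi); split; first by rewrite lt_min ltr01 divr_gt0.
move=> psi lam n; rewrite lt_min => /andP[lam1 lamd].
apply: (@bounded_angle_sum _ _ torus_sum d Lam d0 Lam0 dF torus_sum_lipschitz
  torus_sum_periodic torus_sum_even B K (lexx _) _ _) => //.
  rewrite ler_pdivrMr ?ltr0n//; have := truncnS_gt (Lam * B / (d / 2)).
  by rewrite ltr_pdivrMr// => /ltW h; apply: le_trans h _; rewrite mulrC.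
by move: lamd; rewrite ltr_pdivlMr// mulrC => /ltW.
Qed.

End Torus.

Lemma dot_col (R : realType) p N (x : 'rV[R]_p) (M : 'M[R]_(p, N)) k :
  dot x (col k M) = (x *m M) 0 k.
Proof. by rewrite /dot !mxE; apply: eq_bigr => i _; rewrite !mxE. Qed.

(** * The region as the set of values of the torus sum *)

Section Circuit.
Variables (R : realType) (m : nat) (beta : 'I_m.+1 -> 'cV[int]_m) (gamma : 'cV[int]_m).
Hypothesis circuit : barycentric_circuit (fun j => to_real R (beta j)) (to_real R gamma).
Variables (c : 'I_m.+1 -> R[i]) (c_gamma : R[i]).
Hypothesis c_neq0 : forall j, c j != 0.

Lemma to_realB (d : nat) (u v : 'cV[int]_d) : to_real R (u - v) = to_real R u - to_real R v.
Proof. by apply/matrixP => i j; rewrite !mxE rmorphB. Qed.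

Lemma sum_to_real_beta : \sum_j to_real R (beta j) = m.+1%:R *: to_real R gamma.
Proof.
have [_ _ ->] := circuit; rewrite scalerA divff ?scale1r// pnatr_eq0 //.
Qed.

Lemma sum_beta_sub_gamma : \sum_j to_real R (beta j - gamma) = 0.
Proof.
under eq_bigr do rewrite to_realB.
by rewrite sumrB sum_to_real_beta sumr_const card_ord scaler_nat subrr.
Qed.

(** The first m differences beta(j) - gamma form a basis, so m pairings can be prescribed; the last
    one is forced because all differences, and all t_j, sum to 0. *)
Lemma circuit_pairing_onto (t : 'I_m.+1 -> R) : \sum_j t j = 0 ->
  exists phi : 'rV[R]_m, forall j, dot phi (to_real R (beta j - gamma)) = t j.
Proof.
move=> t0; have [aff _ _] := circuit.
pose M : 'M[R]_m := \matrix_(i, k) to_real R (beta (lift ord_max k) - gamma) i 0.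
have colM k : col k M = to_real R (beta (lift ord_max k) - gamma).
  by apply/colP => i; rewrite !mxE.
have Mker (u : 'rV[R]_m) : u *m M^T = 0 -> u = 0.
  move=> uM.
  have sum0 : \sum_k u 0 k *: to_real R (beta (lift ord_max k) - gamma) = 0.
    apply/colP => i; transitivity ((u *m M^T) 0 i); last by rewrite uM !mxE.
    by rewrite summxE mxE; apply: eq_bigr => k _; rewrite !mxE.
  pose s := \sum_k u 0 k.
  (* A linear relation among the differences is made affine: subtracting the mean weight makes the
     weights sum to 0, and accounts for s gamma since gamma is the barycenter. *)
  pose l (j : 'I_m.+1) := (if unlift ord_max j is Some k then u 0 k else 0) - s / m.+1%:R.
  have l_lift k : l (lift ord_max k) = u 0 k - s / m.+1%:R by rewrite /l liftK.
  have l_max : l ord_max = - (s / m.+1%:R) by rewrite /l unlift_none sub0r.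
  have m1 : m.+1%:R != 0 :> R by rewrite pnatr_eq0.
  have l0 : forall j, l j = 0.
    apply: aff.
      rewrite /l sumrB sumr_const card_ord -[_ *+ m.+1]mulr_natr divfK//.
      rewrite (bigD1_ord ord_max)//= unlift_none add0r.
      by under eq_bigr do rewrite liftK; rewrite subrr.
    rewrite /l; under eq_bigr do rewrite scalerBl.
    rewrite sumrB -scaler_sumr sum_to_real_beta scalerA divfK//.
    rewrite (bigD1_ord ord_max)//= unlift_none scale0r add0r.
    rewrite /s scaler_suml -sumrB -[RHS]sum0; apply: eq_bigr => k _.
    by rewrite liftK to_realB scalerBr.
  have s0 : s / m.+1%:R = 0 by apply/eqP; rewrite -oppr_eq0 -l_max l0.
  by apply/rowP => k; rewrite mxE; have := l_lift k; rewrite l0 s0 subr0.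
have Mu : M \in unitmx.
  rewrite -unitmx_tr -row_free_unit -kermx_eq0; apply/eqP/row_matrixP => i.
  by rewrite row0; apply: Mker; rewrite -row_mul mulmx_ker row0.
pose phi := (\row_k t (lift ord_max k)) *m invmx M.
have phil k : dot phi (to_real R (beta (lift ord_max k) - gamma)) = t (lift ord_max k).
  by rewrite -colM dot_col mulmxKV// mxE.
exists phi => j; case: (unliftP ord_max j) => [k ->|->]; first exact: phil.
have := dot_sumr phi (index_enum _) xpredT (fun j => to_real R (beta j - gamma)).
rewrite sum_beta_sub_gamma dot0r => /esym/eqP; rewrite (bigD1_ord ord_max)//=.
rewrite (eq_bigr (fun k => t (lift ord_max k)))// addr_eq0 => /eqP ->.
by have := t0; rewrite (bigD1_ord ord_max)//= => /eqP; rewrite addr_eq0 => /eqP ->.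
Qed.

Lemma dot_int_shift (phi : 'rV[R]_m) (k : 'I_m -> int) (v : 'cV[int]_m) :
  exists z : int, dot (\row_i (2 * pi *~ k i)) (to_real R v) = 2 * pi *~ z.
Proof.
exists (\sum_i k i * v i 0).
rewrite /dot mxE -mulrzr rmorph_sum mulr_sumr; apply: eq_bigr => i _.
by rewrite !mxE -mulrzr rmorphM /= mulrA.
Qed.

(** Chosen so that the (m+1)-st power of [cis vertex_phase] is the product of the phases of the
    c_j. *)
Definition vertex_phase : R := (\sum_j arg (c j)) / m.+1%:R.
Definition vertex_gmean : R := \prod_j modulus (c j) `^ (1 + m)%:R^-1.

Lemma vertex_gmean_gt0 : 0 < vertex_gmean.
Proof. by apply: prodr_gt0 => j _; rewrite powR_gt0// modulus_gt0. Qed.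

Definition bary_ratio : R[i] := c_gamma / vertex_gmean%:C%C.

(** A zero would exhibit c_gamma as a point of the region: the angles th_j - arg c_j sum to 0, so
    some phi realises them as pairings, and integrality of the exponents allows phi to be reduced
    modulo 2 pi. *)
Lemma torus_sum_neq0 (psi : 'rV[R]_m) : ~ region c beta gamma c_gamma ->
  torus_sum (cis vertex_phase) bary_ratio psi != 0.
Proof.
move=> reg; apply/eqP => tor0; apply: reg.
have m1 : m.+1%:R != 0 :> R by rewrite pnatr_eq0.
pose th (j : 'I_m.+1) := (if unlift ord_max j is Some k then psi 0 k else - \sum_k psi 0 k) + vertex_phase.
have Esum : \sum_(j < m.+1) (if unlift ord_max j is Some k then psi 0 k else - \sum_k psi 0 k) = 0.
  rewrite (bigD1_ord ord_max)//= unlift_none.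
  rewrite [X in _ + X](eq_bigr (fun k => psi 0 k)) ?addNr// => k _.
  by rewrite liftK.
have [phi Hphi] : exists phi, forall j, dot phi (to_real R (beta j - gamma)) = th j - arg (c j).
  apply: circuit_pairing_onto; rewrite sumrB /th big_split /= sumr_const card_ord.
  by rewrite Esum add0r -[vertex_phase *+ _]mulr_natr divfK// subrr.
have /choice[r Hr] : forall i, exists s : R, 0 <= s < 2 * pi /\
    exists k : int, phi 0 i = s + 2 * pi *~ k.
  by move=> i; have [s s1 s2] := exists_angle (phi 0 i); exists s.
have /choice[k Hk] : forall i, exists k : int, phi 0 i = r i + 2 * pi *~ k.
  by move=> i; have [_ [k Hk]] := Hr i; exists k.
exists (\row_i r i) => /=; first by move=> i; rewrite mxE; have [] := Hr i.
have phiE : phi = \row_i r i + \row_i (2 * pi *~ k i) by apply/rowP => i; rewrite !mxE Hk.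
rewrite -/vertex_gmean.
have g0 : vertex_gmean%:C%C != 0 :> R[i].
  by rewrite -modulus_gt0 modulus_real normr_gt0 gt_eqF ?vertex_gmean_gt0.
have -> : c_gamma = vertex_gmean%:C%C * bary_ratio by rewrite /bary_ratio mulrC divfK.
congr (_ * _); move/eqP : tor0; rewrite /torus_sum subr_eq0 => /eqP <-.
have E j : cexp (0 +i* (arg (c j) + ((\row_i r i) *m to_real R (beta j - gamma)) 0 0))%C = cis (th j).
  rewrite -/(cis _) -/(dot _ _).
  have [z Hz] := dot_int_shift phi k (beta j - gamma).
  have -> : th j = arg (c j) + dot (\row_i r i) (to_real R (beta j - gamma)) + 2 * pi *~ z.
    by rewrite -Hz -addrA -dotDl -phiE Hphi addrC subrK.
  by rewrite cis_shift2pi.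
rewrite (eq_bigr _ (fun j _ => E j)) (bigD1_ord ord_max)//= /th unlift_none cisD.
rewrite [X in _ + X](eq_bigr (fun k => cis (psi 0 k) * cis vertex_phase)); last first.
  by move=> l _; rewrite liftK cisD.
by rewrite -mulr_suml; ring.
Qed.

End Circuit.

(** * The twisted sums of f at the equilibrium point *)

Section LiftedCircuit.
Variables (R : realType) (n m : nat) (A : 'M[R]_(1 + n, m.+2)).
Variables (beta : 'I_m.+1 -> 'cV[int]_m) (gamma : 'cV[int]_m).
Hypothesis circuit : barycentric_circuit (fun j => to_real R (beta j)) (to_real R gamma).
Variable T : 'M[R]_(1 + n, 1 + m).
Hypothesis B_lift : A = T *m circuit_mx R beta gamma.
Variables (c : 'I_m.+1 -> R[i]) (c_gamma : R[i]).
Hypothesis c_neq0 : forall j, c j != 0.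
Variables (y : 'rV[R]_m) (y_eq : is_eq_point c beta y).
Variables (y0 : R) (x0 : 'rV[R]_(1 + n)) (x0T : x0 *m T = row_mx y0%:M y).

Lemma circuit_family_lift X (b : 'I_m.+1 -> X) g j : circuit_family b g (lift ord_max j) = b j.
Proof. by rewrite /circuit_family liftK. Qed.

Lemma circuit_family_max X (b : 'I_m.+1 -> X) g : circuit_family b g ord_max = g.
Proof. by rewrite /circuit_family unlift_none. Qed.

Lemma col_lifted k : col k A = T *m lift_col R (circuit_family beta gamma k).
Proof.
rewrite B_lift; apply/colP => i; rewrite mxE mxE [RHS]mxE.
by apply: eq_bigr => l _; rewrite [circuit_mx _ _ _ _ _]mxE.
Qed.

Lemma col_lifted_max : col ord_max A = T *m lift_col R gamma.
Proof. by rewrite col_lifted circuit_family_max. Qed.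

Lemma dot_x0_lifted (b : 'cV[int]_m) : dot x0 (T *m lift_col R b) = y0 + dot y (to_real R b).
Proof.
rewrite /dot mulmxA x0T /lift_col mul_row_col mxE; congr (_ + _).
by rewrite !mxE big_ord1 !mxE mulr1.
Qed.

Lemma sum_col_sub_center : \sum_(j < m.+1) (col (lift ord_max j) A - col ord_max A) = 0.
Proof.
have E j : col (lift ord_max j) A - col ord_max A = T *m col_mx 0 (to_real R (beta j - gamma)).
  rewrite !col_lifted circuit_family_lift circuit_family_max -mulmxBr; congr (_ *m _).
  by rewrite /lift_col opp_col_mx add_col_mx subrr to_realB.
rewrite (eq_bigr _ (fun j _ => E j)) -mulmx_sumr.
have -> : \sum_(j < m.+1) col_mx (0 : 'cV[R]_1) (to_real R (beta j - gamma)) = 0.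
  have := sum_beta_sub_gamma circuit; set S := \sum_j _ => S0.
  rewrite -[RHS](col_mx0) -[X in col_mx _ X]S0 /S.
  by elim/big_rec2: _ => [|i u v _ ->]; rewrite ?col_mx0// add_col_mx addr0.
by rewrite mulmx0.
Qed.

Let cc := circuit_family c (- c_gamma).
Let alpha := col ord_max A.

(** The displacement of the free torus coordinates under imaginary translation by v. The inner
    [lift] omits the last vertex, whose coordinate is determined; the outer one omits the center. *)
Definition shift_angles v : 'rV[R]_m :=
  \row_i (dot v (col (lift ord_max (lift ord_max i)) A) - dot v alpha).

Let K := modulus (c ord_max) * expR (dot y (to_real R (beta ord_max))).

Lemma vertex_term_eq j : modulus (c j) * expR (dot y (to_real R (beta j))) = K.
Proof. exact: y_eq. Qed.

(** All vertex terms equal K, hence so does their geometric mean, whose exponent is <y, gamma>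
    because gamma is the barycenter. *)
Lemma center_term_eq : vertex_gmean c * expR (dot y (to_real R gamma)) = K.
Proof.
have m1 : m.+1%:R != 0 :> R by rewrite pnatr_eq0.
have K0 : 0 < K by rewrite mulr_gt0 ?expR_gt0// modulus_gt0.
have -> : dot y (to_real R gamma) = \sum_j dot y (to_real R (beta j)) * m.+1%:R^-1.
  by rewrite -mulr_suml -dot_sumr (sum_to_real_beta circuit) dotZr mulrAC divff ?mul1r.
rewrite expR_sum /vertex_gmean -big_split /=.
rewrite (eq_bigr (fun=> K `^ m.+1%:R^-1)).
  by rewrite prodr_const card_ord -powR_mulrn ?powR_ge0// -powRrM mulVf// powRr1// ltW.
move=> j _; rewrite -(vertex_term_eq j) powRM ?modulus_ge0 ?expR_ge0//.
by rewrite -expRM.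
Qed.

(** At x0 all vertex terms have the same modulus, so only their phases relative to the center vary.
    The base point psi depends on chi alone; v enters through a translation of the torus. *)
Lemma circuit_value : exists2 E : R, 0 < E & forall chi : character A, exists psi, forall v,
  cis (- dot v alpha) * tsum A cc (char_vals (char_mul (phase_char A v) chi)) x0 =
  (E%:C%C * char_vals chi ord_max) *
    torus_sum (cis (vertex_phase c)) (bary_ratio c c_gamma) (psi + shift_angles v).
Proof.
have m1 : m.+1%:R != 0 :> R by rewrite pnatr_eq0.
have K0 : 0 < K by rewrite mulr_gt0 ?expR_gt0// modulus_gt0.
exists (expR y0 * K); first by rewrite mulr_gt0 ?expR_gt0.
move=> chi; pose g := char_vals chi ord_max.
have nz u : char_fun chi u != 0 by rewrite -modulus_gt0 char_unit.
pose U j := cis (arg (c j) - vertex_phase c) * (char_vals chi (lift ord_max j) / g).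
have U1 j : modulus (U j) = 1.
  by rewrite /U modulusM modulus_cis modulusM modulusV !modulus_char_vals invr1 !mul1r.
(* The arguments cancel by the choice of [vertex_phase], the character values because the vertex
   columns sum to m + 1 times the center column. *)
have prodU : \prod_j U j = 1.
  rewrite /U big_split /= -cis_sum sumrB sumr_const card_ord.
  rewrite -[vertex_phase c *+ _]mulr_natr divfK// subrr cis0 mul1r.
  rewrite prodf_div prodr_const card_ord -char_sum.
  have -> : \sum_j zspan_gen A (lift ord_max j) = zspan_gen A ord_max *+ m.+1.
    apply: val_inj; rewrite raddf_sum raddfMn /=.
    have := sum_col_sub_center; rewrite sumrB sumr_const card_ord => /eqP.
    by rewrite subr_eq0 => /eqP.
  have charX k : chi (zspan_gen A ord_max *+ k) = g ^+ k.
    elim: k => [|k IH]; first by rewrite mulr0n char_zero.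
    by rewrite mulrS char_morph IH exprS.
  rewrite charX.
  by rewrite divff// expf_neq0// nz.
have /choice[psi Hpsi] : forall k, exists t, cis t = U (lift ord_max k).
  by move=> k; exact: exists_cis.
exists (\row_k psi k) => v.
have psimax : cis (- \sum_k psi k) = U ord_max.
  move: prodU; rewrite (bigD1_ord ord_max)//= cisN cis_sum.
  rewrite (eq_bigr _ (fun k _ => Hpsi k)) => h.
  have P0 : \prod_k U (lift ord_max k) != 0.
    by apply/prodf_neq0 => k _; rewrite -modulus_gt0 U1.
  by apply: (mulIf P0); rewrite mulVf.
pose lam j := dot v (col (lift ord_max j) A) - dot v alpha.
have lam0 : \sum_j lam j = 0.
  rewrite -[RHS](dot0r v) -[in RHS]sum_col_sub_center dot_sumr.
  by apply: eq_bigr => j _; rewrite dotDr dotNr.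
have lammax : - \sum_k lam (lift ord_max k) = lam ord_max.
  by move: lam0; rewrite (bigD1_ord ord_max)//= => /eqP; rewrite addr_eq0 => /eqP ->.
have tor : torus_sum (cis (vertex_phase c)) (bary_ratio c c_gamma) (\row_k psi k + shift_angles v) =
   \sum_j cis (vertex_phase c) * (U j * cis (lam j)) - bary_ratio c c_gamma.
  rewrite /torus_sum; congr (_ - _); rewrite -mulr_sumr; congr (_ * _).
  rewrite [RHS](bigD1_ord ord_max)//= [RHS]addrC; congr (_ + _).
    by apply: eq_bigr => k _; rewrite !mxE cisD Hpsi.
  rewrite -psimax -lammax -cisD -opprD -big_split /=; congr (cis (- _)).
  by apply: eq_bigr => k _; rewrite !mxE.
have g0 : g != 0 := nz _.
rewrite tor /tsum (bigD1_ord ord_max)//= {1}/cc circuit_family_max.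
rewrite mulrDr mulr_sumr mulrBr mulr_sumr addrC; congr (_ + _).
  apply: eq_bigr => j _; rewrite /cc circuit_family_lift col_lifted circuit_family_lift.
  rewrite dot_x0_lifted -(vertex_term_eq j) -/(char_vals chi (lift ord_max j)).
  rewrite {1}(modulus_cis_arg (c j)) /U /lam !cisD !cisN !expRD !rmorphM /=.
  rewrite -/g col_lifted circuit_family_lift.
  by field; rewrite !cis_neq0 g0.
rewrite col_lifted_max dot_x0_lifted -center_term_eq -/(char_vals chi ord_max).
have v0 : (vertex_gmean c)%:C%C != 0 :> R[i].
  by rewrite -modulus_gt0 modulus_real normr_gt0 gt_eqF ?vertex_gmean_gt0.
rewrite /bary_ratio cisN !expRD !rmorphM /= -/g -col_lifted_max -/alpha.
by field; rewrite v0 cis_neq0.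
Qed.

End LiftedCircuit.

(** * Propagation of an affine germ over a component *)

Section LocallyAffine.
Variables (R : realType) (p : nat) (h : 'rV[R]_p -> R) (alpha : 'cV[R]_p).
Implicit Types x q w : 'rV[R]_p.

Definition locally_affine x := exists2 e : R, 0 < e &
  forall w, `|w| < e -> h (x + w) - h x = dot w alpha.

Lemma locally_affine_open x : locally_affine x ->
  exists2 e : R, 0 < e & forall q, `|q - x| < e -> locally_affine q.
Proof.
move=> [e e0 He]; exists (e / 2); first by rewrite divr_gt0.
move=> q qe; exists (e / 2); first by rewrite divr_gt0.
move=> w we.
have h1 : `|q - x + w| < e by apply: le_lt_trans (ler_normD _ _) _; lra.
have h2 : `|q - x| < e by lra.
have g1 := He _ h1; have g2 := He _ h2.
have xq : x + (q - x) = q by rewrite addrC subrK.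
rewrite addrA xq dotDl in g1; rewrite xq in g2; lra.
Qed.

(** The first hypothesis says that an affine germ with gradient [alpha] anywhere in a small ball
    passes to its center. The affine points are thus relatively closed in U; being open as well,
    they fill the component. *)
Lemma locally_affine_component (U : set 'rV[R]_p) x0 x :
  (forall q, U q -> exists2 r : R, 0 < r &
     forall q', `|q' - q| < r -> locally_affine q' -> locally_affine q) ->
  U x0 -> locally_affine x0 -> connected_component U x0 x -> locally_affine x.
Proof.
move=> spread Ux0 l0 xC; pose C := connected_component U x0.
pose G := [set q | locally_affine q].
have Gopen : open G.
  rewrite openE => q /locally_affine_open[e e0 He]; apply/nbhs_ballP.
  exists e; first exact: e0.
  by move=> q'; rewrite -ball_normE /= distrC; apply: He.
have CG : C `&` closure G = C `&` G.
  apply/seteqP; split=> q [Cq Gq]; split=> //; last exact: subset_closure.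
  have [r r0 Hr] := spread _ (connected_component_sub Cq).
  have [q' [Gq' qq']] := Gq _ (nbhsx_ballx _ _ r0).
  by apply: Hr Gq'; rewrite distrC; move: qq'; rewrite -ball_normE.
suff E : C `&` G = C by have [] : (C `&` G) x by rewrite E.
apply: (@component_connected _ U x0).
- by exists x0; split => //; apply: connected_component_refl.
- by exists G.
- by exists (closure G) => //; exact: closed_closure.
Qed.

Lemma has_gradient_locally_affine x : locally_affine x -> has_gradient h x alpha.
Proof.
move=> [e e0 He]; rewrite /has_gradient.
have lin : linear (fun v : 'rV[R]_p => (v *m alpha) 0 0 : R^o).
  by move=> k u v; rewrite -/(dot _ _) dotDl dotZl.
pose L := GRing.isLinear.Build _ _ _ _ _ lin.
pose df : {linear 'rV[R]_p -> R^o} := HB.pack (fun v : 'rV[R]_p => (v *m alpha) 0 0 : R^o) L.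
have cdf : continuous df.
  move=> q; apply: (@continuous_at_of_lipschitz _ _ _ _ (\sum_i `|alpha i 0|) 1) => // q' _.
  rewrite /= -!/(dot _ _) -dotNl -dotDl mulrC; exact: norm_dot_le.
have E : (h : 'rV[R]_p -> R^o) \o shift x =
    (cst (h x) + (df : 'rV[R]_p -> R^o)) +o_ (0 : 'rV[R]_p) id.
  apply/eqaddoP => eps eps0; near=> w.
  have we : `|w| < e.
    near: w; apply/nbhs_ballP; exists e => //= w; rewrite -ball_normE /= sub0r normrN.
    by [].
  have := He w we; rewrite (addrC x) => hw.
  have -> : ((h : 'rV[R]_p -> R^o) \o shift x - (cst (h x) + df)) w = 0.
    rewrite /= -[LHS]/(h (w + x) - (h x + dot w alpha)) -hw; ring.
  by rewrite normr0 mulr_ge0// ltW.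
have dE := diff_unique cdf E.
apply: DiffDef; last exact: dE.
by apply/diff_locallyP; rewrite dE.
Unshelve. all: by end_near. Qed.

End LocallyAffine.

(** * The complement of the amoeba *)

Section Component.
Variables (R : realType) (p N : nat) (A : 'M[R]_(p, N)) (c : 'I_N -> R[i]).
Variables (eta : probability (dual A) R) (eta_haar : is_haar eta).
Hypothesis Ainj : injective (fun j => col j A).
Variables (i0 i1 : 'I_N) (i01 : i0 != i1) (c0 : c i0 != 0) (c1 : c i1 != 0).
Variable alpha : 'cV[R]_p.
Implicit Types x q w : 'rV[R]_p.

Let f := exp_sum A c.

Lemma lower_bounded_complement x : ~ amoeba f x -> exists2 d : R, 0 < d & lower_bounded A c x d.
Proof.
move=> /(amoeba_lower_bound Ainj i01 c0 c1)[d d0 Hd]; exists d => // chi.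
exact: tsum_character_lower_bound.
Qed.

Lemma locally_affine_spread x : ~ amoeba f x -> exists2 r : R, 0 < r &
  forall q, `|q - x| < r -> locally_affine (ronkin c eta) alpha q -> locally_affine (ronkin c eta) alpha x.
Proof.
move=> /lower_bounded_complement[d d0 Hd].
have [r r0 Hr] := lower_bounded_midpoint eta_haar d0 Hd.
exists r; first exact: r0.
move=> q qr [e e0 He].
(* Near q the function is exactly affine, so the quadratic error constant is 0. *)
have H := @midpoint_affine_propagation _ _ (ronkin c eta) x r alpha q e 0 Hr qr e0.
have {}H : forall q', `|q' - x| < r -> ronkin c eta q' - ronkin c eta q = dot (q' - q) alpha.
  by apply: H => w we; rewrite He// subrr normr0 mul0r.
exists r; first exact: r0.
move=> w wr.
have xw : `|x + w - x| < r by rewrite addrAC subrr add0r.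
have xx : `|x - x| < r by rewrite subrr normr0.
have h1 := H _ xw; have h2 := H _ xx.
have E : dot w alpha = dot (x + w - q) alpha - dot (x - q) alpha.
  by rewrite -dotNl -dotDl; congr dot; apply/rowP => i; rewrite !mxE; ring.
by rewrite E -h1 -h2; move: (ronkin _ _ _) (ronkin _ _ _) (ronkin _ _ _) => X Y Z; ring.
Qed.

End Component.

Theorem corollary6p3 (R : realType) (n m : nat)
    (A : 'M[R]_(1 + n, m.+2))
    (A_card : injective (fun k => col k A))
    (A_hom : pseudo_homogeneous A)
    (beta : 'I_m.+1 -> 'cV[int]_m) (gamma : 'cV[int]_m)
    (B_circuit : barycentric_circuit (fun j => to_real R (beta j))
                                     (to_real R gamma))
    (T : 'M[R]_(1 + n, 1 + m))
    (B_lift : A = T *m circuit_mx R beta gamma)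
    (B_rational : rational_mx (circuit_mx R beta gamma))
    (c : 'I_m.+1 -> R[i]) (c_gamma : R[i])
    (c_neq0 : forall j, c j != 0)
    (y : 'rV[R]_m) (y_eq : is_eq_point c beta y)
    (y_HT : exists y0 : R, H_ T (row_mx y0%:M y))
    (c_gamma_out : ~ region c beta gamma c_gamma)
    (eta : probability (dual A) R) (eta_haar : is_haar eta) :
  order_component (circuit_family c (- c_gamma)) eta (T *m lift_col R gamma)
    !=set0.
Proof.
have [y0 [x0 _ x0T]] := y_HT.
pose cc := circuit_family c (- c_gamma).
have Ealpha := col_lifted_max B_lift.
rewrite -Ealpha; set alpha := col ord_max A.
(* In dimension 0 the center would coincide with the vertex. For m > 0 two vertex columns are
   available for Hurwitz's theorem, with nonzero coefficients even if c_gamma = 0. *)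
have m0 : (0 < m)%N.
  rewrite lt0n; apply/eqP => mz; have [_ gb _] := B_circuit.
  by move: (gb ord0) => /eqP; apply; apply/colP => i; have := ltn_ord i; rewrite {2}mz.
pose i0 : 'I_m.+2 := lift ord_max ord0; pose i1 : 'I_m.+2 := lift ord_max ord_max.
have i01 : i0 != i1.
  apply/eqP => /lift_inj /(congr1 val) /= E; by rewrite -E in m0.
have ci0 : cc i0 != 0 by rewrite /cc circuit_family_lift.
have ci1 : cc i1 != 0 by rewrite /cc circuit_family_lift.
have zeta1 : modulus (cis (vertex_phase c)) = 1 := modulus_cis _.
pose F := @torus_sum R m (cis (vertex_phase c)) (bary_ratio c c_gamma).
have [d d0 Fd] := torus_sum_lower_bound zeta1 (fun psi => torus_sum_neq0 B_circuit c_neq0 psi c_gamma_out).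
have [E E0 HE] := circuit_value B_circuit B_lift c_gamma c_neq0 y_eq x0T.
have value chi : exists2 psi, forall v, tsum A cc (char_vals (char_mul (phase_char A v) chi)) x0 =
    (cis (dot v alpha) * (E%:C%C * char_vals chi ord_max)) * F (psi + shift_angles A v) &
    tsum A cc (char_vals chi) x0 = (E%:C%C * char_vals chi ord_max) * F psi.
  have [psi Hpsi] := HE chi.
  have H v : tsum A cc (char_vals (char_mul (phase_char A v) chi)) x0 =
      (cis (dot v alpha) * (E%:C%C * char_vals chi ord_max)) * F (psi + shift_angles A v).
    by rewrite -mulrA -(Hpsi v) mulrA cisN divff ?cis_neq0// mul1r.
  exists psi => //; have := H 0.
  rewrite dot0l cis0 mul1r (_ : shift_angles A 0 = 0) ?addr0; last first.
    by apply/rowP => i; rewrite !mxE !dot0l subrr.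
  move=> <-; apply: eq_bigr => j _; congr (_ * _ * _).
  by rewrite char_vals_mul char_vals_phase /phases dot0l cis0 mul1r.
have Echi chi : modulus (E%:C%C * char_vals chi ord_max) = E :> R.
  by rewrite modulusM modulus_char_vals mulr1 modulus_real gtr0_norm.
have lb : lower_bounded A cc x0 (E * d).
  move=> chi; have [psi _ ->] := value chi.
  by rewrite modulusM Echi ler_pM2l.
have Ed0 : 0 < E * d by rewrite mulr_gt0.
have x0A : ~ amoeba (exp_sum A cc) x0.
  apply: (lower_bound_notin_amoeba Ed0) => theta.
  exact: lb (phase_char A theta).
have [e [C [e0 HC]]] := bounded_torus_angle_sum zeta1 d0 Fd.
have [r [K [r0 HK]]] := ronkin_first_order eta alpha Ed0 lb.
pose kap := colbound A + \sum_i `|alpha i 0|.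
have kap0 : 0 < kap by rewrite ltr_pwDl ?colbound_gt0// sumr_ge0.
have small v : `|v| < e / kap -> `|shift_angles A v| < e.
  move=> ve; apply: (@le_lt_trans _ _ (`|v| * kap)); last by rewrite -ltr_pdivlMr.
  rewrite {1}/Num.norm /= mx_normrE; apply: bigmax_le => [|[i j] _ /=].
    by rewrite mulr_ge0// ltW.
  rewrite mxE; apply: le_trans (ler_normB _ _) _; rewrite mulrDr lerD//.
    exact: norm_dot_col.
  exact: norm_dot_le.
have turn0 v : `|v| < r -> `|v| < e / kap -> haar_mean eta (turn cc alpha x0 v) = 0.
  move=> vr ve; have [bt _] := HK v vr.
  apply: (haar_mean_turn_eq0 eta_haar (C := C) bt) => chi k.
  have [psi Hpsi _] := value chi.
  have shiftD u u' : shift_angles A (u + u') = shift_angles A u + shift_angles A u'.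
    by apply/rowP => i; rewrite !mxE !dotDl; ring.
  have shiftZ (t : R) u : shift_angles A (t *: u) = t *: shift_angles A u.
    by apply/rowP => i; rewrite !mxE !dotZl; ring.
  apply: le_trans (HC psi (shift_angles A v) k (small v ve)).
  rewrite le_eqVlt; apply/orP; left; apply/eqP; congr `|_|; apply: eq_bigr => l _.
  rewrite /turn.
  have -> : tsum A cc (char_vals (char_mul (phase_char A v) (char_mul (phase_char A (l%:R *: v)) chi))) x0 =
     tsum A cc (char_vals (char_mul (phase_char A (l.+1%:R *: v)) chi)) x0.
    apply: eq_bigr => j _; congr (_ * _ * _).
    rewrite !char_vals_mul !char_vals_phase mulrA -phasesD.
    by rewrite -natr1 scalerDl scale1r addrC.
  rewrite !Hpsi !shiftZ.
  (* Removing the phase of one step along [alpha] leaves the same factor as at the previous point;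
     [angle_scale] cancels it, and only the turning of the torus sum remains. *)
  have -> : cis (- dot v alpha) * (cis (dot (l.+1%:R *: v) alpha) * (E%:C%C * char_vals chi ord_max) * F (psi + l.+1%:R *: shift_angles A v)) =
     (cis (dot (l%:R *: v) alpha) * (E%:C%C * char_vals chi ord_max)) * F (psi + l.+1%:R *: shift_angles A v).
    rewrite -natr1 scalerDl scale1r dotDl cisD cisN.
    by field; rewrite cis_neq0.
  rewrite angle_scale//.
  by rewrite -modulus_gt0 modulusM modulus_cis mul1r Echi.
have aff0 : locally_affine (ronkin cc eta) alpha x0.
  have [r' r'0 Hr'] := lower_bounded_midpoint eta_haar Ed0 lb.
  exists r' => // w wr.
  have h : `|x0 + w - x0| < r' by rewrite addrAC subrr add0r.
  (* With vanishing mean turning, [ronkin_first_order] is exactly the quadratic bound needed at x0;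
     it holds for |v| below both r and e / kap. *)
  have := @midpoint_affine_propagation _ _ (ronkin cc eta) x0 r' alpha x0
    (Num.min r (e / kap)) K Hr' _ _ _ (x0 + w) h.
  rewrite addrAC subrr add0r normr0; apply => //.
    by rewrite lt_min r0 divr_gt0.
  move=> v; rewrite lt_min => /andP[vr ve].
  by have [_] := HK v vr; rewrite turn0// subr0.
exists x0; exists (connected_component (~` amoeba (exp_sum A cc)) x0); last exact: connected_component_refl.
split; first by exists x0.
move=> x xC; apply: has_gradient_locally_affine.
have spread := @locally_affine_spread _ _ _ _ _ eta eta_haar A_card i0 i1 i01 ci0 ci1 alpha.
exact: (locally_affine_component spread x0A aff0 xC).
Qed.
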